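(* Let $p\ge1$, $J=\{1,\dots,p\}$, $H\subset J$, and let $T_H$ be a Brownian $H$-tent. For a multi-index $\nu=(\nu_j)_{j\in H}\in\mathbb{N}^{\#H}$, where $\mathbb{N}=\{1,2,3,\dots\}$, write $|\nu|=\prod_{j\in H}\nu_j$. Then the Karhunen–Loève expansion $$T_H(t_H)=\sum_{\nu\in\mathbb{N}^{\#H}}\frac{Z_\nu}{|\nu|\,\pi^{\#H}}\prod_{j\in H}\big(\sqrt2\,\sin(\nu_j\pi t_j)\big)$$ holds with $\{Z_\nu:\nu\in\mathbb{N}^{\#H}\}$ i.i.d. standard Gaussian variables, and the probability law of the squared norm of the Brownian tent is given by $$\|T_H\|^2=\sum_{\nu\in\mathbb{N}^{\#H}}\frac{Z_\nu^2}{|\nu|^2\,\pi^{2\#H}},$$ where $\|\cdot\|$ is the norm of $L^2(C_H)$.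
   Context: For $t=(t_1,\dots,t_p)\in[0,1]^p$, $t_H$ is the point with coordinates $(t_H)_j=t_j$ if $j\in H$ and $(t_H)_j=1$ if $j\notin H$; $C_H=\{t_H:t\in[0,1]^p\}$, and $\#H$ is the cardinality of $H$. $L^2(C_H)$ is taken with respect to the $\#H$-dimensional Lebesgue measure in the coordinates $(t_j)_{j\in H}$ (for $H=\emptyset$, unit mass at the single point of $C_\emptyset$; empty products equal $1$ and $\mathbb{N}^0$ has a single element). A Brownian $H$-tent is a centred Gaussian process $T_H$ on $C_H$ with covariances $\mathbf{E}\,T_H(s)T_H(t)=\prod_{j\in H}(s_j\wedge t_j-s_jt_j)$, where $a\wedge b=\min(a,b)$.
   Formalization: For the squared-norm identity only, the tent is assumed jointly measurable in the sample point and t (true for continuous paths); without this the norm of L²(C_H) of a path may be undefined. The expansion is read as uniform mean-square convergence. *)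

(* Defs.v *)
From HB Require Import structures.
From mathcomp Require Import all_boot all_order all_algebra finmap.
From mathcomp Require Import all_classical all_reals all_analysis.
From mathcomp Require Import measurable_realfun.

Set Implicit Arguments.
Unset Strict Implicit.
Unset Printing Implicit Defensive.

Import Order.TTheory GRing.Theory Num.Theory.
Import numFieldNormedType.Exports.

Local Open Scope classical_set_scope.
Local Open Scope ring_scope.

Section lebesgue_tuple.
Context {R : realType}.

Definition tuple_cons n (x : measurableTypeR R * n.-tuple R) : n.+1.-tuple R :=
  [tuple of x.1 :: x.2].

Lemma measurable_tuple_cons n : measurable_fun setT (@tuple_cons n).
Proof. exact: (@measurable_cons _ _ _ R fst n snd). Qed.

Section cons_measure.
Variables (n : nat) (mu : {sigma_finite_measure set (n.-tuple R) -> \bar R}).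

Definition cons_measure : set (n.+1.-tuple R) -> \bar R :=
  pushforward ((@lebesgue_measure R) \x mu)%E (@tuple_cons n).

Let cons_measure0 : cons_measure set0 = 0%E.
Proof. by rewrite /cons_measure /pushforward preimage_set0 measure0. Qed.

Let cons_measure_ge0 A : (0 <= cons_measure A)%E.
Proof. by rewrite /cons_measure /pushforward measure_ge0. Qed.

Let cons_measure_sigma_additive : semi_sigma_additive cons_measure.
Proof.
move=> F mF tF mUF.
have H (U : set (n.+1.-tuple R)) : measurable U ->
    measurable (@tuple_cons n @^-1` U).
  by move=> mU; rewrite -[X in measurable X]setTI; exact: measurable_tuple_cons.
rewrite /cons_measure /pushforward preimage_bigcup.
apply: measure_semi_sigma_additive => //.
- by move=> k; exact: H.
- apply/trivIsetP => /= i j _ _ ij; rewrite -preimage_setI.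
  by move/trivIsetP : tF => /(_ _ _ _ _ ij) ->//; rewrite preimage_set0.
- by rewrite -preimage_bigcup; exact: H.
Qed.

HB.instance Definition _ := isMeasure.Build _ _ _ cons_measure
  cons_measure0 cons_measure_ge0 cons_measure_sigma_additive.

Let cons_measure_sigma_finite : sigma_finite setT cons_measure.
Proof.
have /sigma_finiteP[F [FT ndF Foo]] := sigma_finiteT (@lebesgue_measure R).
have /sigma_finiteP[G [GT ndG Goo]] := sigma_finiteT mu.
pose g (v : n.+1.-tuple R) : measurableTypeR R * n.-tuple R :=
  (thead v, [tuple of behead v]).
have mg : measurable_fun setT g.
  apply/measurable_fun_pair; last exact: measurable_behead.
  exact: (@measurable_tnth _ R).
have gK (x : measurableTypeR R * n.-tuple R) : g (tuple_cons x) = x.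
  by case: x => x v; congr pair; exact/val_inj.
exists (fun k => g @^-1` (F k `*` G k)).
  apply/seteqP; split => // v _; rewrite -preimage_bigcup /=.
  have [k _ Fv] : (\bigcup_k F k) (g v).1 by rewrite -FT.
  have [l _ Gv] : (\bigcup_k G k) (g v).2 by rewrite -GT.
  exists (maxn k l) => //; split => /=.
  - by move: Fv; exact/subsetPset/ndF/leq_maxl.
  - by move: Gv; exact/subsetPset/ndG/leq_maxr.
move=> k; have [mFk Fkoo] := Foo k; have [mGk Gkoo] := Goo k; split.
  by rewrite -[X in measurable X]setTI; apply: mg => //; exact: measurableX.
rewrite /cons_measure /pushforward -comp_preimage.
rewrite (_ : g \o _ = id) ?preimage_id; last exact/funext.
by rewrite product_measure1E// lte_mul_pinfty// ge0_fin_numE.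
Qed.

HB.instance Definition _ := Measure_isSigmaFinite.Build _ _ _ cons_measure
  cons_measure_sigma_finite.

End cons_measure.

(* n-dimensional Lebesgue measure: the n-fold product of [lebesgue_measure];
   for n = 0 it is the unit mass at the empty tuple. *)
Fixpoint lebesgue_tuple n : {sigma_finite_measure set (n.-tuple R) -> \bar R} :=
  match n with
  | 0 => \d_[tuple]
  | m.+1 => cons_measure (lebesgue_tuple m)
  end.

End lebesgue_tuple.

Section gaussian.
Context {d} {Omega : measurableType d} {R : realType}.
Variable P : probability Omega R.

(* Gaussian laws include the degenerate ones. The case s = 0 is split off
   because [normal_prob m 0] is the uniform distribution on [0, 1]. *)
Definition gaussian_law (m s : R) : set R -> \bar R :=
  if s == 0 then \d_m else normal_prob m s.

Definition is_gaussian (X : Omega -> R) : Prop :=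
  exists m s, forall B, measurable B -> P (X @^-1` B) = gaussian_law m s B.

Definition gaussian_process (U : Type) (D : set U) (X : U -> Omega -> R) : Prop :=
  forall (n : nat) (a : 'I_n -> R) (t : 'I_n -> U), (forall i, D (t i)) ->
    is_gaussian (fun w => \sum_(i < n) a i * X (t i) w).

Definition mutually_independent (I : choiceType) (Z : I -> Omega -> R) : Prop :=
  forall (F : {fset I}) (B : I -> set R), (forall i, measurable (B i)) ->
    P (\bigcap_(i in [set i | i \in F]) (Z i @^-1` B i)) =
    (\prod_(i <- F) P (Z i @^-1` B i))%E.

Definition iid_standard_gaussian (I : choiceType) (Z : I -> Omega -> R) : Prop :=
  mutually_independent Z /\
  forall i B, measurable B -> P (Z i @^-1` B) = normal_prob 0 1 B.

(* The unordered series \sum_i f i t converges to X t in mean square,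
   uniformly in t \in D. *)
Definition uniform_mean_square_sum (I : choiceType) (U : Type) (D : set U)
    (f : I -> U -> Omega -> R) (X : U -> Omega -> R) : Prop :=
  forall eps : R, 0 < eps -> exists F0 : {fset I},
    forall F : {fset I}, (F0 `<=` F)%fset -> forall t, D t ->
      ('E_P[fun w => ((X t w - \sum_(i <- F) f i t w) ^+ 2)%R] <= eps%:E)%E.

End gaussian.

Section faces.
Context {R : realType} {p : nat}.
Implicit Types (H : {set 'I_p}) (s t : 'rV[R]_p).

Definition cube : set 'rV[R]_p := [set t | forall j, 0 <= t ord0 j <= 1].

(* t_H *)
Definition face_proj H t : 'rV[R]_p := \row_j (if j \in H then t ord0 j else 1).

(* C_H *)
Definition face H : set 'rV[R]_p := face_proj H @` cube.

Definition unit_box n : set (n.-tuple R) :=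
  [set u | forall k, 0 <= tnth u k <= 1].
Arguments unit_box n : clear implicits.

(* The point of C_H with coordinates u in the directions j \in H, listed
   increasingly. For j \notin H the index is #|H| and [nth] returns 1. *)
Definition face_point H (u : #|H|.-tuple R) : 'rV[R]_p :=
  \row_j nth 1 u (index j (enum H)).

Definition face_integral H (f : 'rV[R]_p -> R) : \bar R :=
  (\int[lebesgue_tuple #|H|]_(u in unit_box #|H|) (f (face_point u))%:E)%E.

(* The norm of L^2(C_H). *)
Definition face_L2norm H (f : 'rV[R]_p -> R) : \bar R :=
  ('N[lebesgue_tuple #|H|]_(2%:E)
    [(fun u => (f (face_point u))%:E) \_ (unit_box #|H|)])%E.

Definition tent_cov H s t : R :=
  \prod_(j in H) (Num.min (s ord0 j) (t ord0 j) - s ord0 j * t ord0 j).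

(* N^{#H} with N = {1, 2, ...}; the k-th entry belongs to the k-th element
   [enum_val k] of H. *)
Definition multiindex H :=
  {nu : {ffun 'I_#|H| -> nat} | [forall k, (0 < nu k)%N]}.

Definition mi_norm H (nu : multiindex H) : nat := (\prod_(k < #|H|) val nu k)%N.

Definition tent_eigenfun H (nu : multiindex H) t : R :=
  \prod_(k < #|H|)
    (Num.sqrt 2 * sin ((val nu k)%:R * pi * t ord0 (enum_val k))).

(* Orthonormal system of L^2(C_H) made of eigenfunctions of the integral
   operator with kernel K, for the positive eigenvalues lambda. *)
Definition orthonormal_eigensystem H (K : 'rV[R]_p -> 'rV[R]_p -> R)
    (I : eqType) (lambda : I -> R) (e : I -> 'rV[R]_p -> R) : Prop :=
  [/\ forall i j, face_integral H (fun t => e i t * e j t) = ((i == j)%:R)%:E,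
      forall i, 0 < lambda i &
      forall i s, face H s ->
        face_integral H (fun t => K s t * e i t) = (lambda i * e i s)%:E].

Context {d} {Omega : measurableType d} (P : probability Omega R).

(* T is a process on C_H: its values outside [face H] play no role. *)
Definition brownian_tent H (T : 'rV[R]_p -> {RV P >-> R}) : Prop :=
  [/\ gaussian_process P (face H) (fun t => T t : Omega -> R),
      forall t, face H t -> ('E_P[T t] = 0)%E &
      forall s t, face H s -> face H t ->
        ('E_P[fun w => (T s w * T t w)%R] = (tent_cov H s t)%:E)%E].

Definition jointly_measurable H (T : 'rV[R]_p -> Omega -> R) : Prop :=
  measurable_fun ([set: Omega] `*` unit_box #|H|)
    (fun x : Omega * #|H|.-tuple R => T (face_point x.2) x.1).

End faces.

(* Main.v *)
(** The Brownian bridge kernel k(s,t) = min s t - s t, sampled on the grid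
    {i/N}, is the inverse of a second difference, so the sampled sines
    sqrt 2 sin (m pi i/N) diagonalise it exactly; letting N tend to infinity in
    this finite spectral theorem gives the eigenvalue equation and a Mercer
    expansion with remainder 16/M. The tent kernel is a product of bridge
    kernels, its eigenfunctions are products of sines.

    The Riemann sums N^-n sum_g e_nu(g/N) T(g/N), for N = 2^k, form a Cauchy
    sequence in L^2(P) because their covariances are the eigenvalues of the grid
    kernel; the normalised limits Z_nu satisfy E Z_nu T(u) = sqrt lambda_nu e_nu(u)
    and E Z_nu Z_mu = delta, so the mean square of T(u) - S_F(u) is the remainder
    in Mercer's expansion.

    Every finite combination sum a_i Z_i is an L^2 limit of centred Gaussians,
    hence E cos (sum a_i Z_i + c) = exp (- sum a_i^2 / 2) cos c. Shifted cosines
    determine finite signed measures on the line, which yields independence, one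
    variable at a time.

    For the norms, Tonelli and Fatou give liminf_k D_k = 0 almost surely, where
    D_k is the squared distance of the path to its k-th partial sum, and
    f^2 <= (1 + h) g^2 + (1 + 1/h) (f - g)^2 compares the two squared norms in
    both directions. *)

Require Import Defs.
From HB Require Import structures.
From mathcomp Require Import all_boot all_order all_algebra finmap.
From mathcomp Require Import all_classical all_reals all_analysis.
From mathcomp Require Import measurable_realfun.
From mathcomp Require Import ring lra zify.

Set Implicit Arguments.
Unset Strict Implicit.
Unset Printing Implicit Defensive.

Import Order.TTheory GRing.Theory Num.Theory.
Import numFieldNormedType.Exports.

Local Open Scope classical_set_scope.
Local Open Scope ring_scope.

(** * The Brownian bridge kernel *)

(** The tent is given by its finite-dimensional laws, and joint measurability is assumed for the
    norm alone. The coefficients Z_nu can therefore not be defined as integrals of paths. Riemann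
    sums are finite combinations of values of T, so their covariances and Gaussian laws are
    available; dyadic grids are nested, and on nested grids these covariances are exact, every limit
    being a product of one-dimensional ones. Mercer's expansion has a second use. Combinations of
    four bridge kernels are trapezoids, so the same remainder bound yields the trigonometric
    approximation of indicators of intervals on which the uniqueness of the cosine transform rests.
    The free phase c lets real cosines carry the whole characteristic function. The bound on E D_k
    is of order 1/k, which is not summable, so Fatou provides a liminf instead of an almost sure
    limit. This suffices because the squared norms of the partial sums increase with k. *)

Section discrete_sines.
Context {R : realType}.
Implicit Types (s t x : R) (m i j N M : nat).

Definition sine_fun m x : R := Num.sqrt 2 * sin (m%:R * pi * x).

Definition bridge_cov s t : R := Num.min s t - s * t.

Definition bridge_eig m : R := (m%:R * pi) ^- 2.

(* The eigenvalues of the N-point Riemann discretisation of the operator with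
   kernel [bridge_cov]; the eigenvectors are the sampled [sine_fun]s. *)
Definition grid_eig m N : R := (2 * N%:R * sin (m%:R * pi / (2 * N%:R))) ^- 2.

(** Summation by parts: as a function of i, [minn i j] is linear except for a kink at j, which picks
    out the value of e there. The weight is zero at i = 0, so the convention [0.-1 = 0] is
    harmless. *)
Lemma sum_min_second_difference (e : nat -> R) j M : e 0 = 0 ->
  \sum_(i < M.+1) (minn i j)%:R * (e i *+ 2 - e i.-1 - e i.+1) =
  e (minn M j) + (minn M j)%:R * (e M - e M.+1).
Proof.
move=> e0; elim: M => [|M IH].
  by rewrite big_ord_recr big_ord0 /= min0n !mul0r !addr0 e0.
rewrite big_ord_recr IH /=.
have [jM|Mj] := leqP j M.
  by rewrite (minn_idPr (leqW jM)); ring.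
by rewrite (minn_idPl Mj) -natr1; ring.
Qed.

(** Subtracting the linear function i j / N makes the kernel vanish at i = N as well, and this
    removes the boundary term of the previous sum. *)
Lemma discrete_green (e : nat -> R) j N : (0 < N)%N -> (j <= N)%N ->
  e 0 = 0 -> e N = 0 ->
  \sum_(i < N) ((minn i j)%:R - i%:R * j%:R / N%:R) *
    (e i *+ 2 - e i.-1 - e i.+1) = e j.
Proof.
case: N => // N _ jN e0 eN.
under eq_bigr => i _ do rewrite mulrBl.
rewrite big_split/= sumrN sum_min_second_difference//.
have -> : \sum_(i < N.+1) i%:R * j%:R / N.+1%:R * (e i *+ 2 - e i.-1 - e i.+1)
    = j%:R * e N.
  (* On the range of summation i equals [minn i N.+1], so the linear part is the previous lemma with
     N.+1 in place of j. *)
  transitivity (j%:R / N.+1%:R * \sum_(i < N.+1) (minn i N.+1)%:R *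
      (e i *+ 2 - e i.-1 - e i.+1)).
    rewrite big_distrr/=; apply: eq_bigr => i _.
    by rewrite (minn_idPl (ltnW (ltn_ord i))); ring.
  rewrite sum_min_second_difference// (minn_idPl (leqnSn N)) eN subr0.
  have N0 : N.+1%:R != 0 :> R by rewrite pnatr_eq0.
  by rewrite -natr1 in N0 *; field.
rewrite eN subr0; case: (ltngtP j N.+1) jN => // [jN|->] _.
  by rewrite (minn_idPr _)//; ring.
by rewrite (minn_idPl (leqnSn N)) -natr1 eN; ring.
Qed.

Lemma sine_fun0 m : sine_fun m 0 = 0.
Proof. by rewrite /sine_fun mulr0 sin0 mulr0. Qed.

Lemma sin_natpi m : sin (m%:R * pi) = 0 :> R.
Proof.
elim: m => [|m IH]; first by rewrite mul0r sin0.
by rewrite -natr1 mulrDl mul1r sinDpi IH oppr0.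
Qed.

Lemma cos_natpi m : cos (m%:R * pi) = (-1) ^+ m :> R.
Proof.
elim: m => [|m IH]; first by rewrite mul0r cos0.
by rewrite -natr1 mulrDl mul1r cosDpi IH exprS mulN1r.
Qed.

Lemma sine_fun1 m : sine_fun m 1 = 0.
Proof. by rewrite /sine_fun mulr1 sin_natpi mulr0. Qed.

Lemma sine_fun_second_difference m x h :
  sine_fun m x *+ 2 - sine_fun m (x - h) - sine_fun m (x + h) =
  (2 * sin (m%:R * pi * h / 2)) ^+ 2 * sine_fun m x.
Proof.
rewrite /sine_fun [_ * (x - h)]mulrBr [_ * (x + h)]mulrDr sinB sinD.
set a := m%:R * pi * x; set b := m%:R * pi * h.
have -> : cos b = 1 - 2 * sin (b / 2) ^+ 2.
  have {1}-> : b = (b / 2) *+ 2 by rewrite -mulr_natr; field.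
  by rewrite cos_mulr2n cos2sin2; ring.
by rewrite -[_ *+ 2]mulr_natr; ring.
Qed.

Lemma sin_grid_gt0 m N : (0 < m < N)%N -> 0 < sin (m%:R * pi / (2 * N%:R)) :> R.
Proof.
move=> /andP[m0 mN]; have N0 : 0 < N%:R :> R by rewrite ltr0n (ltn_trans m0 mN).
apply: sin_gt0_pihalf; rewrite divr_gt0 ?mulr_gt0 ?pi_gt0 ?ltr0n ?(ltn_trans m0 mN)//=.
have -> : m%:R * pi / (2 * N%:R) = pi / 2 * (m%:R / N%:R) :> R.
  by field; rewrite gt_eqF.
by rewrite gtr_pMr ?divr_gt0 ?pi_gt0// ltr_pdivrMr// mul1r ltr_nat.
Qed.

Lemma bridge_cov_grid i j N : (0 < N)%N ->
  bridge_cov (i%:R / N%:R) (j%:R / N%:R) =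
  ((minn i j)%:R - i%:R * j%:R / N%:R) / N%:R.
Proof.
move=> N0; have N0' : 0 < N%:R :> R by rewrite ltr0n.
rewrite /bridge_cov -minr_pMl ?invr_ge0 ?(ltW N0')//.
have -> : Num.min i%:R j%:R = (minn i j)%:R :> R.
  by rewrite /minn minEle ler_nat; case: ltngtP => // ->.
by field; rewrite gt_eqF.
Qed.

Lemma grid_eigenvector m j N : (0 < m < N)%N -> (j <= N)%N ->
  N%:R^-1 * \sum_(i < N) bridge_cov (i%:R / N%:R) (j%:R / N%:R) *
    sine_fun m (i%:R / N%:R) = grid_eig m N * sine_fun m (j%:R / N%:R).
Proof.
move=> mN jN; have s0 := sin_grid_gt0 mN.
have N0 : (0 < N)%N by case/andP: mN => m0; exact: ltn_trans.
have N0' : N%:R != 0 :> R by rewrite pnatr_eq0 -lt0n.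
pose e i := sine_fun m (i%:R / N%:R).
have e0 : e 0 = 0 by rewrite /e mul0r sine_fun0.
have eN : e N = 0 by rewrite /e divff// sine_fun1.
rewrite -[sine_fun m (j%:R / _)](discrete_green N0 jN e0 eN) !big_distrr/=.
apply: eq_bigr => i _; rewrite bridge_cov_grid//.
(* At i = 0 the predecessor is not the left neighbour, so the difference equation fails there; the
   kernel is zero at that point. *)
case: (posnP i) => [->|i0]; first by rewrite min0n; ring.
have -> : e i *+ 2 - e i.-1 - e i.+1 =
    (2 * sin (m%:R * pi / (2 * N%:R))) ^+ 2 * e i.
  rewrite /e -(prednK i0) /= -[in X in _ - X]natr1 -natr1.
  have -> : (i.-1%:R / N%:R) = (i.-1%:R + 1) / N%:R - N%:R^-1 :> R by field.
  have -> : ((i.-1%:R + 1 + 1) / N%:R) = (i.-1%:R + 1) / N%:R + N%:R^-1 :> R.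
    by field.
  rewrite sine_fun_second_difference; congr (_ * _); congr ((2 * sin _) ^+ 2).
  by field.
rewrite /grid_eig /e.
by field; rewrite N0' gt_eqF.
Qed.

(** Multiplication by 2 sin a, with a = q pi / (2 N), makes the sum telescope, and q < 2 N keeps sin
    a positive. The value depends only on the parity of q; this yields orthogonality of the sampled
    sines, since m - n and m + n have the same parity. *)
Lemma sum_cos_grid (q : nat) N : (0 < N)%N -> (0 < q < 2 * N)%N ->
  \sum_(i < N) cos (q%:R * pi * (i%:R / N%:R)) = (1 - (-1) ^+ q) / 2 :> R.
Proof.
move=> N0 /andP[q0 qN]; have N0' : 0 < N%:R :> R by rewrite ltr0n.
pose a : R := q%:R * pi / (2 * N%:R).
have sa : 0 < sin a.
  apply: sin_gt0_pi; rewrite divr_gt0 ?mulr_gt0 ?pi_gt0 ?ltr0n//=.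
  by rewrite ltr_pdivrMr ?mulr_gt0// [pi * _]mulrC ltr_pM2r ?pi_gt0// -natrM ltr_nat.
have H M : 2 * sin a * \sum_(i < M) cos (i%:R * (2 * a)) =
    sin (M%:R * (2 * a) - a) + sin a.
  elim: M => [|M IH]; first by rewrite big_ord0 mul0r sub0r sinN mulr0 addNr.
  rewrite big_ord_recr mulrDr IH /=.
  have -> : M.+1%:R * (2 * a) - a = M%:R * (2 * a) + a by rewrite -natr1; ring.
  by rewrite sinB sinD; ring.
have := H N.
have -> : N%:R * (2 * a) = q%:R * pi by rewrite /a; field; rewrite gt_eqF.
rewrite sinB sin_natpi cos_natpi mul0r sub0r => HN.
have -> : \sum_(i < N) cos (q%:R * pi * (i%:R / N%:R)) =
    \sum_(i < N) cos (i%:R * (2 * a)).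
  by apply: eq_bigr => i _; congr cos; rewrite /a; field; rewrite gt_eqF.
apply: (@mulfI _ (2 * sin a)); first by rewrite mulf_neq0 ?gt_eqF.
by rewrite HN; field.
Qed.

Lemma sine_funM m n x : sine_fun m x * sine_fun n x =
  cos ((m%:R - n%:R) * pi * x) - cos ((m + n)%:R * pi * x).
Proof.
rewrite /sine_fun natrD !mulrDl !mulNr cosB cosD.
set a := sin _; set b := sin _.
rewrite mulrACA -expr2 sqr_sqrtr//; ring.
Qed.

Lemma cos_subnat m n x :
  cos ((m%:R - n%:R) * pi * x) = cos ((maxn m n - minn m n)%N%:R * pi * x).
Proof.
have [mn|nm] := ltnP m n; last by rewrite natrB.
rewrite natrB; last exact: ltnW.
by rewrite -cosN -!mulNr opprB.
Qed.

Lemma sine_fun_grid_orthonormal m n N : (0 < m < N)%N -> (0 < n < N)%N ->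
  N%:R^-1 * \sum_(i < N) sine_fun m (i%:R / N%:R) * sine_fun n (i%:R / N%:R) =
  (m == n)%:R.
Proof.
move=> /andP[m0 mN] /andP[n0 nN].
have N0 : (0 < N)%N by exact: ltn_trans mN.
under eq_bigr => i _ do rewrite sine_funM.
rewrite sumrB [in X in _ - X]sum_cos_grid//; last first.
  by rewrite addn_gt0 m0/= mul2n -addnn -addnS leq_add// ltnW.
have [->|mn] := eqVneq m n.
  under eq_bigr => i _ do rewrite subrr !mul0r cos0.
  rewrite sumr_const card_ord addnn -mul2n exprM sqrrN expr1n expr1n subrr mul0r.
  by rewrite subr0 mulVf// pnatr_eq0 -lt0n.
under eq_bigr => i _ do rewrite cos_subnat.
have qP : (0 < maxn m n - minn m n < 2 * N)%N.
  by move: mn m0 n0 mN nN; rewrite maxnE minnE; clear; case: ltngtP => //; lia.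
rewrite sum_cos_grid// -signr_odd -[in X in _ - X]signr_odd.
suff -> : odd (maxn m n - minn m n) = odd (m + n) by rewrite subrr mulr0.
case: (leqP m n) => h; first by rewrite oddB// oddD addbC.
by rewrite oddB ?oddD//; exact: ltnW.
Qed.

End discrete_sines.

Section finite_cvg.
Context {R : realType} {T : Type} {F : set_system T} {FF : Filter F}.
Context {I : Type} (r : seq I) (P : pred I) (f : I -> T -> R) (l : I -> R).
Hypothesis fl : forall i, P i -> f i x @[x --> F] --> l i.

Lemma cvgr_sum :
  (\sum_(i <- r | P i) f i x) @[x --> F] --> \sum_(i <- r | P i) l i.
Proof.
elim: r => [|i s IH].
  by under eq_fun do rewrite big_nil; rewrite big_nil; exact: cvg_cst.
under eq_fun do rewrite big_cons; rewrite big_cons.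
by case: ifPn => // Pi; apply: cvgD => //; exact: fl.
Qed.

Lemma cvgr_prod :
  (\prod_(i <- r | P i) f i x) @[x --> F] --> \prod_(i <- r | P i) l i.
Proof.
elim: r => [|i s IH].
  by under eq_fun do rewrite big_nil; rewrite big_nil; exact: cvg_cst.
under eq_fun do rewrite big_cons; rewrite big_cons.
by case: ifPn => // Pi; apply: cvgM => //; exact: fl.
Qed.

End finite_cvg.

(** * Bounds on sines, limits of grid eigenvalues, and Mercer's expansion in one variable *)

Section mercer.
Context {R : realType}.
Implicit Types (s t x : R) (m i j N M : nat).

Lemma cvg_divn (c : R) : (c / n%:R) @[n --> \oo] --> (0 : R).
Proof.
apply/cvgr0Pnorm_le => /= e e0; near=> n.
have n0 : 0 < n%:R :> R by rewrite ltr0n; near: n; exact: nbhs_infty_gt.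
rewrite normrM normfV (gtr0_norm n0) ler_pdivrMr// mulrC -ler_pdivrMr//.
near: n; exact: nbhs_infty_ger.
Unshelve. all: by end_near. Qed.

Lemma sin_mean_value x : 0 <= x -> exists2 c, 0 <= c <= x & sin x = x * cos c.
Proof.
move=> x0; have dsin (y : R) : y \in `]0, x[ -> is_derive y 1 sin (cos y).
  by move=> _; exact: is_derive_sin.
have csin : {within `[0, x], continuous sin}.
  by apply: continuous_subspaceT => z; exact: continuous_sin.
have [c] := MVT_segment x0 dsin csin.
by rewrite in_itv/= sin0 !subr0 mulrC => cx ->; exists c.
Qed.

Lemma sin_le_id x : 0 <= x -> sin x <= x.
Proof.
move=> x0; have [c _ ->] := sin_mean_value x0.
by rewrite ler_piMr// cos_le1.
Qed.

Lemma norm_sin_le x : `|sin x| <= `|x|.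
Proof.
wlog x0 : x / 0 <= x => [H|].
  have [/H//|x0] := leP 0 x.
  by rewrite -normrN -sinN -(normrN x); apply: H; rewrite oppr_ge0 ltW.
have [c _ ->] := sin_mean_value x0.
by rewrite normrM ler_piMr// cos_max.
Qed.

Lemma cos_ge x : 1 - x ^+ 2 / 2 <= cos x.
Proof.
have -> : cos x = 1 - 2 * sin (x / 2) ^+ 2.
  have {1}-> : x = (x / 2) *+ 2 by rewrite -mulr_natr; field.
  by rewrite cos_mulr2n cos2sin2; ring.
have : sin (x / 2) ^+ 2 <= (x / 2) ^+ 2.
  rewrite -[leLHS](real_normK (num_real _)) -[leRHS](real_normK (num_real _)).
  by rewrite lerXn2r ?nnegrE// norm_sin_le.
by lra.
Qed.

Lemma sin_ge x : 0 <= x -> x * (1 - x ^+ 2 / 2) <= sin x.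
Proof.
move=> x0; have [c /andP[c0 cx] ->] := sin_mean_value x0.
rewrite ler_wpM2l// (le_trans _ (cos_ge c))// lerB// ler_pM2r//.
by rewrite lerXn2r ?nnegrE.
Qed.

(** A crude form of Jordan's inequality. Beyond 1 the sine is at least sin 1 >= 1/2, while x / 4 <
    1/2 because pi / 2 < 2. *)
Lemma sin_ge_quarter x : 0 <= x <= pi / 2 -> x / 4 <= sin x.
Proof.
move=> /andP[x0 xpi].
have pi2 : pi / 2 < 2 :> R := pihalf_lt2 R.
have pi1 : 1 <= pi / 2 :> R := pihalf_ge1 R.
have [x1|x1] := leP x 1.
  have := sin_ge x0.
  have : x ^+ 2 <= 1 by rewrite expr_le1.
  by move: x0; clear; nra.
have : sin 1 < sin x by rewrite ltr_sin// in_itv/=; lra.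
have := @sin_ge 1 ler01; rewrite expr1n mul1r; lra.
Qed.

Lemma grid_eig_ge0 m N : 0 <= grid_eig m N :> R.
Proof. by rewrite /grid_eig invr_ge0 sqr_ge0. Qed.

Lemma bridge_eig_gt0 m : (0 < m)%N -> 0 < bridge_eig m :> R.
Proof. by move=> m0; rewrite invr_gt0 exprn_gt0// mulr_gt0 ?ltr0n ?pi_gt0. Qed.

(** A bound free of N, which controls the tail of the spectral sum while N grows. With a = m pi / (2
    N) <= pi / 2, the quarter bound gives 2 N sin a >= m pi / 4 >= m / 2. *)
Lemma grid_eig_le m N : (0 < m < N)%N -> grid_eig m N <= 4 / m%:R ^+ 2 :> R.
Proof.
move=> mN; have := sin_grid_gt0 (R:=R) mN; case/andP: mN => m0 mN.
have m0' : 0 < m%:R :> R by rewrite ltr0n.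
have N0 : 0 < N%:R :> R by rewrite ltr0n (ltn_trans m0).
set a := m%:R * pi / _ => s0.
have a4 : a / 4 <= sin a.
  apply: sin_ge_quarter; rewrite /a divr_ge0 ?mulr_ge0 ?pi_ge0//=.
  have -> : m%:R * pi / (2 * N%:R) = pi / 2 * (m%:R / N%:R) :> R.
    by field; rewrite gt_eqF.
  by rewrite ger_pMr ?divr_gt0 ?pi_gt0// ler_pdivrMr// mul1r ler_nat ltnW.
have -> : 4 / m%:R ^+ 2 = (m%:R / 2) ^- 2 :> R by field; rewrite gt_eqF.
rewrite lef_pV2 ?posrE ?exprn_gt0 ?divr_gt0 ?mulr_gt0//.
rewrite lerXn2r ?nnegrE ?divr_ge0 ?mulr_ge0 ?(ltW s0)//.
apply: (@le_trans _ _ (2 * N%:R * (a / 4))); last by rewrite ler_pM2l ?mulr_gt0.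
have -> : 2 * N%:R * (a / 4) = m%:R / 2 * (pi / 2).
  by rewrite /a; field; rewrite gt_eqF.
by rewrite ler_peMr ?divr_ge0 ?pihalf_ge1.
Qed.

Lemma cvg_grid_eig m : grid_eig m N @[N --> \oo] --> (bridge_eig m : R).
Proof.
(* For m = 0 both sides are the inverse of 0, which is 0. *)
have [->|m0] := posnP m.
  rewrite /bridge_eig /grid_eig !mul0r expr0n invr0.
  under eq_fun do rewrite mul0r sin0 mulr0 expr0n invr0.
  exact: cvg_cst.
pose c : R := m%:R * pi.
have c0 : 0 < c by rewrite mulr_gt0 ?pi_gt0 ?ltr0n.
apply: cvgV; first by rewrite gt_eqF// exprn_gt0.
suff : 2 * N%:R * sin (m%:R * pi / (2 * N%:R)) @[N --> \oo] --> (c : R).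
  by move=> h; rewrite expr2; under eq_fun do rewrite expr2; exact: cvgM.
apply: (@squeeze_cvgr _ _ _ _ (fun N => c * (1 - (c / 2 / N%:R) ^+ 2 / 2)) (fun=> c)).
- near=> N; have N0 : 0 < N%:R :> R.
    by rewrite ltr0n; near: N; exact: nbhs_infty_gt.
  have -> : m%:R * pi / (2 * N%:R) = c / 2 / N%:R.
    by rewrite /c; field; rewrite gt_eqF.
  set a := c / 2 / N%:R; have a0 : 0 <= a by rewrite !divr_ge0 ?ltW.
  have {2}-> : c = 2 * N%:R * a by rewrite /a; field; rewrite gt_eqF.
  have -> : c = 2 * N%:R * a by rewrite /a; field; rewrite gt_eqF.
  by rewrite -mulrA !ler_pM2l ?mulr_gt0// sin_ge// sin_le_id.
- rewrite -[X in _ --> X]mulr1; apply: cvgM; first exact: cvg_cst.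
  rewrite -[X in _ --> X]subr0; apply: cvgB; first exact: cvg_cst.
  rewrite -[X in _ --> X](mul0r 2^-1); apply: cvgMr_tmp.
  rewrite -[X in _ --> X](mul0r 0); under eq_fun do rewrite expr2.
  by apply: cvgM; exact: cvg_divn.
- exact: cvg_cst.
Unshelve. all: by end_near. Qed.

Lemma bridge_covC s t : bridge_cov s t = bridge_cov t s.
Proof. by rewrite /bridge_cov minC mulrC. Qed.

Lemma bridge_cov0 t : 0 <= t -> bridge_cov 0 t = 0.
Proof. by move=> t0; rewrite /bridge_cov min_l// mul0r subr0. Qed.

Lemma bridge_cov1 t : t <= 1 -> bridge_cov 1 t = 0.
Proof. by move=> t0; rewrite /bridge_cov min_r// mul1r subrr. Qed.

Lemma bridge_cov_itv s t : 0 <= s <= 1 -> 0 <= t <= 1 ->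
  0 <= bridge_cov s t <= 1.
Proof.
move=> s01 t01; rewrite /bridge_cov minEle; case: ifPn => [|/negP] h; nra.
Qed.

Lemma bridge_cov_lipr x s t : 0 <= x <= 1 ->
  `|bridge_cov x s - bridge_cov x t| <= `|s - t|.
Proof.
wlog st : s t / s <= t => [H|].
  have [/H//|/ltW ts] := leP s t.
  by move=> /(H _ _ ts); rewrite distrC (distrC t).
move=> x01; rewrite (distrC s) (@ger0_norm _ (t - s)) ?subr_ge0//.
rewrite ler_norml /bridge_cov !minEle.
by case: (leP x s) => h1; case: (leP x t) => h2; apply/andP; split; nra.
Qed.

Lemma sine_fun_le m x : `|sine_fun m x| <= 2.
Proof.
rewrite /sine_fun normrM ger0_norm ?sqrtr_ge0//.
rewrite -[leRHS]mulr1 ler_pM ?sin_max//.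
by rewrite -(@ler_pXn2r _ 2) ?nnegrE ?sqrtr_ge0// sqr_sqrtr// expr2; lra.
Qed.

Lemma continuous_sine_fun m : continuous (@sine_fun R m).
Proof.
move=> x; apply: cvgMl_tmp; apply: continuous_cvg; first exact: continuous_sin.
by apply: cvgMl_tmp; exact: cvg_id.
Qed.

Definition grid_point N t : R := (Num.truncn (t * N%:R))%:R / N%:R.

Lemma grid_point_itv N t : (0 < N)%N -> 0 <= t ->
  grid_point N t <= t <= grid_point N t + N%:R^-1.
Proof.
move=> N0 t0; have N0' : 0 < N%:R :> R by rewrite ltr0n.
have /truncn_itv/andP[h1 h2] : 0 <= t * N%:R by rewrite mulr_ge0.
rewrite /grid_point ler_pdivrMr// h1/= -[X in _ + X]mul1r -mulrDl ler_pdivlMr//.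
by rewrite natr1 ltW.
Qed.

Lemma truncn_grid_le N t : (0 < N)%N -> 0 <= t <= 1 -> (Num.truncn (t * N%:R) <= N)%N.
Proof.
move=> N0 /andP[t0 t1].
have /truncn_itv/andP[h1 h2] : 0 <= t * N%:R by rewrite mulr_ge0.
by rewrite -(ler_nat R) (le_trans h1)// ler_piMl.
Qed.

Lemma grid_point_ge0 N t : 0 <= grid_point N t.
Proof. by rewrite divr_ge0. Qed.

Lemma cvg_grid_point t : 0 <= t -> grid_point N t @[N --> \oo] --> t.
Proof.
move=> t0.
apply: (@squeeze_cvgr _ _ _ _ (fun N : nat => t - 1 / N%:R) (fun=> t)).
- near=> N; have N0 : (0 < N)%N by near: N; exact: nbhs_infty_gt.
  by have /andP[] := grid_point_itv N0 t0; rewrite div1r; lra.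
- by rewrite -[X in _ --> X]subr0; apply: cvgB; [exact: cvg_cst|exact: cvg_divn].
- exact: cvg_cst.
Unshelve. all: by end_near. Qed.

(** At the grid point below t the sum is exactly [grid_eig m N] times the sampled sine. Moving from
    there to t costs at most 2 / N, since the kernel is 1-Lipschitz and the sines are bounded by
    2. *)
Lemma cvg_riemann_bridge m t : (0 < m)%N -> 0 <= t <= 1 ->
  N%:R^-1 * \sum_(i < N) bridge_cov (i%:R / N%:R) t * sine_fun m (i%:R / N%:R)
    @[N --> \oo] --> bridge_eig m * sine_fun m t.
Proof.
move=> m0 t01; have /andP[t0 t1] := t01.
pose f N (t : R) := N%:R^-1 * \sum_(i < N) bridge_cov (i%:R / N%:R) t *
  sine_fun m (i%:R / N%:R).
have -> : (fun N => f N t) =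
    (fun N => f N (grid_point N t) + (f N t - f N (grid_point N t))).
  by apply/funext => N; rewrite addrC subrK.
rewrite -[X in _ --> X]addr0; apply: cvgD.
  have H : grid_eig m N * sine_fun m (grid_point N t) @[N --> \oo] -->
      bridge_eig m * sine_fun m t.
    apply: cvgM; first exact: cvg_grid_eig.
    apply: continuous_cvg; first exact: continuous_sine_fun.
    exact: cvg_grid_point.
  apply: cvg_trans H; apply: near_eq_cvg; near=> N.
  have mN : (m < N)%N by near: N; exact: nbhs_infty_gt.
  rewrite /f /grid_point grid_eigenvector ?m0//.
  by rewrite truncn_grid_le// (leq_ltn_trans _ mN).
apply/cvgr0Pnorm_le => /= e e0; near=> N.
have N0 : (0 < N)%N by near: N; exact: nbhs_infty_gt.
have N0' : 0 < N%:R :> R by rewrite ltr0n.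
rewrite /f -mulrBr -sumrB normrM normfV (gtr0_norm N0') mulrC ler_pdivrMr//.
apply: (@le_trans _ _ (\sum_(i < N) (2 / N%:R))).
  apply: (le_trans (ler_norm_sum _ _ _)); apply: ler_sum => i _.
  rewrite -mulrBl normrM mulrC ler_pM ?sine_fun_le//.
  apply: (le_trans (bridge_cov_lipr _ _ _)).
    by rewrite divr_ge0//= ler_pdivrMr// mul1r ler_nat ltnW.
  have /andP[h1 h2] := grid_point_itv N0 t0.
  by rewrite ger0_norm ?subr_ge0//; lra.
rewrite sumr_const card_ord -[_ *+ N]mulr_natr ler_pM2r//.
rewrite ler_pdivrMr// mulrC.
by rewrite -ler_pdivrMr//; near: N; exact: nbhs_infty_ger.
Unshelve. all: by end_near. Qed.

Lemma sine_fun_gridC m i N :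
  sine_fun m (i%:R / N%:R) = sine_fun i (m%:R / N%:R) :> R.
Proof. by rewrite /sine_fun; congr (_ * sin _); ring. Qed.

(** The matrix of sampled sines is symmetric in frequency and position, so orthonormality of its
    columns is orthonormality of its rows. *)
Lemma sine_fun_grid_dual i l N : (0 < i < N)%N -> (0 < l < N)%N ->
  N%:R^-1 * \sum_(1 <= m < N)
    sine_fun m (i%:R / N%:R) * sine_fun m (l%:R / N%:R) = (i == l)%:R :> R.
Proof.
move=> iN lN; rewrite -(@sine_fun_grid_orthonormal R i l N)//.
have N0 : (0 < N)%N by case/andP: iN => i0; exact: ltn_trans.
rewrite -(big_mkord xpredT
  (fun k => sine_fun i (k%:R / N%:R) * sine_fun l (k%:R / N%:R))).
rewrite [in RHS]big_ltn// mul0r sine_fun0 mul0r add0r.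
by congr (_ * _); apply: eq_bigr => m _; rewrite -!(sine_fun_gridC m).
Qed.

(** The delta of [sine_fun_grid_dual] is inserted against the kernel, the sums are exchanged and
    [grid_eigenvector] is applied. That delta concerns interior points; at i = 0 and i = N both
    sides vanish. *)
Lemma bridge_cov_grid_spectral i j N : (0 < N)%N -> (i <= N)%N -> (j <= N)%N ->
  bridge_cov (i%:R / N%:R) (j%:R / N%:R) =
  \sum_(1 <= m < N) grid_eig m N *
    (sine_fun m (i%:R / N%:R) * sine_fun m (j%:R / N%:R)) :> R.
Proof.
move=> N0 iN jN; have N0' : 0 < N%:R :> R by rewrite ltr0n.
have jN01 : 0 <= (j%:R / N%:R : R) <= 1.
  by rewrite divr_ge0//= ler_pdivrMr// mul1r ler_nat.
have [i0|i0] := posnP i.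
  rewrite i0 mul0r bridge_cov0; last by case/andP: jN01.
  by rewrite big1// => m _; rewrite sine_fun0; ring.
have [->|iN'] := eqVneq i N.
  rewrite divff ?gt_eqF// bridge_cov1; last by case/andP: jN01.
  by rewrite big1// => m _; rewrite sine_fun1; ring.
have {iN'}iN : (i < N)%N by rewrite ltn_neqAle iN'.
transitivity (\sum_(l < N) bridge_cov (l%:R / N%:R) (j%:R / N%:R) *
    (N%:R^-1 * \sum_(1 <= m < N)
      (sine_fun m (i%:R / N%:R) * sine_fun m (l%:R / N%:R) : R))).
  rewrite (bigD1 (Ordinal iN))//= [X in _ + X]big1 ?addr0.
    rewrite -[LHS]mulr1; congr (_ * _).
    by rewrite sine_fun_grid_dual ?i0 ?iN// eqxx.
  move=> l /negP li; have [->|l0] := posnP l.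
    by rewrite mul0r bridge_cov0 ?mul0r//; case/andP: jN01.
  rewrite sine_fun_grid_dual ?i0 ?iN ?l0 ?ltn_ord//.
  have -> : (i == l)%N = false.
    by apply/negbTE/negP => /eqP il; apply: li; apply/eqP/val_inj.
  by rewrite mulr0.
under eq_bigr => l _ do rewrite 2!big_distrr/=.
rewrite exchange_big/=; apply: eq_big_nat => m mN.
rewrite mulrCA -grid_eigenvector// !big_distrr/=.
by apply: eq_bigr => l _; ring.
Qed.

Lemma sum_inv_sqr_le M N : (0 < M)%N ->
  \sum_(M.+1 <= m < N) m%:R ^- 2 <= M%:R^-1 :> R.
Proof.
move=> M0; have [NM|MN] := leqP N M.+1.
  by rewrite big_geq// invr_ge0.
(* The summand is written as f (m + 1) - f m for f m = - 1 / (m - 1), the shape expected by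
   [telescope_sumr]. *)
have H : \sum_(M.+1 <= m < N) m%:R ^- 2 <=
    \sum_(M.+1 <= m < N) (- (m.+1.-1%:R^-1) - - (m.-1%:R^-1)) :> R.
  rewrite !big_nat; apply: ler_sum => -[|m] // /andP[Mm _] /=.
  have m0 : 0 < m%:R :> R by rewrite ltr0n (leq_trans M0).
  have m1 : 0 < m.+1%:R :> R by rewrite ltr0n.
  rewrite opprK -natr1 in m1 *.
  rewrite -subr_ge0.
  have -> : - (m%:R + 1)^-1 + m%:R^-1 - (m%:R + 1) ^- 2 =
      (m%:R * (m%:R + 1) ^+ 2)^-1 :> R by field; rewrite !gt_eqF.
  by rewrite invr_ge0 mulr_ge0 ?sqr_ge0.
apply: (le_trans H); rewrite (telescope_sumr (fun m => - (m.-1%:R^-1)))//=; last exact: ltnW.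
by rewrite opprK gerDr oppr_le0 invr_ge0.
Qed.

(** The constant is 16 = 4 * 2 * 2: the grid eigenvalues are at most 4 / m^2, the two sines at most
    2, and the sum of 1 / m^2 over m > M is at most 1 / M. The bound holds at grid points for all N
    > M and passes to the limit, the sum up to M being finite. *)
Lemma mercer_bridge M s t : (0 < M)%N -> 0 <= s <= 1 -> 0 <= t <= 1 ->
  `|bridge_cov s t -
    \sum_(1 <= m < M.+1) bridge_eig m * (sine_fun m s * sine_fun m t)|
  <= 16 / M%:R.
Proof.
move=> M0 s01 t01.
have /andP[s0 s1] := s01; have /andP[t0 t1] := t01.
pose A N := bridge_cov (grid_point N s) (grid_point N t) -
  \sum_(1 <= m < M.+1) grid_eig m N *
    (sine_fun m (grid_point N s) * sine_fun m (grid_point N t)).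
have A_cvg : A N @[N --> \oo] --> bridge_cov s t -
    \sum_(1 <= m < M.+1) bridge_eig m * (sine_fun m s * sine_fun m t).
  apply: cvgB.
    apply/subr_cvg0/cvgr0Pnorm_le => e e0; near=> N.
    have N0 : (0 < N)%N by near: N; exact: nbhs_infty_gt.
    have N0' : 0 < N%:R :> R by rewrite ltr0n.
    have /andP[h1 h2] := grid_point_itv N0 t0.
    have /andP[h3 h4] := grid_point_itv N0 s0.
    apply: (@le_trans _ _ (2 / N%:R)); last first.
      rewrite ler_pdivrMr// mulrC -ler_pdivrMr//.
      by near: N; exact: nbhs_infty_ger.
    apply: (le_trans (ler_distD (bridge_cov (grid_point N s) t) _ _)).
    have -> : 2 / N%:R = N%:R^-1 + N%:R^-1 :> R by ring.
    apply: lerD.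
      apply: (le_trans (bridge_cov_lipr _ _ _)).
        by rewrite grid_point_ge0 (le_trans h3).
      by rewrite ler_norml; lra.
    rewrite bridge_covC [X in _ - X]bridge_covC.
    by apply: (le_trans (bridge_cov_lipr _ _ _)) => //; rewrite ler_norml; lra.
  apply: cvgr_sum => m _.
  apply: cvgM; first exact: cvg_grid_eig.
  by apply: cvgM; (apply: continuous_cvg; [exact: continuous_sine_fun|
    exact: cvg_grid_point]).
have /cvg_norm nA_cvg := A_cvg.
apply: (@ler_cvg_to nat \oo _ R (fun N => `|A N|) (fun=> 16 / M%:R) _ _ nA_cvg).
  exact: cvg_cst.
near=> N; have MN : (M < N)%N by near: N; exact: nbhs_infty_gt.
have N0 : (0 < N)%N by exact: leq_ltn_trans MN.
rewrite /A bridge_cov_grid_spectral ?truncn_grid_le//.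
rewrite (big_cat_nat (n := M.+1))//= addrC addrK.
apply: (le_trans (ler_norm_sum _ _ _)).
apply: (@le_trans _ _ (\sum_(M.+1 <= m < N) 16 * m%:R ^- 2)); last first.
  by rewrite -big_distrr/= ler_pM2l// sum_inv_sqr_le.
rewrite !big_nat; apply: ler_sum => m /andP[Mm mN].
rewrite normrM ger0_norm ?grid_eig_ge0// normrM.
have -> : 16 * m%:R ^- 2 = 4 / m%:R ^+ 2 * (2 * 2) :> R.
  by field; rewrite pnatr_eq0 -lt0n (leq_ltn_trans _ Mm).
rewrite ler_pM ?grid_eig_ge0 ?mulr_ge0 ?ler_pM ?sine_fun_le//.
by rewrite grid_eig_le// mN (leq_ltn_trans _ Mm).
Unshelve. all: by end_near. Qed.

End mercer.

(** * Integration over the unit box *)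

Section lebesgue_tuple_integral.
Context {R : realType}.
Local Notation lm := (@lebesgue_measure R).

Lemma ge0_integral_lebesgue_tupleS n (f : n.+1.-tuple R -> \bar R) :
  measurable_fun setT f -> (forall v, (0 <= f v)%E) ->
  (\int[lebesgue_tuple n.+1]_v f v =
   \int[lm \x lebesgue_tuple n]_x f (tuple_cons x))%E.
Proof.
move=> mf f0; have mcons := @measurable_tuple_cons R n.
rewrite (eq_measure_integral (pushforward (lm \x lebesgue_tuple n)%E (@tuple_cons R n)))//.
by rewrite ge0_integral_pushforward.
Qed.

Lemma integrable_lebesgue_tupleS n (f : n.+1.-tuple R -> \bar R) :
  measurable_fun setT f ->
  (lm \x lebesgue_tuple n)%E.-integrable setT (f \o @tuple_cons R n) ->
  (lebesgue_tuple n.+1).-integrable setT f.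
Proof.
move=> mf /integrableP[_ foo]; apply/integrableP; split => //.
have mf' : measurable_fun setT (abse \o f) by exact: measurableT_comp.
by rewrite (ge0_integral_lebesgue_tupleS mf' (fun v => abse_ge0 (f v))).
Qed.

Lemma integral_lebesgue_tupleS n (f : n.+1.-tuple R -> \bar R) :
  measurable_fun setT f ->
  (lm \x lebesgue_tuple n)%E.-integrable setT (f \o @tuple_cons R n) ->
  (\int[lebesgue_tuple n.+1]_v f v =
   \int[lm \x lebesgue_tuple n]_x f (tuple_cons x))%E.
Proof.
move=> mf fi; have mcons := @measurable_tuple_cons R n.
rewrite (eq_measure_integral (pushforward (lm \x lebesgue_tuple n)%E (@tuple_cons R n)))//.
by rewrite integral_pushforward.
Qed.

Lemma measurable_prod_tnth n (g : 'I_n -> R -> R) :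
  (forall k, measurable_fun setT (g k)) ->
  measurable_fun setT (fun u : n.-tuple R => \prod_(k < n) g k (tnth u k)).
Proof.
move=> mg; apply: measurable_prod => k _.
apply: measurableT_comp; first exact: mg.
exact: measurable_tnth.
Qed.

(** Integrability and value go through the induction together, because Fubini on the head coordinate
    needs the product over the tail to be integrable. *)
Lemma lebesgue_tuple_prod n (g : 'I_n -> R -> R) :
  (forall k, lm.-integrable setT (EFin \o g k)) ->
  (lebesgue_tuple n).-integrable setT
    (fun u => (\prod_(k < n) g k (tnth u k))%:E) /\
  (\int[lebesgue_tuple n]_u (\prod_(k < n) g k (tnth u k))%:E =
   (\prod_(k < n) \int[lm]_x g k x)%:E)%E.
Proof.
elim: n g => [|n IH] g ig.
  have -> : (fun u : 0.-tuple R => (\prod_(k < 0) g k (tnth u k))%:E) = cst 1%:E.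
    by apply/funext => u; rewrite big_ord0.
  rewrite big_ord0; split.
    apply/integrableP; split => //.
    rewrite (eq_integral (cst 1%:E)); last by move=> x _; rewrite /= normr1.
    by rewrite integral_cst//= /dirac indicE in_setT mule1 ltry.
  by rewrite integral_cst//= /dirac indicE in_setT mule1.
have [ih1 ih2] := IH (fun k => g (lift ord0 k)) (fun k => ig _).
have mg k : measurable_fun setT (g k).
  by have /integrableP[/measurable_EFinP] := ig k.
pose G (v : n.-tuple R) := \prod_(k < n) g (lift ord0 k) (tnth v k).
have mG : measurable_fun setT G.
  exact: (measurable_prod_tnth (g := fun k => g (lift ord0 k))).
set F := fun u : n.+1.-tuple R => (\prod_(k < n.+1) g k (tnth u k))%:E.
have FE x v : (F \o @tuple_cons R n) (x, v) = ((g ord0 x)%:E * (G v)%:E)%E.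
  rewrite /F/= big_ord_recl -EFinM; congr (_ * _)%:E.
  by apply: eq_bigr => k _; rewrite tnthS.
have mF : measurable_fun setT F.
  by apply/measurable_EFinP; exact: measurable_prod_tnth.
have Goo : (\int[lebesgue_tuple n]_v `|(G v)%:E| < +oo)%E.
  by case/integrableP : ih1.
have iF : (lm \x lebesgue_tuple n)%E.-integrable setT (F \o @tuple_cons R n).
  apply/integrable12ltyP.
    by apply: measurableT_comp => //; exact: measurable_tuple_cons.
  rewrite (eq_integral (fun x : measurableTypeR R => `|(g ord0 x)%:E| *
      \int[lebesgue_tuple n]_v `|(G v)%:E|))%E; last first.
    move=> x _; under eq_integral => v _ do rewrite FE abseM.
    rewrite ge0_integralZl//.
    by apply: measurableT_comp => //; exact/measurable_EFinP.
  rewrite ge0_integralZr//; first last.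
  - exact: integral_ge0.
  - by have mg0 := measurable_int _ (ig ord0); exact: (measurableT_comp _ mg0).
  rewrite lte_mul_pinfty//; first exact: integral_ge0.
    by rewrite ge0_fin_numE ?integral_ge0//; case/integrableP : (ig ord0).
split; first exact: integrable_lebesgue_tupleS.
rewrite integral_lebesgue_tupleS// -(integral12_prod_meas1 iF).
rewrite (eq_integral (fun x : measurableTypeR R => (g ord0 x)%:E *
    (\int[lebesgue_tuple n]_v G v)%:E))%E; last first.
  move=> x _; rewrite /fubini_F; under eq_integral => v _ do rewrite FE.
  rewrite integralZl//; congr (_ * _)%E.
  by rewrite /Rintegral fineK// integrable_fin_num.
rewrite integralZr; [|by []|exact: ig].
rewrite big_ord_recl [RHS]EFinM; congr (_ * _)%E.
  by rewrite /Rintegral fineK//; apply: integrable_fin_num => //; exact: ig.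
by rewrite /Rintegral ih2.
Qed.

Lemma measurable_unit_box n : measurable (@unit_box R n).
Proof.
have -> : @unit_box R n =
    \bigcap_(k in [set: 'I_n]) ((fun u => tnth u k) @^-1` `[0, 1]).
  apply/seteqP; split => u /= h.
    by move=> k _ /=; rewrite in_itv/=; exact: h.
  by move=> k; have := h k I; rewrite /= in_itv.
apply: fin_bigcap_measurable; first exact: finite_finset.
move=> k _; rewrite -[X in measurable X]setTI.
exact: measurable_tnth.
Qed.

(** The indicator of the box is the product of the indicators of its sides, so each factor can be
    cut off separately. *)
Lemma lebesgue_unit_box_prod n (f : 'I_n -> R -> R) :
  (forall k, lm.-integrable `[0, 1] (EFin \o f k)) ->
  (lebesgue_tuple n).-integrable (@unit_box R n)
    (fun u => (\prod_(k < n) f k (tnth u k))%:E) /\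
  (\int[lebesgue_tuple n]_(u in @unit_box R n) (\prod_(k < n) f k (tnth u k))%:E =
   (\prod_(k < n) \int[lm]_(x in `[0, 1]) f k x)%:E)%E.
Proof.
move=> fi; pose g k := f k \_ (`[0%R, 1%R] : set R).
have gi k : lm.-integrable setT (EFin \o g k).
  have := (@integrable_mkcond _ (measurableTypeR R) _ lm _ (EFin \o f k)
    (measurable_itv `[0%R, 1%R])).1 (fi k).
  by rewrite restrict_EFin.
have [h1 h2] := lebesgue_tuple_prod gi.
have gE : (fun u : n.-tuple R => (\prod_(k < n) g k (tnth u k))%:E) =
    (fun u => (\prod_(k < n) f k (tnth u k))%:E) \_ (@unit_box R n).
  apply/funext => u; rewrite patchE; case: ifPn => [|/negP] hu.
    congr EFin; apply: eq_bigr => k _; rewrite /g patchE mem_set//=.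
    by move: hu; rewrite inE in_itv/= => /(_ k).
  have [k hk] : exists k, ~ (0 <= tnth u k <= 1).
    by apply/existsNP => h; apply: hu; rewrite inE.
  rewrite (bigD1 k)//= /g patchE memNset ?mul0r//.
split.
  by apply/(integrable_mkcond _ (@measurable_unit_box n)); rewrite -gE.
rewrite integral_mkcond -gE h2; congr EFin; apply: eq_bigr => k _.
by rewrite [RHS]Rintegral_mkcond.
Qed.

End lebesgue_tuple_integral.

(** * Orthonormality and the eigenvalue equation in one variable *)

Section bridge_integrals.
Context {R : realType}.
Local Notation lm := (@lebesgue_measure R).
Implicit Types (s t x : R) (m n : nat).

Lemma continuous_integrable01 (f : R -> R) :
  continuous f -> lm.-integrable `[0, 1] (EFin \o f).
Proof.
move=> cf; apply: continuous_compact_integrable; first exact: segment_compact.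
exact: continuous_subspaceT.
Qed.

Lemma continuous_cos_scale (a : R) : continuous (fun x : R => cos (a * x)).
Proof.
move=> x; apply: (@continuous_cvg _ _ _ _ _ (fun x => a * x) (@cos R)).
  exact: continuous_cos.
by apply: cvgMl_tmp; exact: cvg_id.
Qed.

Lemma Rintegral_cos_natpi (q : nat) :
  \int[lm]_(x in `[0, 1]) cos (q%:R * pi * x) = (q == 0%N)%:R.
Proof.
have [->|q0] := eqVneq q 0%N.
  under eq_Rintegral => x _ do rewrite !mul0r cos0.
  by rewrite Rintegral_cst//= lebesgue_measure_itv/= lte01 oppr0 adde0/= mulr1.
pose a : R := q%:R * pi.
have a0 : a != 0 by rewrite mulf_neq0 ?pnatr_eq0// gt_eqF// pi_gt0.
pose F (x : R) := a^-1 * sin (a * x).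
have dF (x : R) : is_derive x 1 F (cos (a * x)).
  rewrite /F; apply: is_derive_eq.
  by rewrite /GRing.scale/= mulr1; field.
have cF : continuous F.
  move=> x; apply: cvgMl_tmp; apply: continuous_cvg; first exact: continuous_sin.
  by apply: cvgMl_tmp; exact: cvg_id.
rewrite /Rintegral (@continuous_FTC2 _ (fun x => cos (a * x)) F)//.
- by rewrite /F mulr0 sin0 mulr1 sin_natpi !mulr0 subee.
- by apply: continuous_subspaceT; exact: continuous_cos_scale.
- split; first by move=> x _; exact: ex_derive.
  + by apply: cvg_at_right_filter; exact: cF.
  + by apply: cvg_at_left_filter; exact: cF.
- by move=> x _; rewrite derive1E; exact: derive_val.
Qed.

Lemma continuousM_fun (f g : R -> R) :
  continuous f -> continuous g -> continuous (fun x => f x * g x).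
Proof. by move=> cf cg x; apply: cvgM; [exact: cf|exact: cg]. Qed.

Lemma Rintegral_sine_fun m n : (0 < m)%N -> (0 < n)%N ->
  \int[lm]_(x in `[0, 1]) (sine_fun m x * sine_fun n x) = (m == n)%:R.
Proof.
move=> m0 n0.
under eq_Rintegral => x _ do rewrite sine_funM cos_subnat.
rewrite RintegralB//; last 2 first.
- by apply: continuous_integrable01; exact: continuous_cos_scale.
- by apply: continuous_integrable01; exact: continuous_cos_scale.
rewrite !Rintegral_cos_natpi addn_eq0 [X in _ && X]eqn0Ngt n0 andbF subr0.
have -> // : (maxn m n - minn m n == 0)%N = (m == n).
by move: m0 n0; clear; rewrite maxnE minnE; case: ltngtP => //; lia.
Qed.

Lemma continuous_bridge_cov s : 0 <= s <= 1 -> continuous (bridge_cov s).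
Proof.
move=> s01 t; apply/cvgrPdist_le => /= e e0; near=> x.
apply: (le_trans (bridge_cov_lipr _ _ s01)).
by near: x; apply: cvgr_dist_le => //; exact: cvg_id.
Unshelve. all: by end_near. Qed.

(** Mercer's expansion is integrated against [sine_fun m]. A partial sum with M > m gives the
    right-hand side exactly by orthonormality; the remainder 16 / M times the bound 2 on the sine
    gives the error 32 / M. *)
Lemma Rintegral_bridge_cov m s : (0 < m)%N -> 0 <= s <= 1 ->
  \int[lm]_(t in `[0, 1]) (bridge_cov s t * sine_fun m t) =
  bridge_eig m * sine_fun m s.
Proof.
move=> m0 s01; apply/eqP; rewrite -subr_eq0 -normr_le0.
apply/ler_addgt0Pl => e e0; rewrite addr0.
have [M [mM Me]] : exists M, (m < M)%N /\ 32 / M%:R <= e :> R.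
  pose M := maxn m.+1 (Num.truncn (32 / e)).+1.
  exists M; split; first by rewrite /M leq_max leqnn.
  have M0 : 0 < M%:R :> R by rewrite ltr0n /M leq_max.
  rewrite ler_pdivrMr// mulrC -ler_pdivrMr//.
  have /truncn_itv/andP[_ /ltW/le_trans] : 0 <= 32 / e :> R by rewrite divr_ge0// ltW.
  by apply; rewrite ler_nat /M leq_max leqnn orbT.
have M0 : (0 < M)%N by exact: ltn_trans mM.
have csf n := @continuous_sine_fun R n.
pose S t := \sum_(1 <= n < M.+1) bridge_eig n * (sine_fun n s * sine_fun n t).
have ST t : S t * sine_fun m t = \sum_(1 <= n < M.+1)
    (bridge_eig n * sine_fun n s) * (sine_fun n t * sine_fun m t).
  by rewrite /S big_distrl/=; apply: eq_bigr => n _; rewrite !mulrA.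
have iK : lm.-integrable `[0, 1] (EFin \o (fun t => bridge_cov s t * sine_fun m t)).
  by apply/continuous_integrable01/continuousM_fun => //; exact: continuous_bridge_cov.
have cS : continuous S.
  move=> t; rewrite /S; apply: cvgr_sum => n _.
  by apply: cvgMl_tmp; apply: cvgMl_tmp; exact: csf.
have iS : lm.-integrable `[0, 1] (EFin \o (fun t => S t * sine_fun m t)).
  by apply/continuous_integrable01/continuousM_fun.
have <- : \int[lm]_(t in `[0, 1]) (S t * sine_fun m t) = bridge_eig m * sine_fun m s.
  under eq_Rintegral => t _ do rewrite ST.
  have H (r : seq nat) : all (leq 1) r -> lm.-integrable `[0, 1] (EFin \o
      (fun t => \sum_(n <- r) bridge_eig n * sine_fun n s * (sine_fun n t * sine_fun m t)))
    /\ \int[lm]_(t in `[0, 1])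
      (\sum_(n <- r) bridge_eig n * sine_fun n s * (sine_fun n t * sine_fun m t)) =
    \sum_(n <- r) bridge_eig n * sine_fun n s * (n == m)%:R.
    move=> r1; split.
      apply: continuous_integrable01 => t; apply: cvgr_sum => n _.
      by apply: cvgMl_tmp; apply: cvgM; exact: csf.
    elim: r r1 => [_|n r IH /= /andP[n0 /IH{}IH]].
      under eq_Rintegral do rewrite big_nil.
      by rewrite Rintegral_cst// mul0r big_nil.
    under eq_Rintegral do rewrite big_cons.
    rewrite RintegralD ?big_cons ?IH//; last 2 first.
    - by apply: continuous_integrable01 => t; apply: cvgMl_tmp; apply: cvgM; exact: csf.
    - apply: continuous_integrable01 => t; apply: cvgr_sum => k _.
      by apply: cvgMl_tmp; apply: cvgM; exact: csf.
    rewrite RintegralZl ?Rintegral_sine_fun//.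
    by apply: continuous_integrable01; exact: continuousM_fun.
  have [|_ ->] := H (index_iota 1 M.+1).
    by apply/allP => n; rewrite mem_index_iota => /andP[].
  rewrite (bigD1_seq m) ?mem_index_iota ?m0 ?ltnS ?(ltnW mM) ?iota_uniq//=.
  by rewrite eqxx mulr1 big1 ?addr0// => n /negbTE ->; rewrite mulr0.
rewrite -RintegralB//.
have iD : lm.-integrable `[0, 1]
    (EFin \o (fun t => bridge_cov s t * sine_fun m t - S t * sine_fun m t)).
  apply/continuous_integrable01 => t; apply: cvgB.
    by apply: continuousM_fun => //; exact: continuous_bridge_cov.
  exact: continuousM_fun.
apply: (le_trans (le_normr_Rintegral _ iD)) => //.
apply: (@le_trans _ _ (\int[lm]_(t in `[0, 1]) (32 / M%:R))); last first.
  by rewrite Rintegral_cst//= lebesgue_measure_itv/= lte01 oppr0 adde0/= mulr1.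
apply: le_Rintegral => //.
- exact: (integrable_norm iD).
- by apply: continuous_integrable01 => t; exact: cvg_cst.
move=> t /=; rewrite in_itv/= => t01.
rewrite -mulrBl normrM.
have -> : 32 / M%:R = 16 / M%:R * 2 :> R by ring.
by rewrite ler_pM ?sine_fun_le//; exact: mercer_bridge.
Qed.

End bridge_integrals.

(** * Cosine transforms of Gaussian laws *)

Section normal_moments.
Context {R : realType} (m s : R).
Hypothesis s0 : s != 0.
Local Notation lm := (@lebesgue_measure R).
Local Notation p := (normal_pdf m s).

Let s20 : 0 < s ^+ 2. Proof. by rewrite exprn_even_gt0. Qed.

Lemma normal_pdf_expR : p = fun x => normal_peak s * expR (- (x - m) ^+ 2 / (s ^+ 2 *+ 2)).
Proof. by rewrite normal_pdfE. Qed.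

Lemma is_derive_normal_pdf (x : R) : is_derive x 1 p (- (x - m) / s ^+ 2 * p x).
Proof.
rewrite normal_pdf_expR; apply: is_derive_eq.
rewrite /GRing.scale/= -[_ *+ 2]mulr_natr; field.
exact: s0.
Qed.

(** A Gaussian of twice the standard deviation absorbs the quadratic factor: with y = (x - m)^2 / (4
    s^2) the claim is y <= exp (3 y / 2). Since that Gaussian is integrable, the second moment is
    finite. *)
Lemma normal_pdf_sqr_le x : (x - m) ^+ 2 * p x <=
  (4 * s ^+ 2 * normal_peak s / normal_peak (2 * s)) * normal_pdf m (2 * s) x.
Proof.
have s20' : 2 * s != 0 by rewrite mulf_neq0.
rewrite (normal_pdfE _ s20') normal_pdf_expR.
have pk0 := normal_peak_gt0 s20'; have pk := normal_peak_gt0 s0.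
rewrite [leRHS]mulrA divfK ?gt_eqF//.
rewrite [leLHS]mulrCA [4 * _ * normal_peak s]mulrC -[leRHS]mulrA ler_pM2l//.
set y := (x - m) ^+ 2 / (4 * s ^+ 2).
have y0 : 0 <= y by rewrite divr_ge0 ?sqr_ge0// mulr_ge0 ?ltW.
have -> : (x - m) ^+ 2 = 4 * s ^+ 2 * y by rewrite /y; field.
have c0 : 0 < 4 * s ^+ 2 by rewrite pmulr_rgt0.
rewrite -[leLHS]mulrA (ler_pM2l c0) /normal_fun.
have -> : - (x - m) ^+ 2 / ((2 * s) ^+ 2 *+ 2) = - (y / 2).
  by rewrite /y -[_ *+ 2]mulr_natr; field.
have -> : - (4 * s ^+ 2 * y) / (s ^+ 2 *+ 2) = - (2 * y).
  by rewrite -[_ *+ 2]mulr_natr; field.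
have -> : - (y / 2) = - (2 * y) + y * 3 / 2 by field.
rewrite expRD mulrC ler_pM2l ?expR_gt0//.
apply: le_trans (expR_ge1Dx _); lra.
Qed.

Lemma integrable_normal_pdf_sqr :
  lm.-integrable setT (EFin \o (fun x => (x - m) ^+ 2 * p x)).
Proof.
apply: (@le_integrable _ _ _ lm _ _ _
  (fun x => (4 * s ^+ 2 * normal_peak s / normal_peak (2 * s))%:E *
     (normal_pdf m (2 * s) x)%:E)%E) => //.
- apply/measurable_EFinP; apply: measurable_funM; last exact: measurable_normal_pdf.
  by apply: measurable_funX; exact: measurable_funB.
- move=> x _; rewrite -EFinM /= lee_fin.
  have xp0 : 0 <= (x - m) ^+ 2 * p x by rewrite mulr_ge0 ?sqr_ge0 ?normal_pdf_ge0.
  rewrite (ger0_norm xp0).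
  exact: (le_trans (normal_pdf_sqr_le x) (ler_norm _)).
- by apply: integrableZl => //=; exact: integrable_normal_pdf.
Qed.

Lemma integrable_normal_pdf_abs :
  lm.-integrable setT (EFin \o (fun x => `|x - m| * p x)).
Proof.
apply: (@le_integrable _ _ _ lm _ _ _
  (EFin \o (fun x => p x + (x - m) ^+ 2 * p x))) => //.
- apply/measurable_EFinP; apply: measurable_funM; last exact: measurable_normal_pdf.
  by apply: measurableT_comp => //; exact: measurable_funB.
- move=> x _; rewrite /= lee_fin.
  have xp0 : 0 <= `|x - m| * p x by rewrite mulr_ge0 ?normal_pdf_ge0.
  rewrite (ger0_norm xp0); apply: le_trans (ler_norm _).
  rewrite -[X in _ <= X + _]mul1r -mulrDl ler_wpM2r ?normal_pdf_ge0//.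
  by rewrite -[(x - m) ^+ 2](real_normK (num_real _)); have := normr_ge0 (x - m); nra.
- rewrite (_ : _ \o _ = (fun x => (p x)%:E + ((x - m) ^+ 2 * p x)%:E)%E)//.
  apply: integrableD => //; first exact: integrable_normal_pdf.
  exact: integrable_normal_pdf_sqr.
Qed.

(** From y exp (- y) <= 1. This decay makes the boundary terms vanish in the integrations by parts
    below. *)
Lemma normal_pdf_abs_le x : x != m ->
  `|x - m| * p x <= 2 * s ^+ 2 * normal_peak s / `|x - m|.
Proof.
move=> xm; have xm0 : 0 < `|x - m| by rewrite normr_gt0 subr_eq0.
rewrite normal_pdf_expR ler_pdivlMr// mulrAC -expr2 (real_normK (num_real _)).
rewrite mulrCA [leRHS]mulrC ler_pM2l ?normal_peak_gt0//.
rewrite mulNr; set y := (x - m) ^+ 2 / (s ^+ 2 *+ 2).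
have -> : (x - m) ^+ 2 = 2 * s ^+ 2 * y.
  by rewrite /y -[_ *+ 2]mulr_natr; field.
have c0 : 0 < 2 * s ^+ 2 by rewrite pmulr_rgt0.
rewrite -[leLHS]mulrA -[leRHS]mulr1 (ler_pM2l c0) expRN.
rewrite ler_pdivrMr ?expR_gt0// mul1r.
by apply: le_trans (expR_ge1Dx _); lra.
Qed.

End normal_moments.

Section integral_derivative.
Context {R : realType}.
Local Notation lm := (@lebesgue_measure R).

(** Integration by parts on the line: the Gaussian identities below are instances in which F is the
    density times a suitable factor. The fundamental theorem on [-n, n] is passed to the limit by
    dominated convergence. *)
Lemma Rintegral_derivative_eq0 (F f : R -> R) :
  (forall x : R, is_derive x 1 F (f x)) -> continuous f ->
  lm.-integrable setT (EFin \o f) ->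
  F n%:R @[n --> \oo] --> (0 : R) -> F (- n%:R) @[n --> \oo] --> (0 : R) ->
  \int[lm]_x f x = 0.
Proof.
move=> dF cf fi Fp Fn.
have cF : continuous F.
  by move=> x; apply: differentiable_continuous; apply/derivable1_diffP; exact: ex_derive.
pose g (n : nat) := (EFin \o f) \_ `[- n%:R, n%:R].
have gi : (\int[lm]_x g n x)%E @[n --> \oo] --> (\int[lm]_x (f x)%:E)%E.
  apply: (@dominated_cvg _ _ _ lm setT _ g _ (fun x => `|(f x)%:E|%E)) => //.
  - move=> n; apply/(measurable_restrictT _ _).1 => //.
    by apply: measurable_funTS; exact: measurable_int fi.
  - move=> x _; apply: cvg_near_cst; near=> n.
    rewrite /g patchE mem_set//= in_itv/= -ler_norml.
    by near: n; exact: nbhs_infty_ger.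
  - exact: integrable_abse.
  - by move=> n x _; rewrite /g patchE; case: ifPn => // _; rewrite abse0.
have gE n : (0 < n)%N -> (\int[lm]_x g n x)%E = (F n%:R - F (- n%:R))%:E.
  move=> n0; rewrite /g -integral_mkcond (@continuous_FTC2 _ f F)//.
  - by rewrite gtrN// ltr0n.
  - exact: continuous_subspaceT.
  - split; first by move=> x _; exact: ex_derive.
    + by apply: cvg_at_right_filter; exact: cF.
    + by apply: cvg_at_left_filter; exact: cF.
  - by move=> x _; rewrite derive1E; exact: derive_val.
have h0 : (F n%:R - F (- n%:R))%:E @[n --> \oo] --> (0 : R)%:E.
  apply: cvg_EFin; first exact: nearW.
  by rewrite -[X in _ --> X](subr0 0); exact: cvgB.
have h1 : (\int[lm]_x g n x)%E @[n --> \oo] --> (0 : R)%:E.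
  apply: cvg_trans h0; apply: near_eq_cvg; near=> n.
  by rewrite gE//; near: n; exact: nbhs_infty_gt.
by rewrite /Rintegral (cvg_unique _ gi h1).
Unshelve. all: by end_near. Qed.

End integral_derivative.

Section normal_integrals.
Context {R : realType} (m s : R).
Hypothesis s0 : s != 0.
Local Notation lm := (@lebesgue_measure R).
Local Notation p := (normal_pdf m s).

Let s20 : s ^+ 2 != 0. Proof. by rewrite expf_neq0. Qed.

Lemma continuous_normal_pdfM (f : R -> R) :
  continuous f -> continuous (fun x => f x * p x).
Proof. by move=> cf; apply: continuousM_fun => //; exact: continuous_normal_pdf. Qed.

Lemma cvg_normal_pdf_abs (u : nat -> R) :
  `|u n - m| @[n --> \oo] --> +oo -> `|u n - m| * p (u n) @[n --> \oo] --> (0 : R).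
Proof.
move=> uoo; set C := 2 * s ^+ 2 * normal_peak s.
apply: (@squeeze_cvgr _ _ _ _ (fun=> 0) (fun n => C * `|u n - m|^-1)).
- near=> n; rewrite mulr_ge0 ?normal_pdf_ge0//= normal_pdf_abs_le//.
  rewrite -subr_eq0 -normr_gt0.
  by near: n; move/cvgryPgt : uoo; apply.
- exact: cvg_cst.
- rewrite -[X in _ --> X](mulr0 C); apply: cvgMl_tmp.
  apply/gtr0_cvgV0 => //; near=> n.
  by near: n; move/cvgryPgt : uoo; apply.
Unshelve. all: by end_near. Qed.

Lemma cvg_abs_natrB : `|n%:R - m| @[n --> \oo] --> +oo.
Proof.
apply/cvgryPge => A; near=> n.
apply: le_trans (ler_norm _); rewrite lerBrDr.
by near: n; exact: nbhs_infty_ger.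
Unshelve. all: by end_near. Qed.

Lemma cvg_abs_natrN : `|- n%:R - m| @[n --> \oo] --> +oo.
Proof.
apply/cvgryPge => A; near=> n.
rewrite -normrN opprB opprK addrC; apply: le_trans (ler_norm _); rewrite -lerBlDr.
by near: n; exact: nbhs_infty_ger.
Unshelve. all: by end_near. Qed.

Lemma cvg_normal_pdf (u : nat -> R) :
  `|u n - m| @[n --> \oo] --> +oo -> p (u n) @[n --> \oo] --> (0 : R).
Proof.
move=> uoo; apply: (@squeeze_cvgr _ _ _ _ (fun=> 0) (fun n => `|u n - m| * p (u n))).
- near=> n; rewrite normal_pdf_ge0//= ler_peMl ?normal_pdf_ge0//.
  by near: n; move/cvgryPge : uoo; apply.
- exact: cvg_cst.
- exact: cvg_normal_pdf_abs.
Unshelve. all: by end_near. Qed.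

Lemma Rintegral_normal_pdf_centered : \int[lm]_x ((x - m) * p x) = 0.
Proof.
have H : \int[lm]_x (- s ^+ 2 * (- (x - m) / s ^+ 2 * p x)) = 0.
  apply: (@Rintegral_derivative_eq0 _ (fun x => - s ^+ 2 * p x)
    (fun x => - s ^+ 2 * (- (x - m) / s ^+ 2 * p x))).
  - move=> x; have dp := is_derive_normal_pdf m s0 x.
    by apply: is_derive_eq.
  - have -> : (fun x => - s ^+ 2 * (- (x - m) / s ^+ 2 * p x)) =
        (fun x => (x - m) * p x) by apply/funext => x; field.
    apply: continuous_normal_pdfM => x.
    by apply: cvgB; [exact: cvg_id|exact: cvg_cst].
  - have -> : (fun x => - s ^+ 2 * (- (x - m) / s ^+ 2 * p x)) =
        (fun x => (x - m) * p x) by apply/funext => x; field.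
    have := integrable_normal_pdf_abs m s0.
    apply: le_integrable => //.
      apply/measurable_EFinP/measurable_funM; last exact: measurable_normal_pdf.
      exact: measurable_funB.
    by move=> x _ /=; rewrite lee_fin !normrM normr_id.
  - rewrite -[X in _ --> X](mulr0 (- s ^+ 2)); apply: cvgMl_tmp.
    exact: cvg_normal_pdf cvg_abs_natrB.
  - rewrite -[X in _ --> X](mulr0 (- s ^+ 2)); apply: cvgMl_tmp.
    exact: cvg_normal_pdf cvg_abs_natrN.
by rewrite -[RHS]H; apply: eq_Rintegral => x _; field.
Qed.

Lemma Rintegral_normal_pdf : \int[lm]_x p x = 1.
Proof. by rewrite /Rintegral integral_normal_pdf. Qed.

Lemma Rintegral_normal_pdf_sqr : \int[lm]_x ((x - m) ^+ 2 * p x) = s ^+ 2.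
Proof.
apply/eqP; rewrite -subr_eq0 -[X in _ - X]mulr1 -Rintegral_normal_pdf; apply/eqP.
rewrite -RintegralZl//; last exact: integrable_normal_pdf.
rewrite -RintegralB//; last 2 first.
- exact: integrable_normal_pdf_sqr.
- have := integrableZl measurableT (s ^+ 2) (integrable_normal_pdf m s).
  exact.
apply: (@Rintegral_derivative_eq0 _ (fun x => - s ^+ 2 * ((x - m) * p x))
  (fun x => (x - m) ^+ 2 * p x - s ^+ 2 * p x)).
- move=> x; have dp := is_derive_normal_pdf m s0 x.
  apply: is_derive_eq; rewrite /GRing.scale/=; field.
  exact: s0.
- have -> : (fun x => (x - m) ^+ 2 * p x - s ^+ 2 * p x) =
      (fun x => ((x - m) ^+ 2 - s ^+ 2) * p x) by apply/funext => x; ring.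
  apply: continuous_normal_pdfM => x.
  apply: cvgB; last exact: cvg_cst.
  by apply: cvgM; apply: cvgB; (exact: cvg_id || exact: cvg_cst).
- have := integrableB measurableT (integrable_normal_pdf_sqr m s0)
    (integrableZl measurableT (s ^+ 2) (integrable_normal_pdf m s)).
  exact.
- rewrite -[X in _ --> X](mulr0 (- s ^+ 2)); apply: cvgMl_tmp.
  apply: norm_cvg0; have := cvg_normal_pdf_abs cvg_abs_natrB.
  by apply: cvg_trans; apply: near_eq_cvg; near=> n; rewrite normrM (ger0_norm (normal_pdf_ge0 _ _ _)).
- rewrite -[X in _ --> X](mulr0 (- s ^+ 2)); apply: cvgMl_tmp.
  apply: norm_cvg0; have := cvg_normal_pdf_abs cvg_abs_natrN.
  by apply: cvg_trans; apply: near_eq_cvg; near=> n; rewrite normrM (ger0_norm (normal_pdf_ge0 _ _ _)).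
Unshelve. all: by end_near. Qed.

(** The phases c = 0 and c = - pi / 2 give the real and imaginary parts of the characteristic
    function of the centred law. *)
Definition normal_cos (c u : R) : R := \int[lm]_x (cos (u * (x - m) + c) * p x).

Lemma integrable_bounded_normal_pdf (f : R -> R) : measurable_fun setT f ->
  (forall x, `|f x| <= 1) -> lm.-integrable setT (EFin \o (fun x => f x * p x)).
Proof.
move=> mf f1; have := integrable_normal_pdf m s.
apply: le_integrable => //.
  by apply/measurable_EFinP/measurable_funM => //; exact: measurable_normal_pdf.
by move=> x _ /=; rewrite lee_fin normrM ler_piMl.
Qed.

Lemma continuous_affine (u c : R) : continuous (fun x => u * (x - m) + c).
Proof.
move=> x; apply: cvgD; last exact: cvg_cst.
by apply: cvgMl_tmp; apply: cvgB; [exact: cvg_id|exact: cvg_cst].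
Qed.

Lemma continuous_cos_affine (u c : R) : continuous (fun x => cos (u * (x - m) + c)).
Proof.
move=> x; apply: (@continuous_cvg _ _ _ _ _ (fun x => u * (x - m) + c) (@cos R)).
  exact: continuous_cos.
exact: continuous_affine.
Qed.

Lemma continuous_sin_affine (u c : R) : continuous (fun x => sin (u * (x - m) + c)).
Proof.
move=> x; apply: (@continuous_cvg _ _ _ _ _ (fun x => u * (x - m) + c) (@sin R)).
  exact: continuous_sin.
exact: continuous_affine.
Qed.

(** Stein's identity E (x - m) g = s^2 E g' for g x = sin (u (x - m) + c): the difference of the two
    integrands is the derivative of - s^2 g p. *)
Lemma Rintegral_normal_stein (u c : R) :
  \int[lm]_x ((x - m) * sin (u * (x - m) + c) * p x) = s ^+ 2 * u * normal_cos c u.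
Proof.
have mC := continuous_measurable_fun (@continuous_cos_affine u c).
have mS := continuous_measurable_fun (@continuous_sin_affine u c).
have iC : lm.-integrable setT (EFin \o (fun x => cos (u * (x - m) + c) * p x)).
  by apply: integrable_bounded_normal_pdf => // x; exact: cos_max.
have iS : lm.-integrable setT
    (EFin \o (fun x => (x - m) * sin (u * (x - m) + c) * p x)).
  have := integrable_normal_pdf_abs m s0; apply: le_integrable => //.
    apply/measurable_EFinP/measurable_funM; last exact: measurable_normal_pdf.
    by apply: measurable_funM => //; exact: measurable_funB.
  move=> x _ /=; rewrite lee_fin !normrM normr_id ler_wpM2r//.
  by rewrite ler_piMr// sin_max.
rewrite /normal_cos -RintegralZl//; apply/eqP; rewrite -subr_eq0; apply/eqP.
have iC' : lm.-integrable setT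
    (EFin \o (fun x => s ^+ 2 * u * (cos (u * (x - m) + c) * p x))).
  by have := integrableZl measurableT (s ^+ 2 * u) iC.
rewrite -RintegralB//.
apply: (@Rintegral_derivative_eq0 _
  (fun x => - s ^+ 2 * (sin (u * (x - m) + c) * p x))
  (fun x => (x - m) * sin (u * (x - m) + c) * p x -
    s ^+ 2 * u * (cos (u * (x - m) + c) * p x))).
- move=> x; have dp := is_derive_normal_pdf m s0 x.
  apply: is_derive_eq; rewrite /GRing.scale/=; field.
  exact: s0.
- have c1 : continuous (fun x : R => x - m).
    by move=> y; apply: cvgB; [exact: cvg_id|exact: cvg_cst].
  have c2 := continuous_normal_pdfM (continuousM_fun c1 (@continuous_sin_affine u c)).
  have c3 := continuous_normal_pdfM (@continuous_cos_affine u c).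
  move=> x; apply: cvgB; first exact: c2.
  by apply: cvgMl_tmp; exact: c3.
- by have := integrableB measurableT iS iC'.
- rewrite -[X in _ --> X](mulr0 (- s ^+ 2)); apply: cvgMl_tmp; apply: norm_cvg0.
  apply: (@squeeze_cvgr _ _ _ _ (fun=> 0) (fun n : nat => p n%:R)).
  + near=> n; rewrite normr_ge0/= normrM (ger0_norm (normal_pdf_ge0 _ _ _)).
    by rewrite ler_piMl ?normal_pdf_ge0// sin_max.
  + exact: cvg_cst.
  + exact: cvg_normal_pdf cvg_abs_natrB.
- rewrite -[X in _ --> X](mulr0 (- s ^+ 2)); apply: cvgMl_tmp; apply: norm_cvg0.
  apply: (@squeeze_cvgr _ _ _ _ (fun=> 0) (fun n : nat => p (- n%:R))).
  + near=> n; rewrite normr_ge0/= normrM (ger0_norm (normal_pdf_ge0 _ _ _)).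
    by rewrite ler_piMl ?normal_pdf_ge0// sin_max.
  + exact: cvg_cst.
  + exact: cvg_normal_pdf cvg_abs_natrN.
Unshelve. all: by end_near. Qed.

(** Differentiation under the integral, dominated by |x - m| p, followed by Stein's identity. The
    resulting linear equation is solved in [normal_cosE] by the integrating factor exp (s^2 u^2 /
    2). *)
Lemma is_derive_normal_cos (c u : R) :
  is_derive u 1 (normal_cos c) (- (s ^+ 2 * u) * normal_cos c u).
Proof.
pose f (u x : R) := cos (u * (x - m) + c) * p x.
have df (v x : R) : is_derive v 1 (f ^~ x) (- ((x - m) * sin (v * (x - m) + c) * p x)).
  rewrite /f; apply: is_derive_eq; rewrite /GRing.scale/=; ring.
have d1f v x : partial1of2 f v x = - ((x - m) * sin (v * (x - m) + c) * p x).
  by rewrite partial1of2E; apply: derive_val.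
have Iu : `]u - 1, u + 1[%classic u by rewrite /= in_itv/=; lra.
have intf (v : R) : `]u - 1, u + 1[%classic v -> lm.-integrable setT (EFin \o f v).
  move=> _; apply: integrable_bounded_normal_pdf => [|x]; last exact: cos_max.
  exact: continuous_measurable_fun (@continuous_cos_affine v c).
have derf (v x : R) : `]u - 1, u + 1[%classic v -> setT x -> derivable (f ^~ x) v 1.
  by move=> _ _; case: (df v x).
have G0 (x : R) : 0 <= `|x - m| * p x by rewrite mulr_ge0 ?normal_pdf_ge0.
have Gub (v x : R) : `]u - 1, u + 1[%classic v -> setT x ->
    `|partial1of2 f v x| <= `|x - m| * p x.
  move=> _ _; rewrite d1f normrN !normrM (ger0_norm (normal_pdf_ge0 _ _ _)).
  by rewrite ler_wpM2r ?normal_pdf_ge0// ler_piMr// sin_max.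
have iG := integrable_normal_pdf_abs m s0.
have D := derivable_under_integral measurableT Iu intf derf G0 iG Gub.
have E := differentiation_under_integral measurableT Iu intf derf G0 iG Gub.
apply: DeriveDef; first exact: D.
rewrite -derive1E E.
under eq_Rintegral => x _ do rewrite d1f.
rewrite mulNr -Rintegral_normal_stein.
have iS : lm.-integrable setT
    (EFin \o (fun x => (x - m) * sin (u * (x - m) + c) * p x)).
  apply: le_integrable iG => //.
    apply/measurable_EFinP/measurable_funM; last exact: measurable_normal_pdf.
    apply: measurable_funM; first exact: measurable_funB.
    exact: continuous_measurable_fun (@continuous_sin_affine u c).
  move=> x _ /=; rewrite lee_fin !normrM normr_id ler_wpM2r//.
  by rewrite ler_piMr// sin_max.
by under eq_Rintegral do rewrite -mulN1r; rewrite RintegralZl// mulN1r.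
Qed.

Lemma normal_cosE (c u : R) : normal_cos c u = expR (- (s ^+ 2 * u ^+ 2 / 2)) * cos c.
Proof.
pose B (u : R) := normal_cos c u * expR (s ^+ 2 * u ^+ 2 / 2).
have BE : B u = B 0.
  apply: is_derive_0_is_cst => x; rewrite /B.
  have dN := is_derive_normal_cos c x.
  apply: is_derive_eq; rewrite /GRing.scale/=; field.
  by [].
have B0 : B 0 = cos c.
  rewrite /B expr0n mulr0 mul0r expR0 mulr1 /normal_cos.
  under eq_Rintegral do rewrite mul0r add0r.
  by rewrite RintegralZl ?Rintegral_normal_pdf ?mulr1//; exact: integrable_normal_pdf.
by rewrite expRN -B0 -BE /B mulrCA mulVf ?mulr1// gt_eqF// expR_gt0.
Qed.

End normal_integrals.

Section Rintegral_bigop.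
Context d (T : measurableType d) (R : realType) (mu : {measure set T -> \bar R}).
Context (D : set T) (mD : measurable D) (I : Type) (r : seq I) (P : pred I).
Variable h : I -> T -> R.
Hypothesis ih : forall i, P i -> mu.-integrable D (EFin \o h i).

Lemma integrable_Rsum :
  mu.-integrable D (EFin \o (fun x => \sum_(i <- r | P i) h i x)).
Proof.
rewrite (_ : _ \o _ = fun x => \sum_(i <- r | P i) (h i x)%:E)%E.
  exact: (@integrable_sum _ _ _ mu D mD _ r P (fun i x => (h i x)%:E)).
by apply/funext => x /=; rewrite sumEFin.
Qed.

End Rintegral_bigop.

Section Rintegral_sum.
Context d (T : measurableType d) (R : realType) (mu : {measure set T -> \bar R}).
Context (D : set T) (mD : measurable D) (I : Type) (r : seq I) (P : pred I).
Variable h : I -> T -> R.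
Hypothesis ih : forall i, P i -> mu.-integrable D (EFin \o h i).

Lemma Rintegral_sum :
  \int[mu]_(x in D) (\sum_(i <- r | P i) h i x) =
  \sum_(i <- r | P i) \int[mu]_(x in D) h i x.
Proof.
elim: r => [|i s IH].
  under eq_Rintegral do rewrite big_nil.
  by rewrite big_nil Rintegral_cst// mul0r.
rewrite big_cons; case: ifPn => Pi.
  under eq_Rintegral do rewrite big_cons Pi.
  by rewrite RintegralD ?IH//; [exact: ih|exact: integrable_Rsum].
by under eq_Rintegral do rewrite big_cons (negbTE Pi).
Qed.

End Rintegral_sum.

Section gaussian_cos.
Context {R : realType}.
Local Notation lm := (@lebesgue_measure R).

Lemma integral_normal_prob (m s : R) (f : R -> \bar R) :
  (normal_prob m s).-integrable setT f ->
  (\int[normal_prob m s]_x f x = \int[lm]_x (f x * (normal_pdf m s x)%:E))%E.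
Proof.
move=> fi; have dom := normal_prob_dominates m s.
have mf := measurable_int _ fi.
have mp : measurable_fun setT (fun x => (normal_pdf m s x)%:E).
  by apply/measurable_EFinP; exact: measurable_normal_pdf.
rewrite -(Radon_Nikodym_change_of_variables dom)//=.
apply: ae_eq_integral => //.
- exact: emeasurable_funM.
- exact: emeasurable_funM.
- apply: ae_eqe_mul2l; apply: integral_ae_eq => //.
    exact: Radon_Nikodym_integrable.
  by move=> E _ mE; rewrite -Radon_Nikodym_integral.
Qed.

Context d (Omega : measurableType d) (P : probability Omega R).

Lemma integral_law (X : {RV P >-> R}) (mu : {measure set (measurableTypeR R) -> \bar R})
    (f : R -> \bar R) :
  (forall B, measurable B -> P (X @^-1` B) = mu B) ->
  measurable_fun setT f -> P.-integrable setT (f \o X) ->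
  mu.-integrable setT f /\ (\int[P]_w f (X w) = \int[mu]_x f x)%E.
Proof.
move=> XP mf fi.
have mX : measurable_fun setT (X : Omega -> measurableTypeR R).
  exact: (measurable_funP X).
have mf' : measurable_fun (setT : set (measurableTypeR R)) f by exact: mf.
have E g : (\int[pushforward P (X : Omega -> measurableTypeR R)]_x g x =
    \int[mu]_x g x)%E.
  by apply: eq_measure_integral => B mB _; exact: XP.
split; last by rewrite -E (integral_pushforward mX mf').
apply/integrableP; split => //.
rewrite -E; have := integrable_pushforward mX mf' fi measurableT.
by case/integrableP.
Qed.

Lemma gaussian_law_neq0 (m s : R) B : s != 0 -> gaussian_law m s B = normal_prob m s B.
Proof. by move=> s0; rewrite /gaussian_law (negbTE s0). Qed.

(** The law comes with unknown parameters m and s; the first two moments identify them as m = 0 and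
    s^2 = v. The Dirac case s = 0 is settled apart and forces v = 0. *)
Lemma Rintegral_gaussian_cos (X : {RV P >-> R}) (v c : R) :
  is_gaussian P X -> P.-integrable setT (EFin \o (fun w => X w ^+ 2)) ->
  \int[P]_w X w = 0 -> \int[P]_w (X w ^+ 2) = v ->
  \int[P]_w cos (X w + c) = expR (- (v / 2)) * cos c.
Proof.
move=> [m [s Xms]] iX2 EX EX2.
have mX : measurable_fun setT X by exact: measurable_funP.
have iX : P.-integrable setT (EFin \o X).
  have i1 : P.-integrable setT (EFin \o (fun w => 1 + X w ^+ 2)).
    rewrite (_ : _ \o _ = (fun w => 1%:E + (X w ^+ 2)%:E)%E)//.
    by apply: integrableD => //; exact: finite_measure_integrable_cst.
  apply: le_integrable i1 => //; first exact/measurable_EFinP.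
  move=> w _ /=; rewrite lee_fin; apply: le_trans (ler_norm _).
  by rewrite -[X w ^+ 2](real_normK (num_real _)); have := normr_ge0 (X w); nra.
have icos : P.-integrable setT (EFin \o (fun w => cos (X w + c))).
  have i1 := finite_measure_integrable_cst P 1 measurableT.
  apply: le_integrable i1 => //.
    apply/measurable_EFinP; apply: (measurableT_comp (f := @cos R)).
      by apply: continuous_measurable_fun; exact: continuous_cos.
    exact: measurable_funD.
  by move=> w _ /=; rewrite lee_fin normr1 cos_max.
have mcos : measurable_fun setT (fun x : R => cos (x + c)).
  apply: continuous_measurable_fun => x; apply: (@continuous_cvg _ _ _ _ _ (+%R^~ c) (@cos R)).
    exact: continuous_cos.
  by apply: cvgD; [exact: cvg_id|exact: cvg_cst].
have mX2 : measurable_fun setT (fun x : R => x ^+ 2).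
  exact: exprn_measurable.
have [s0|s0] := eqVneq s 0.
  pose D0 : {measure set (measurableTypeR R) -> \bar R} := \d_(m : measurableTypeR R).
  have XP B : measurable B -> P (X @^-1` B) = D0 B.
    by move=> /Xms; rewrite /gaussian_law s0 eqxx.
  have D (f : R -> R) : measurable_fun setT f ->
      P.-integrable setT (EFin \o (f \o X)) -> \int[P]_w f (X w) = f m.
    move=> mf fi; have mf' : measurable_fun setT (EFin \o f) by exact/measurable_EFinP.
    have [_] := integral_law XP mf' fi.
    rewrite /Rintegral => ->; rewrite /D0 integral_dirac//.
    by rewrite diracT mul1e.
  have m0 : m = 0 by rewrite -(D id)//; exact: measurable_id.
  have v0 : v = 0 by rewrite -EX2 (D (fun x => x ^+ 2))// m0 expr0n.
  by rewrite (D (fun x => cos (x + c)))// m0 v0 mul0r oppr0 expR0 mul1r add0r.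
have XP B : measurable B -> P (X @^-1` B) = normal_prob m s B.
  by move=> /Xms ->; exact: gaussian_law_neq0.
have D (f : R -> R) : measurable_fun setT f ->
    P.-integrable setT (EFin \o (f \o X)) ->
    \int[P]_w f (X w) = \int[lm]_x (f x * normal_pdf m s x).
  move=> mf fi; have mf' : measurable_fun setT (EFin \o f) by exact/measurable_EFinP.
  have [h] := integral_law XP mf' fi.
  by rewrite /Rintegral => ->; rewrite integral_normal_prob.
have ixp : lm.-integrable setT (EFin \o (fun x => (x - m) * normal_pdf m s x)).
  apply: le_integrable (integrable_normal_pdf_abs m s0) => //.
    apply/measurable_EFinP/measurable_funM; last exact: measurable_normal_pdf.
    exact: measurable_funB.
  by move=> x _ /=; rewrite lee_fin !normrM normr_id.
have m0 : m = 0.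
  rewrite -EX (D id)//.
  have -> : \int[lm]_x (x * normal_pdf m s x) =
      \int[lm]_x ((x - m) * normal_pdf m s x + m * normal_pdf m s x).
    by apply: eq_Rintegral => x _; ring.
  rewrite RintegralD//; last first.
    by have := integrableZl measurableT m (integrable_normal_pdf m s).
  rewrite Rintegral_normal_pdf_centered// RintegralZl//; last exact: integrable_normal_pdf.
  by rewrite Rintegral_normal_pdf mulr1 add0r.
have vs : v = s ^+ 2.
  rewrite -EX2 (D (fun x => x ^+ 2))// -(Rintegral_normal_pdf_sqr m s0).
  by apply: eq_Rintegral => x _; rewrite m0 subr0.
rewrite (D (fun x => cos (x + c)))//.
have := normal_cosE m s0 c 1; rewrite /normal_cos expr1n mulr1 -vs => <-.
by apply: eq_Rintegral => x _; rewrite m0 subr0 mul1r.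
Qed.

Lemma Rintegral_normal_prob_cos (a c : R) :
  \int[normal_prob 0 1]_x cos (a * x + c) = expR (- (a ^+ 2 / 2)) * cos c.
Proof.
have n10 : (1 : R) != 0 by [].
have := normal_cosE 0 n10 c a; rewrite /normal_cos expr1n mul1r => <-.
rewrite /Rintegral integral_normal_prob//.
  by congr fine; apply: eq_integral => x _; rewrite subr0.
have i1 := finite_measure_integrable_cst (normal_prob (0 : R) 1) 1 measurableT.
apply: le_integrable i1 => //; last first.
  by move=> w _ /=; rewrite lee_fin normr1 cos_max.
apply/measurable_EFinP; apply: continuous_measurable_fun => x.
apply: (@continuous_cvg _ _ _ _ _ (fun x => a * x + c) (@cos R)).
  exact: continuous_cos.
by apply: cvgD; [apply: cvgMl_tmp; exact: cvg_id|exact: cvg_cst].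
Qed.

End gaussian_cos.

(** * Uniqueness of the cosine transform *)

Section sine_periodicity.
Context {R : realType}.
Implicit Types (u : R).

Lemma sine_funN m u : sine_fun m (- u) = - sine_fun m u.
Proof. by rewrite /sine_fun mulrN sinN mulrN. Qed.

Lemma sine_funD2 m u k : sine_fun m (u + (2 * k)%:R) = sine_fun m u.
Proof.
rewrite /sine_fun; congr (_ * _).
have -> : m%:R * pi * (u + (2 * k)%:R) = m%:R * pi * u + (pi *+ 2) *+ (m * k) :> R.
  by rewrite -[_ *+ (m * k)]mulr_natr -[_ *+ 2]mulr_natr !natrM; ring.
exact: (periodicn (@sinD2pi R)).
Qed.

(** All the sines are odd with period 2, so one folding of the line onto the unit interval serves
    every m. As sg and u0 are independent of m, a bound for a combination of sines on the unit
    interval extends to the line. *)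
Lemma sine_fun_reduce u : exists sg u0 : R,
  [/\ `|sg| = 1, 0 <= u0 <= 1 & forall m, sine_fun m u = sg * sine_fun m u0].
Proof.
wlog u0 : u / 0 <= u => [H|].
  have [/H//|/ltW u0] := leP 0 u.
  have [|sg [v [sg1 v01 hv]]] := H (- u); first by rewrite oppr_ge0.
  exists (- sg), v; split => // [|m]; first by rewrite normrN.
  by rewrite -(opprK u) sine_funN hv mulNr.
pose k := Num.truncn (u / 2).
have /andP[k1 k2] : k%:R <= u / 2 < k.+1%:R by apply: truncn_itv; rewrite divr_ge0.
pose v := u - (2 * k)%:R.
have v0 : 0 <= v by rewrite subr_ge0 natrM mulrC -ler_pdivlMr.
have v2 : v < 2 by rewrite ltrBlDr natrM -{1}[2]mulr1 -mulrDr nat1r mulrC -ltr_pdivrMr.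
have uE m : sine_fun m u = sine_fun m v.
  by rewrite -(sine_funD2 m v k) /v subrK.
have [v1|v1] := leP v 1.
  by exists 1, v; split; rewrite ?normr1 ?v0// => m; rewrite mul1r.
(* Between 1 and 2 the point is reflected to 2 - v, which costs a sign. *)
exists (-1), (2 - v); split; first by rewrite normrN normr1.
  by lra.
move=> m; rewrite uE mulN1r -sine_funN opprB.
have -> : v - 2 = v - (2 * 1)%:R by [].
by rewrite -(sine_funD2 m (v - _) 1) subrK.
Qed.

Definition trapezoid_coef (a b e : R) m : R :=
  sine_fun m (a + e) - sine_fun m a - sine_fun m (b + e) + sine_fun m b.

Definition trapezoid_sum M (a b e u : R) : R :=
  \sum_(1 <= m < M.+1) bridge_eig m * (sine_fun m u * trapezoid_coef a b e m).

(* As a function of u, the bump that vanishes outside [a, b + e] and equals e on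
   [a + e, b]; Mercer's expansion makes it a limit of trigonometric sums. *)
Definition trapezoid (a b e u : R) : R :=
  bridge_cov u (a + e) - bridge_cov u a - bridge_cov u (b + e) + bridge_cov u b.

Lemma trapezoid_itv a b e u : 0 <= e -> a <= b -> 0 <= trapezoid a b e u <= e.
Proof.
move=> e0 ab; rewrite /trapezoid /bridge_cov !minEle.
by case: (leP u (a + e)) => h1; case: (leP u a) => h2;
  case: (leP u (b + e)) => h3; case: (leP u b) => h4; apply/andP; split; lra.
Qed.

Lemma trapezoid_out a b e u : 0 <= e -> a <= b -> u <= a \/ b + e <= u ->
  trapezoid a b e u = 0.
Proof.
move=> e0 ab h; rewrite /trapezoid /bridge_cov !minEle.
by case: (leP u (a + e)) => h1; case: (leP u a) => h2;
  case: (leP u (b + e)) => h3; case: (leP u b) => h4; case: h => h; lra.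
Qed.

Lemma trapezoid_in a b e u : 0 <= e -> a + e <= u <= b ->
  trapezoid a b e u = e.
Proof.
move=> e0 /andP[h h']; rewrite /trapezoid /bridge_cov !minEle.
by case: (leP u (a + e)) => h1; case: (leP u a) => h2;
  case: (leP u (b + e)) => h3; case: (leP u b) => h4; lra.
Qed.

(** Four bridge kernels, each with a Mercer remainder of 16 / M. *)
Lemma trapezoid_sum_approx M a b e u : (0 < M)%N ->
  0 <= u <= 1 -> 0 <= a -> a <= b -> 0 <= e -> b + e <= 1 ->
  `|trapezoid_sum M a b e u - trapezoid a b e u| <= 64 / M%:R.
Proof.
move=> M0 u01 a0 ab e0 be1.
have h t : 0 <= t <= 1 -> `|bridge_cov u t -
    \sum_(1 <= m < M.+1) bridge_eig m * (sine_fun m u * sine_fun m t)| <= 16 / M%:R.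
  by move=> t01; exact: mercer_bridge.
pose S t := \sum_(1 <= m < M.+1) bridge_eig m * (sine_fun m u * sine_fun m t).
have -> : trapezoid_sum M a b e u = S (a + e) - S a - S (b + e) + S b.
  rewrite /trapezoid_sum /S -!sumrB -big_split/=; apply: eq_bigr => m _.
  by rewrite /trapezoid_coef; ring.
have h1 : `|bridge_cov u (a + e) - S (a + e)| <= 16 / M%:R by apply: h; lra.
have h2 : `|bridge_cov u a - S a| <= 16 / M%:R by apply: h; lra.
have h3 : `|bridge_cov u (b + e) - S (b + e)| <= 16 / M%:R by apply: h; lra.
have h4 : `|bridge_cov u b - S b| <= 16 / M%:R by apply: h; lra.
rewrite /trapezoid; move: h1 h2 h3 h4; rewrite !ler_norml.
have -> : 64 / M%:R = 16 / M%:R *+ 4 :> R by rewrite -[_ *+ 4]mulr_natr; ring.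
set c := 16 / M%:R; rewrite -[c *+ 4]mulr_natr.
move: (S _) (S _) (S _) (S _) (bridge_cov _ _) (bridge_cov _ _)
  (bridge_cov _ _) (bridge_cov _ _) => x1 x2 x3 x4 y1 y2 y3 y4.
by move=> /andP[? ?] /andP[? ?] /andP[? ?] /andP[? ?]; apply/andP; split; lra.
Qed.

(** Here u ranges over the whole line. Outside the unit interval the sum no longer approximates the
    trapezoid, yet it stays bounded, as dominated convergence will require. *)
Lemma trapezoid_sum_bound M a b e u : (0 < M)%N ->
  0 <= a -> a <= b -> 0 <= e -> b + e <= 1 ->
  `|trapezoid_sum M a b e u| <= e + 64 / M%:R.
Proof.
move=> M0 a0 ab e0 be1; have [sg [v [sg1 v01 hv]]] := sine_fun_reduce u.
have -> : trapezoid_sum M a b e u = sg * trapezoid_sum M a b e v.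
  rewrite /trapezoid_sum big_distrr/=; apply: eq_bigr => m _.
  by rewrite hv; ring.
rewrite normrM sg1 mul1r.
have := trapezoid_sum_approx M0 v01 a0 ab e0 be1.
have /andP[] := @trapezoid_itv a b e v e0 ab.
by rewrite !ler_norml => ? ? /andP[? ?]; apply/andP; split; lra.
Qed.

End sine_periodicity.

Section step_approximation.
Context {R : realType}.
Implicit Types a b x : R.

(* The line is mapped to the unit interval by x |-> 1/2 + x/(2n), so the sums
   have period 4n and a trapezoid of slope width 1/n converges to the indicator
   of ]a, b]. The number of terms makes the Mercer error, once rescaled by
   2 n^2, equal to 1/n. *)
Definition step_approx a b (n : nat) x : R :=
  2 * n%:R ^+ 2 * trapezoid_sum (128 * n ^ 3) (1 / 2 + a / (2 * n%:R))
    (1 / 2 + b / (2 * n%:R)) (2 * n%:R ^+ 2)^-1 (1 / 2 + x / (2 * n%:R)).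

Section bounds.
Variables (a b : R) (n : nat).
Hypotheses (ab : a <= b) (n0 : (0 < n)%N) (an : - n%:R <= a) (bn : b + 1 <= n%:R).

Let nR : 0 < n%:R :> R. Proof. by rewrite ltr0n. Qed.
Let M0 : (0 < 128 * n ^ 3)%N. Proof. by rewrite muln_gt0 expn_gt0 n0. Qed.
Let c0 : 0 < 2 * n%:R ^+ 2 :> R. Proof. by rewrite mulr_gt0// exprn_gt0. Qed.

Let scale_le x y : (1 / 2 + x / (2 * n%:R) <= 1 / 2 + y / (2 * n%:R)) = (x <= y).
Proof. by rewrite lerD2l ler_pM2r// invr_gt0 mulr_gt0. Qed.

Let scaleD x : 1 / 2 + x / (2 * n%:R) + (2 * n%:R ^+ 2)^-1 =
  1 / 2 + (x + n%:R^-1) / (2 * n%:R).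
Proof. by field; rewrite gt_eqF. Qed.

Let scale0 : 1 / 2 + - n%:R / (2 * n%:R) = 0 :> R.
Proof. by field; rewrite gt_eqF. Qed.

Let scale1 : 1 / 2 + n%:R / (2 * n%:R) = 1 :> R.
Proof. by field; rewrite gt_eqF. Qed.

Let e0 : 0 <= (2 * n%:R ^+ 2)^-1 :> R. Proof. by rewrite invr_ge0 ltW. Qed.
Let a0 : 0 <= 1 / 2 + a / (2 * n%:R). Proof. by rewrite -scale0 scale_le. Qed.
Let ab' : 1 / 2 + a / (2 * n%:R) <= 1 / 2 + b / (2 * n%:R).
Proof. by rewrite scale_le. Qed.
Let be1 : 1 / 2 + b / (2 * n%:R) + (2 * n%:R ^+ 2)^-1 <= 1.
Proof.
apply: (@le_trans _ _ (1 / 2 + n%:R / (2 * n%:R))); last by rewrite scale1.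
rewrite scaleD scale_le; apply: le_trans bn; rewrite lerD2l.
by rewrite invf_le1// ler1n.
Qed.

Let cM : 2 * n%:R ^+ 2 * (64 / (128 * n ^ 3)%:R) = n%:R^-1 :> R.
Proof. by rewrite natrM natrX; field; rewrite gt_eqF. Qed.

Lemma step_approx_bound x : `|step_approx a b n x| <= 2.
Proof.
rewrite /step_approx normrM (gtr0_norm c0).
apply: (@le_trans _ _ (2 * n%:R ^+ 2 * ((2 * n%:R ^+ 2)^-1 + 64 / (128 * n ^ 3)%:R))).
  by rewrite ler_pM2l//; exact: trapezoid_sum_bound.
rewrite mulrDr mulfV ?gt_eqF// cM.
by rewrite -[leRHS](natrD _ 1 1) natrD lerD2l invf_le1// ler1n.
Qed.

Lemma step_approx_close x (y : R) : - n%:R <= x -> x <= n%:R ->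
  2 * n%:R ^+ 2 * trapezoid (1 / 2 + a / (2 * n%:R))
    (1 / 2 + b / (2 * n%:R)) (2 * n%:R ^+ 2)^-1 (1 / 2 + x / (2 * n%:R)) = y ->
  `|step_approx a b n x - y| <= n%:R^-1.
Proof.
move=> x1 x2 <-; rewrite /step_approx -mulrBr normrM (gtr0_norm c0) -cM.
rewrite ler_pM2l//; apply: trapezoid_sum_approx => //.
by apply/andP; split; [rewrite -[leLHS]scale0 scale_le|rewrite -[leRHS]scale1 scale_le].
Qed.

Lemma step_approx_out x : - n%:R <= x -> x <= n%:R ->
  x <= a \/ b + n%:R^-1 <= x -> `|step_approx a b n x| <= n%:R^-1.
Proof.
move=> x1 x2 h; rewrite -[X in `|X|]subr0; apply: step_approx_close => //.
rewrite trapezoid_out ?mulr0// scaleD !scale_le.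
by case: h => ?; [left|right].
Qed.

Lemma step_approx_in x : - n%:R <= x -> x <= n%:R ->
  a + n%:R^-1 <= x <= b -> `|step_approx a b n x - 1| <= n%:R^-1.
Proof.
move=> x1 x2 /andP[h1 h2]; apply: step_approx_close => //.
by rewrite trapezoid_in ?mulfV ?gt_eqF// scaleD !scale_le h1.
Qed.

End bounds.

(** For large n the slopes, of width 1/n and starting at a and at b, end before any given x > a or x
    > b. Both slopes start on their left, so x = a is outside and x = b inside: hence the half-open
    interval. *)
Lemma cvg_step_approx a b x : a <= b ->
  step_approx a b n x @[n --> \oo] --> (\1_(`]a, b]%classic) x : R).
Proof.
move=> ab; apply/subr_cvg0/cvgr0Pnorm_le => /= e e0.
have inv_near (r : R) : 0 < r -> \forall n \near \oo, n%:R^-1 <= r.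
  move=> r0; near=> n; have n0 : 0 < n%:R :> R.
    by rewrite ltr0n; near: n; exact: nbhs_infty_gt.
  rewrite -[leRHS]invrK lef_pV2 ?posrE ?invr_gt0//.
  by near: n; exact: nbhs_infty_ger.
have inv_near' (r : R) : 0 < r -> (\forall n \near \oo, n%:R^-1 <= r) by exact: inv_near.
have far (r : R) : \forall n \near \oo, r <= n%:R by exact: nbhs_infty_ger.
have pos : \forall n \near \oo, (0 < n)%N by exact: nbhs_infty_gt.
have ne := inv_near e e0.
have fa := far (- a); have fb := far (b + 1); have fx := far x; have fnx := far (- x).
rewrite indicE; have [xa|ax] := leP x a.
  rewrite memNset/=; last by rewrite in_itv/= ltNge xa.
  near=> n; rewrite subr0; apply: (@le_trans _ _ n%:R^-1); last by near: n.
  apply: step_approx_out => //.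
  - by near: n.
  - by rewrite lerNl; near: n.
  - by near: n.
  - by rewrite lerNl; near: n.
  - by near: n.
  - by left.
have [xb|bx] := leP x b.
  rewrite mem_set/=; last by rewrite in_itv/= ax.
  have nxa := inv_near (x - a).
  rewrite subr_gt0 in nxa; move/(_ ax) in nxa.
  near=> n; apply: (@le_trans _ _ n%:R^-1); last by near: n.
  apply: step_approx_in => //.
  - by near: n.
  - by rewrite lerNl; near: n.
  - by near: n.
  - by rewrite lerNl; near: n.
  - by near: n.
  - by rewrite xb andbT addrC -lerBrDr; near: n.
rewrite memNset/=; last by rewrite in_itv/= ax/= leNgt bx.
have nxb := inv_near (x - b).
rewrite subr_gt0 in nxb; move/(_ bx) in nxb.
near=> n; rewrite subr0; apply: (@le_trans _ _ n%:R^-1); last by near: n.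
apply: step_approx_out => //.
- by near: n.
- by rewrite lerNl; near: n.
- by near: n.
- by rewrite lerNl; near: n.
- by near: n.
- by right; rewrite addrC -lerBrDr; near: n.
Unshelve. all: by end_near. Qed.

(** A sine is a cosine of phase - pi / 2, so equality of shifted cosine transforms applies to each
    term. *)
Lemma step_approx_cos a b n : exists s : seq (R * R * R), forall x,
  step_approx a b n x = \sum_(i <- s) i.1.1 * cos (i.1.2 * x + i.2).
Proof.
exists [seq (2 * n%:R ^+ 2 * bridge_eig m * Num.sqrt 2 *
    trapezoid_coef (1 / 2 + a / (2 * n%:R)) (1 / 2 + b / (2 * n%:R))
      (2 * n%:R ^+ 2)^-1 m,
    m%:R * pi / (2 * n%:R), m%:R * pi / 2 - pi / 2) | m <- index_iota 1 (128 * n ^ 3).+1] => x.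
rewrite big_map/= /step_approx /trapezoid_sum big_distrr/=; apply: eq_bigr => m _.
rewrite /sine_fun addrA cosBpihalf.
have -> : m%:R * pi * (1 / 2 + x / (2 * n%:R)) =
  m%:R * pi / (2 * n%:R) * x + m%:R * pi / 2 by rewrite mulrDr; ring.
by ring.
Qed.

End step_approximation.

Section cos_transform.
Context {R : realType}.

Section one_measure.
Context d (T : measurableType d) (mu : {measure set T -> \bar R}).
Variables (Z W : T -> R).
Hypotheses (mZ : measurable_fun setT Z) (iW : mu.-integrable setT (EFin \o W)).

Lemma integrable_weight (f : R -> R) (C : R) : measurable_fun setT f ->
  (forall x, `|f x| <= C) ->
  mu.-integrable setT (EFin \o (fun w => W w * f (Z w))).
Proof.
move=> mf fC; have iCW := integrableZl measurableT C iW.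
apply: le_integrable iCW => //.
  apply/measurable_EFinP/measurable_funM; last exact: measurableT_comp.
  by apply/measurable_EFinP; exact: measurable_int iW.
move=> w _ /=; rewrite lee_fin !normrM mulrC ler_wpM2r//.
exact: le_trans (ler_norm _).
Qed.

Lemma cvg_Rintegral_weight (f_ : nat -> R -> R) (f : R -> R) (C : R) :
  (forall n, measurable_fun setT (f_ n)) -> (forall n x, `|f_ n x| <= C) ->
  measurable_fun setT f -> (forall x, f_ n x @[n --> \oo] --> f x) ->
  \int[mu]_w (W w * f_ n (Z w)) @[n --> \oo] --> \int[mu]_w (W w * f (Z w)).
Proof.
move=> mf_ fC mf ff.
have fC' x : `|f x| <= C.
  have /cvg_norm nf := ff x.
  apply: (@ler_cvg_to nat \oo _ R (fun n => `|f_ n x|) (fun=> C) _ _ nf).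
    exact: cvg_cst.
  exact: nearW.
have iWf := integrable_weight mf fC'.
apply: fine_cvg; rewrite fineK; last exact: integrable_fin_num.
have iCW := integrableZl measurableT C iW.
apply: (@dominated_cvg _ _ _ mu setT _ _ _ (fun w => `|C%:E * (W w)%:E|%E)) => //.
- move=> n; exact: measurable_int (integrable_weight (mf_ n) (fC n)).
- move=> w _; apply: cvg_EFin; first exact: nearW.
  by apply: cvgMl_tmp; exact: ff.
- exact: integrable_abse.
- move=> n w _ /=; rewrite lee_fin !normrM mulrC ler_wpM2r//.
  exact: le_trans (ler_norm _).
Qed.

End one_measure.

Section two_measures.
Context d1 (T1 : measurableType d1) (mu1 : {measure set T1 -> \bar R}).
Context d2 (T2 : measurableType d2) (mu2 : {measure set T2 -> \bar R}).
Variables (Z1 W1 : T1 -> R) (Z2 W2 : T2 -> R).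
Hypotheses (mZ1 : measurable_fun setT Z1) (iW1 : mu1.-integrable setT (EFin \o W1)).
Hypotheses (mZ2 : measurable_fun setT Z2) (iW2 : mu2.-integrable setT (EFin \o W2)).
Hypothesis cosE : forall a c, \int[mu1]_w (W1 w * cos (a * Z1 w + c)) =
  \int[mu2]_w (W2 w * cos (a * Z2 w + c)).

(** The test functions that do not separate the two signed image measures. The class is closed under
    bounded pointwise limits and finite linear combinations, which carries it from cosines to
    indicators of intervals. *)
Let same (f : R -> R) :=
  \int[mu1]_w (W1 w * f (Z1 w)) = \int[mu2]_w (W2 w * f (Z2 w)).

Let same_cvg (f_ : nat -> R -> R) (f : R -> R) (C : R) :
  (forall n, measurable_fun setT (f_ n)) -> (forall n x, `|f_ n x| <= C) ->
  measurable_fun setT f -> (forall x, f_ n x @[n --> \oo] --> f x) ->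
  (forall n, same (f_ n)) -> same f.
Proof.
move=> mf_ fC mf ff sf.
have h1 := cvg_Rintegral_weight mZ1 iW1 mf_ fC mf ff.
have h2 := cvg_Rintegral_weight mZ2 iW2 mf_ fC mf ff.
have E : (fun n => \int[mu1]_w (W1 w * f_ n (Z1 w))) =
    (fun n => \int[mu2]_w (W2 w * f_ n (Z2 w))) by apply/funext => n; exact: sf.
by rewrite E in h1; exact: (cvg_unique _ h1 h2).
Qed.

Let same_sum I (r : seq I) (k : I -> R) (f : I -> R -> R) (C : I -> R) :
  (forall i, measurable_fun setT (f i)) -> (forall i x, `|f i x| <= C i) ->
  (forall i, same (f i)) -> same (fun x => \sum_(i <- r) k i * f i x).
Proof.
move=> mf fC sf; rewrite /same.
have E (T : Type) (W Z : T -> R) w : W w * \sum_(i <- r) k i * f i (Z w) =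
    \sum_(i <- r) k i * (W w * f i (Z w)).
  by rewrite big_distrr/=; apply: eq_bigr => i _; rewrite mulrCA.
have i1 i := integrable_weight mZ1 iW1 (mf i) (fC i).
have i2 i := integrable_weight mZ2 iW2 (mf i) (fC i).
under eq_Rintegral do rewrite E; under [RHS]eq_Rintegral do rewrite E.
rewrite !Rintegral_sum//.
- by apply: eq_bigr => i _; rewrite !RintegralZl// sf.
- by move=> i _; have := integrableZl measurableT (k i) (i2 i).
- by move=> i _; have := integrableZl measurableT (k i) (i1 i).
Qed.

Let measurable_cos_affine (a c : R) : measurable_fun setT (fun x : R => cos (a * x + c)).
Proof.
apply: continuous_measurable_fun => x.
apply: (@continuous_cvg _ _ _ _ _ (fun x => a * x + c) (@cos R)).
  exact: continuous_cos.
by apply: cvgD; [apply: cvgMl_tmp; exact: cvg_id|exact: cvg_cst].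
Qed.

Let measurable_step_approx a b n : measurable_fun setT (@step_approx R a b n).
Proof.
have [s sE] := step_approx_cos a b n.
rewrite (_ : step_approx a b n = fun x => \sum_(i <- s) i.1.1 * cos (i.1.2 * x + i.2)).
  by apply: measurable_sum => i; exact: measurable_funM.
exact/funext.
Qed.

Let same_ocitv a b : a <= b -> same (\1_(`]a, b]%classic)).
Proof.
move=> ab.
(* From rank N on, [a, b + 1] lies in the window [-n, n], where [step_approx_bound] applies. *)
pose N := maxn 1 (maxn (Num.truncn `|a|).+1 (Num.truncn `|b + 1|).+1).
have trN (x : R) n : (Num.truncn `|x| < n)%N -> x <= n%:R /\ - n%:R <= x.
  move=> xn; have /truncn_itv/andP[_ h] := normr_ge0 x.
  have : `|x| <= n%:R by apply: (le_trans (ltW h)); rewrite ler_nat.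
  by rewrite ler_norml => /andP[].
have Nn n : [/\ (0 < n + N)%N, - (n + N)%:R <= a & b + 1 <= (n + N)%:R].
  split; first by rewrite addn_gt0 /N !leq_max ltnSn orbT.
  - by apply: (trN a _ _).2; rewrite (leq_trans _ (leq_addl _ _))// /N !leq_max ltnSn !orbT.
  - by apply: (trN _ _ _).1; rewrite (leq_trans _ (leq_addl _ _))// /N !leq_max ltnSn !orbT.
apply: (@same_cvg (fun n => step_approx a b (n + N)) _ 2) => //.
- by move=> n x; have [h1 h2 h3] := Nn n; exact: step_approx_bound.
- by move=> x; rewrite (cvg_shiftn N (fun n => step_approx a b n x)); exact: cvg_step_approx.
- move=> n; have [s sE] := step_approx_cos a b (n + N).
  rewrite (_ : step_approx _ _ _ = fun x => \sum_(i <- s) i.1.1 * cos (i.1.2 * x + i.2)).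
    apply: (@same_sum _ s (fun i => i.1.1) (fun i x => cos (i.1.2 * x + i.2)) (fun=> 1)) => //.
    + by move=> i x; exact: cos_max.
    + by move=> i; exact: cosE.
  exact/funext.
Qed.

(* Levy uniqueness for the images of W1 mu1 under Z1 and of W2 mu2 under Z2. *)
Lemma cos_transform_unique (B : set R) : measurable B ->
  \int[mu1]_(w in Z1 @^-1` B) W1 w = \int[mu2]_(w in Z2 @^-1` B) W2 w.
Proof.
move=> mB.
suff h : same \1_B.
  rewrite Rintegral_mkcond [RHS]Rintegral_mkcond.
  have E (T : Type) (W Z : T -> R) : W \_ (Z @^-1` B) = (fun w => W w * \1_B (Z w)).
    apply/funext => w; rewrite patchE indicE; case: ifPn => hw.
      by rewrite mem_set ?mulr1//; move: hw; rewrite inE.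
    by rewrite memNset ?mulr0//; move: hw; rewrite notin_setE.
  by under eq_Rintegral do rewrite E; under [RHS]eq_Rintegral do rewrite E.
have bnd (A : set R) x : `|\1_A x : R| <= 1.
  by rewrite indicE; case: (_ \in _); rewrite ?normr1 ?normr0.
(* Equal total masses, from the constant cosine a = c = 0; complements need them. *)
have sT : same \1_setT.
  have := cosE 0 0; rewrite /same.
  under eq_Rintegral do rewrite mul0r addr0 cos0.
  under [RHS]eq_Rintegral do rewrite mul0r addr0 cos0.
  under [in X in _ -> X]eq_Rintegral do rewrite indicT.
  by under [in X in _ -> _ = X]eq_Rintegral do rewrite indicT.
apply: (@dynkin_induction _ (measurableTypeR R) (@ocitv R) (fun B => same \1_B)) => //.
- exact: ocitvI.
- move=> _ [[a b] _ <-] /=; have [ab|/ltW ba] := leP a b; first exact: same_ocitv.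
  rewrite set_itv_ge ?bnd_simp -?leNgt// /same indic0.
  by under eq_Rintegral do rewrite mulr0; under [RHS]eq_Rintegral do rewrite mulr0;
    rewrite !Rintegral_cst// !mul0r.
- move=> A mA sA.
  rewrite (_ : \1_(~` A) = fun x : R => \sum_(i <- [:: true; false])
      (if i then 1 else -1) * \1_(if i then setT else A) x).
    apply: (@same_sum _ _ (fun i => if i then 1 else -1) (fun i => \1_(if i then setT else A))
      (fun=> 1)) => //; last by case.
    by case => //; exact: measurable_indic.
  apply/funext => x; rewrite !big_cons big_nil/= addr0 mul1r mulN1r.
  by rewrite !indicE in_setT in_setC; case: (_ \in _); rewrite ?subrr ?subr0.
- move=> F mF tF sF.
  (* By disjointness the partial sums at x jump once from 0 to 1, at the index of the set containing
     x, or stay 0. They are therefore bounded by 1 and eventually constant. *)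
  have key (x : R) : (exists2 j, (forall n, \sum_(i <- index_iota 0 n) 1 * \1_(F i) x =
      (j < n)%N%:R :> R) & \1_(\bigcup_k F k) x = 1 :> R) \/
      ((forall n, \sum_(i <- index_iota 0 n) 1 * \1_(F i) x = 0 :> R) /\
        \1_(\bigcup_k F k) x = 0 :> R).
    have [[j _ Fj]|nF] := pselect ((\bigcup_k F k) x); [left; exists j|right; split].
    + move=> n; rewrite (eq_bigr (fun i => (i == j)%:R)).
        have [jn|nj] := ltnP j n.
          rewrite (bigD1_seq j) ?mem_index_iota ?iota_uniq//= eqxx big1 ?addr0//.
          by move=> i /negbTE ->.
        rewrite big_nat big1// => i /andP[_ ilt].
        by rewrite ltn_eqF// (leq_trans ilt).
      move=> i _; rewrite mul1r indicE; congr (_%:R); apply: congr1.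
      have [->|ij] := eqVneq i j; first by rewrite mem_set.
      apply/memNset => Fi; move/trivIsetP : tF => /(_ i j I I ij)/seteqP[+ _].
      by move=> /(_ x); apply.
    + by rewrite indicE mem_set//; exists j.
    + move=> n; rewrite big1// => i _; rewrite indicE memNset ?mulr0//.
      by move=> Fi; apply: nF; exists i.
    + by rewrite indicE memNset.
  apply: (@same_cvg (fun n x => \sum_(i <- index_iota 0 n) 1 * \1_(F i) x) _ 1) => //.
  + move=> n; apply: measurable_sum => i; apply: measurable_funM => //.
    by apply: measurable_indic; exact: mF.
  + move=> n x; have [[j -> _]|[-> _]] := key x; last by rewrite normr0.
    by case: (_ < _)%N; rewrite ?normr1 ?normr0.
  + by apply: measurable_indic; apply: bigcup_measurable => k _; exact: mF.
  + move=> x; have [[j h1 h2]|[h1 h2]] := key x.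
      rewrite h2; apply: cvg_near_cst; near=> n; rewrite h1.
      by have -> // : (j < n)%N; near: n; exact: nbhs_infty_gt.
    by rewrite h2; apply: cvg_near_cst; apply: nearW => n; exact: h1.
  + move=> n; apply: (@same_sum _ _ (fun=> 1) (fun i => \1_(F i)) (fun=> 1)) => // i.
    by apply: measurable_indic; exact: mF.
Unshelve. all: by end_near. Qed.

End two_measures.

End cos_transform.

(** * Independence and standard laws from joint cosine transforms *)

Section gaussian_independence.
Context {R : realType} d (Omega : measurableType d) (P : probability Omega R).
Context (I : choiceType) (Z : I -> {RV P >-> R}).
Hypothesis cosZ : forall (r : seq I) (a : I -> R) (c : R), uniq r ->
  \int[P]_w cos (\sum_(i <- r) a i * Z i w + c) =
  expR (- ((\sum_(i <- r) a i ^+ 2) / 2)) * cos c.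

Let measurable_lin (r : seq I) (a : I -> R) c :
  measurable_fun setT (fun w => cos (\sum_(i <- r) a i * Z i w + c)).
Proof.
apply: (measurableT_comp (f := @cos R)).
  by apply: continuous_measurable_fun; exact: continuous_cos.
apply: measurable_funD => //; apply: measurable_sum => i.
by apply: measurable_funM => //; exact: measurable_funP.
Qed.

Let cos1 (i : I) (a c : R) :
  \int[P]_w cos (a * Z i w + c) = expR (- (a ^+ 2 / 2)) * cos c.
Proof.
have := @cosZ [:: i] (fun=> a) c isT.
by under eq_Rintegral do rewrite big_seq1; rewrite big_seq1.
Qed.

Lemma integrable_bounded1 (f : Omega -> R) (C : R) : measurable_fun setT f ->
  (forall w, `|f w| <= C) -> P.-integrable setT (EFin \o f).
Proof.
move=> mf fC; have i1 := finite_measure_integrable_cst P C measurableT.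
apply: le_integrable i1 => //; first exact/measurable_EFinP.
by move=> w _ /=; rewrite lee_fin; apply: le_trans (ler_norm _).
Qed.

Variable B : I -> set R.
Hypothesis mB : forall i, measurable (B i).

Let A (s : seq I) : set Omega := [set w | forall i, i \in s -> B i (Z i w)].

Let mZB i : measurable (Z i @^-1` B i).
Proof. by rewrite -[X in measurable X]setTI; apply: measurable_funP => //; exact: mB. Qed.

Let A_cons i s : A (i :: s) = A s `&` Z i @^-1` B i.
Proof.
apply/seteqP; split => w /=.
  by move=> h; split; [move=> j js; apply: h; rewrite inE js orbT|apply: h; rewrite inE eqxx].
by move=> [h hi] j; rewrite inE => /predU1P[->//|]; exact: h.
Qed.

Let A_nil : A [::] = setT.
Proof. by apply/seteqP; split => w. Qed.

Let mA s : measurable (A s).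
Proof.
elim: s => [|i s IH]; first by rewrite A_nil; exact: measurableT.
by rewrite A_cons; exact: measurableI.
Qed.

Let prodP s := \prod_(i <- s) fine (P (Z i @^-1` B i)).

(** The variables of s have already been turned into events, those of r are still inside the cosine.
    To convert one more variable [Z i], its image under the random weight [W1] is compared with its
    image under the constant weight [K]; quantifying over r, a and c makes the induction hypothesis
    available for [i :: r]. *)
Let cos_indep s : forall (r : seq I) (a : I -> R) c, uniq (s ++ r) ->
  \int[P]_(w in A s) cos (\sum_(i <- r) a i * Z i w + c) =
  prodP s * (expR (- ((\sum_(i <- r) a i ^+ 2) / 2)) * cos c).
Proof.
elim: s => [r a c ur|i s IH r a c].
  by rewrite A_nil /prodP big_nil mul1r; exact: cosZ.
rewrite cat_cons cons_uniq mem_cat negb_or => /andP[/andP[is_ ir] ur].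
have usir : uniq (s ++ i :: r).
  by rewrite uniq_catC cat_cons cons_uniq mem_cat negb_or ir is_ uniq_catC.
pose W1 w := \1_(A s) w * cos (\sum_(j <- r) a j * Z j w + c).
pose K := prodP s * (expR (- ((\sum_(j <- r) a j ^+ 2) / 2)) * cos c).
have mI : measurable_fun setT (\1_(A s) : Omega -> R) by exact: measurable_indic.
have I1 w : `|\1_(A s) w : R| <= 1.
  by rewrite indicE; case: (_ \in _); rewrite ?normr1 ?normr0.
have iW (r' : seq I) (a' : I -> R) c' : P.-integrable setT
    (EFin \o (fun w => \1_(A s) w * cos (\sum_(j <- r') a' j * Z j w + c'))).
  apply: (@integrable_bounded1 _ 1); first exact: measurable_funM.
  by move=> w; rewrite normrM mulr_ile1// ?cos_max.
have AE (r' : seq I) (a' : I -> R) c' :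
    \int[P]_(w in A s) cos (\sum_(j <- r') a' j * Z j w + c') =
    \int[P]_w (\1_(A s) w * cos (\sum_(j <- r') a' j * Z j w + c')).
  rewrite Rintegral_mkcond; apply: eq_Rintegral => w _.
  by rewrite patchE indicE; case: (_ \in _); rewrite ?mul1r ?mul0r.
have key := @cos_transform_unique R _ Omega P _ Omega P (Z i) W1 (Z i) (fun=> K)
  (measurable_funP (Z i)) (iW r a c) (measurable_funP (Z i))
  (finite_measure_integrable_cst P K measurableT).
have -> : \int[P]_(w in A (i :: s)) cos (\sum_(j <- r) a j * Z j w + c) =
    \int[P]_(w in Z i @^-1` B i) W1 w.
  rewrite Rintegral_mkcond [RHS]Rintegral_mkcond; apply: eq_Rintegral => w _.
  rewrite !patchE A_cons in_setI /W1 indicE.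
  by case: (_ \in A s); case: (_ \in _); rewrite ?mul1r ?mul0r.
rewrite key//; last first.
  (* The product of two cosines is half the sum of the cosines of sum and difference. With e = 1 and
     e = -1, [a' e] lists the coefficients of these two, with b attached to [Z i]. *)
  move=> b c'; pose a' e j := if j == i then b else e * a j.
  have a'r e : \sum_(j <- r) a' e j ^+ 2 = e ^+ 2 * \sum_(j <- r) a j ^+ 2.
    rewrite big_distrr/= !big_seq; apply: eq_bigr => j jr.
    by rewrite /a' (negbTE (memPn ir _ jr)) exprMn.
  have a'Z e w : \sum_(j <- r) a' e j * Z j w = e * \sum_(j <- r) a j * Z j w.
    rewrite big_distrr/= !big_seq; apply: eq_bigr => j jr.
    by rewrite /a' (negbTE (memPn ir _ jr)) mulrA.
  have W1E w : W1 w * cos (b * Z i w + c') = 2^-1 * (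
      \1_(A s) w * cos (\sum_(j <- i :: r) a' 1 j * Z j w + (c' + c)) +
      \1_(A s) w * cos (\sum_(j <- i :: r) a' (-1) j * Z j w + (c' - c))).
    rewrite /W1 !big_cons !a'Z /a' eqxx mul1r mulN1r.
    set y := \sum_(j <- r) _; set z := b * Z i w.
    have -> : z + y + (c' + c) = (z + c') + (y + c) by ring.
    have -> : z - y + (c' - c) = (z + c') - (y + c) by ring.
    by move: (z + c') (y + c) => u v; rewrite cosD cosB; field.
  under eq_Rintegral do rewrite W1E.
  have iD := integrableD measurableT (iW (i :: r) (a' 1) (c' + c)) (iW (i :: r) (a' (-1)) (c' - c)).
  transitivity (2^-1 * (
      \int[P]_w (\1_(A s) w * cos (\sum_(j <- i :: r) a' 1 j * Z j w + (c' + c))) +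
      \int[P]_w (\1_(A s) w * cos (\sum_(j <- i :: r) a' (-1) j * Z j w + (c' - c))))).
    rewrite -(RintegralD measurableT (iW _ _ _) (iW _ _ _)).
    by rewrite -RintegralZl.
  rewrite -!AE !IH// RintegralZl//; last first.
    apply: (@integrable_bounded1 _ 1); last by move=> w; exact: cos_max.
    have := @measurable_lin [:: i] (fun=> b) c'.
    by apply: eq_measurable_fun => w _; rewrite big_seq1.
  rewrite cos1 /K !big_cons !a'r /a' eqxx expr1n sqrrN expr1n mul1r cosD cosB.
  rewrite [(b ^+ 2 + _) / 2]mulrDl opprD expRD; field.
  by [].
rewrite Rintegral_cst// /K /prodP big_cons; ring.
Qed.

Lemma independent_preimages (s : seq I) : uniq s ->
  fine (P (A s)) = \prod_(i <- s) fine (P (Z i @^-1` B i)).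
Proof.
move=> us; have := @cos_indep s [::] (fun=> 0) 0; rewrite cats0 => /(_ us).
under eq_Rintegral do rewrite big_nil addr0 cos0.
by rewrite Rintegral_cst// mul1r big_nil mul0r oppr0 expR0 cos0 !mulr1.
Qed.

End gaussian_independence.

Section iid.
Context {R : realType} d (Omega : measurableType d) (P : probability Omega R).
Context (I : choiceType) (Z : I -> {RV P >-> R}).

Lemma cos_iid_standard_gaussian :
  (forall (r : seq I) (a : I -> R) (c : R), uniq r ->
    \int[P]_w cos (\sum_(i <- r) a i * Z i w + c) =
    expR (- ((\sum_(i <- r) a i ^+ 2) / 2)) * cos c) ->
  iid_standard_gaussian P (fun i => Z i : Omega -> R).
Proof.
move=> cosZ.
have mZB i (B : set R) : measurable B -> measurable (Z i @^-1` B).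
  by move=> mB; rewrite -[X in measurable X]setTI; exact: measurable_funP.
split=> [F B mB|i B mB].
  have := @independent_preimages R d Omega P I Z cosZ B mB F (fset_uniq F).
  have -> : [set w | forall i, i \in enum_fset F -> B i (Z i w)] =
      \bigcap_(i in [set i | i \in F]) (Z i @^-1` B i).
    by apply/seteqP; split => w h i /=; exact: h.
  set E := \bigcap_(i in _) _ => PE.
  have mE : measurable E.
    apply: fin_bigcap_measurable; first exact: finite_fset.
    by move=> i _; exact: mZB.
  rewrite -(fineK (fin_num_measure P _ mE)) PE.
  rewrite -prodEFin; apply: eq_bigr => i _.
  by rewrite fineK// fin_num_measure//; exact: mZB.
have one : \int[P]_(w in Z i @^-1` B) 1 =
    \int[normal_prob 0 1]_(x in (id : measurableTypeR R -> R) @^-1` B) 1.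
  apply: (@cos_transform_unique R _ Omega P _ (measurableTypeR R) (normal_prob (0 : R) 1)
    (Z i) (fun=> 1) id (fun=> 1)) => //.
  - exact: finite_measure_integrable_cst.
  - exact: finite_measure_integrable_cst.
  move=> a c; under eq_Rintegral do rewrite mul1r.
  under [RHS]eq_Rintegral do rewrite mul1r.
  rewrite Rintegral_normal_prob_cos; have := cosZ [:: i] (fun=> a) c isT.
  by under eq_Rintegral do rewrite big_seq1; rewrite big_seq1.
have mB' : measurable (B : set (measurableTypeR R)) by exact: mB.
move: one; rewrite Rintegral_cst; last exact: mZB.
rewrite preimage_id Rintegral_cst// !mul1r => one.
rewrite -(fineK (fin_num_measure P _ (mZB i B mB))) one fineK//.
exact: (fin_num_measure (normal_prob (0 : R) 1)).
Qed.

End iid.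

(** * Square-integrable random variables *)

Section square_integrable.
Context {R : realType} d (Omega : measurableType d) (P : probability Omega R).
Implicit Types (X Y Z : Omega -> R) (k : R).

Definition sqint X :=
  measurable_fun setT X /\ P.-integrable setT (EFin \o (fun w => X w ^+ 2)).

Definition ip X Y : R := \int[P]_w (X w * Y w).

Lemma sqintM X Y : sqint X -> sqint Y ->
  P.-integrable setT (EFin \o (fun w => X w * Y w)).
Proof.
move=> [mX iX] [mY iY]; have := integrableD measurableT iX iY.
apply: le_integrable => //; first by apply/measurable_EFinP; exact: measurable_funM.
move=> w _ /=; rewrite lee_fin; apply: le_trans (ler_norm _).
by rewrite ler_norml; apply/andP; split; nra.
Qed.

Lemma sqint_cst k : sqint (fun=> k).
Proof. by split => //; exact: finite_measure_integrable_cst. Qed.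

Lemma sqintD X Y : sqint X -> sqint Y -> sqint (fun w => X w + Y w).
Proof.
move=> hX hY; have [mX iX] := hX; have [mY iY] := hY.
split; first exact: measurable_funD.
have iXY := sqintM hX hY.
have := integrableD measurableT (integrableD measurableT iX iY)
  (integrableZl measurableT 2 iXY).
apply: le_integrable => //.
  by apply/measurable_EFinP; apply: measurable_funX; exact: measurable_funD.
move=> w _ /=; rewrite lee_fin; apply: le_trans (ler_norm _) => /=.
by rewrite ger0_norm ?sqr_ge0//; nra.
Qed.

Lemma sqintZ k X : sqint X -> sqint (fun w => k * X w).
Proof.
move=> [mX iX]; split; first exact: measurable_funM.
have := integrableZl measurableT (k ^+ 2) iX.
apply: le_integrable => //.
  by apply/measurable_EFinP; apply: measurable_funX; exact: measurable_funM.
by move=> w _ /=; rewrite lee_fin exprMn.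
Qed.

Lemma sqintB X Y : sqint X -> sqint Y -> sqint (fun w => X w - Y w).
Proof.
move=> hX /(sqintZ (-1)) hY; have := sqintD hX hY.
by under eq_fun do rewrite mulN1r.
Qed.

Lemma sqint_sum I (r : seq I) (Q : pred I) (X : I -> Omega -> R) :
  (forall i, Q i -> sqint (X i)) -> sqint (fun w => \sum_(i <- r | Q i) X i w).
Proof.
move=> hX; elim: r => [|i r IH].
  by under eq_fun do rewrite big_nil; exact: sqint_cst.
have [Qi|nQi] := boolP (Q i).
  by under eq_fun do rewrite big_cons Qi; apply: sqintD => //; exact: hX.
by under eq_fun do rewrite big_cons (negbTE nQi).
Qed.

Lemma sqint_integrable X : sqint X -> P.-integrable setT (EFin \o X).
Proof.
move=> hX; have := sqintM hX (sqint_cst 1).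
by under eq_fun do rewrite mulr1.
Qed.

Lemma sqint_norm X : sqint X -> sqint (fun w => `|X w|).
Proof.
move=> [mX iX]; split; first exact: measurableT_comp.
by under eq_fun do rewrite (real_normK (num_real _)).
Qed.

Lemma ipC X Y : ip X Y = ip Y X.
Proof. by rewrite /ip; apply: eq_Rintegral => w _; rewrite mulrC. Qed.

Lemma ip_ge0 X : 0 <= ip X X.
Proof. by apply: Rintegral_ge0 => w _; rewrite -expr2 sqr_ge0. Qed.

Lemma ipDl X Y Z : sqint X -> sqint Y -> sqint Z ->
  ip (fun w => X w + Y w) Z = ip X Z + ip Y Z.
Proof.
move=> hX hY hZ; rewrite /ip -RintegralD//; [|exact: sqintM..].
by apply: eq_Rintegral => w _; rewrite mulrDl.
Qed.

Lemma ipBl X Y Z : sqint X -> sqint Y -> sqint Z ->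
  ip (fun w => X w - Y w) Z = ip X Z - ip Y Z.
Proof.
move=> hX hY hZ; rewrite /ip -RintegralB//; [|exact: sqintM..].
by apply: eq_Rintegral => w _; rewrite mulrBl.
Qed.

Lemma ipBr X Y Z : sqint X -> sqint Y -> sqint Z ->
  ip Z (fun w => X w - Y w) = ip Z X - ip Z Y.
Proof. by move=> hX hY hZ; rewrite ipC ipBl// (ipC X) (ipC Y). Qed.

Lemma ipZl k X Z : sqint X -> sqint Z -> ip (fun w => k * X w) Z = k * ip X Z.
Proof.
move=> hX hZ; rewrite /ip -RintegralZl//; last exact: sqintM.
by apply: eq_Rintegral => w _; rewrite mulrA.
Qed.

Lemma ip_suml I (r : seq I) (k : I -> R) (X : I -> Omega -> R) Z :
  (forall i, sqint (X i)) -> sqint Z ->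
  ip (fun w => \sum_(i <- r) k i * X i w) Z = \sum_(i <- r) k i * ip (X i) Z.
Proof.
move=> hX hZ; elim: r => [|i r IH].
  rewrite big_nil /ip; under eq_Rintegral do rewrite big_nil mul0r.
  by rewrite Rintegral_cst// mul0r.
have hS : sqint (fun w => \sum_(j <- r) k j * X j w).
  by apply: sqint_sum => j _; exact: sqintZ.
have := ipDl (sqintZ (k i) (hX i)) hS hZ.
rewrite ipZl// IH big_cons => <-.
by rewrite /ip; apply: eq_Rintegral => w _; rewrite big_cons.
Qed.

Lemma ip_sumr I (r : seq I) (k : I -> R) (X : I -> Omega -> R) Z :
  (forall i, sqint (X i)) -> sqint Z ->
  ip Z (fun w => \sum_(i <- r) k i * X i w) = \sum_(i <- r) k i * ip Z (X i).
Proof.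
move=> hX hZ; rewrite ipC ip_suml//.
by apply: eq_bigr => i _; rewrite ipC.
Qed.

Lemma ipBB X Y : sqint X -> sqint Y ->
  ip (fun w => X w - Y w) (fun w => X w - Y w) = ip X X - 2 * ip X Y + ip Y Y.
Proof.
move=> hX hY; have hXY := sqintB hX hY.
rewrite ipBl// (ipC X) (ipC Y) !ipBl// (ipC Y X); ring.
Qed.

Lemma cauchy_schwarz X Y : sqint X -> sqint Y -> ip X Y ^+ 2 <= ip X X * ip Y Y.
Proof.
move=> hX hY.
have H t : 0 <= ip X X - 2 * t * ip X Y + t ^+ 2 * ip Y Y.
  have := ip_ge0 (fun w => X w - t * Y w).
  rewrite ipBB//; last exact: sqintZ.
  rewrite [ip X (fun w => t * Y w)]ipC ipZl// [ip (fun w => t * Y w) _]ipZl//; last exact: sqintZ.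
  rewrite [ip Y (fun w => _ * _)]ipC ipZl// [ip Y X]ipC.
  by move=> h; apply: (le_trans h); rewrite le_eqVlt; apply/orP; left; apply/eqP; ring.
move: (ip X X) (ip X Y) (ip Y Y) (ip_ge0 X) (ip_ge0 Y) H => a b c a0 c0 H.
have [c00|cn0] := eqVneq c 0.
  rewrite c00 mulr0 in H *.
  have [->|b0] := eqVneq b 0; first by rewrite expr0n.
  (* For c = 0 the quadratic is affine in t and takes the value -1 at this point. *)
  have := H ((a + 1) / (2 * b)); rewrite mulr0 addr0.
  have -> : 2 * ((a + 1) / (2 * b)) * b = a + 1 by field.
  by lra.
have cgt0 : 0 < c by rewrite lt_neqAle eq_sym cn0.
have := H (b / c).
have -> : a - 2 * (b / c) * b + (b / c) ^+ 2 * c = (a * c - b ^+ 2) / c by field.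
by rewrite pmulr_lge0 ?invr_gt0// subr_ge0.
Qed.

Lemma Rintegral_abs_le X : sqint X -> (\int[P]_w `|X w|) ^+ 2 <= ip X X.
Proof.
move=> hX; have := cauchy_schwarz (sqint_norm hX) (sqint_cst 1).
have -> : ip (fun=> 1) (fun=> 1) = 1.
  rewrite /ip Rintegral_cst// mulr1 mul1r.
  by rewrite -[fine _]/(fine (P setT)) probability_setT.
rewrite mulr1 {1}/ip; under eq_Rintegral do rewrite mulr1.
suff -> : ip (fun w => `|X w|) (fun w => `|X w|) = ip X X by [].
by rewrite /ip; apply: eq_Rintegral => w _; rewrite -expr2 (real_normK (num_real _)) expr2.
Qed.

Definition l2cvg (Y_ : nat -> Omega -> R) Y :=
  ip (fun w => Y_ n w - Y w) (fun w => Y_ n w - Y w) @[n --> \oo] --> (0 : R).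

Lemma cvg_sqr0 (u : nat -> R) : u n ^+ 2 @[n --> \oo] --> (0 : R) ->
  u n @[n --> \oo] --> (0 : R).
Proof.
move/cvgr0Pnorm_le => h; apply/cvgr0Pnorm_le => /= e e0.
have /h := exprn_gt0 2 e0; apply: filterS => n /=.
by rewrite normrX ler_pXn2r ?nnegrE ?(ltW e0).
Qed.

Lemma cvg_ip0 (X_ Y_ : nat -> Omega -> R) (C : R) :
  (forall n, sqint (X_ n)) -> (forall n, sqint (Y_ n)) ->
  ip (X_ n) (X_ n) @[n --> \oo] --> (0 : R) ->
  ip (Y_ n) (Y_ n) @[n --> \oo] --> C ->
  ip (X_ n) (Y_ n) @[n --> \oo] --> (0 : R).
Proof.
move=> hX hY X0 YC; apply: cvg_sqr0.
apply: (@squeeze_cvgr _ _ _ _ (fun=> 0) (fun n => ip (X_ n) (X_ n) * ip (Y_ n) (Y_ n))).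
- by apply: nearW => n; rewrite sqr_ge0 cauchy_schwarz.
- exact: cvg_cst.
- by rewrite -(mul0r C); exact: cvgM.
Qed.

Lemma l2cvg_ip (X_ Y_ : nat -> Omega -> R) X Y :
  (forall n, sqint (X_ n)) -> (forall n, sqint (Y_ n)) -> sqint X -> sqint Y ->
  l2cvg X_ X -> l2cvg Y_ Y -> ip (X_ n) (Y_ n) @[n --> \oo] --> ip X Y.
Proof.
move=> hX_ hY_ hX hY cX cY.
have hXB n := sqintB (hX_ n) hX; have hYB n := sqintB (hY_ n) hY.
have E n : ip (X_ n) (Y_ n) = ip X Y +
    (ip (fun w => X_ n w - X w) (fun w => Y_ n w - Y w) +
     ip (fun w => X_ n w - X w) Y + ip (fun w => Y_ n w - Y w) X).
  rewrite !ipBl// !ipBr// (ipC (Y_ n) X) (ipC Y X); ring.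
rewrite -[X in _ --> X]addr0; under eq_fun do rewrite E.
apply: cvgD; first exact: cvg_cst.
rewrite -[X in _ --> X]addr0; apply: cvgD; last first.
  by apply: (@cvg_ip0 _ _ (ip X X)) => //; exact: cvg_cst.
rewrite -[X in _ --> X]addr0; apply: cvgD.
  exact: (@cvg_ip0 _ _ 0).
by apply: (@cvg_ip0 _ _ (ip Y Y)) => //; exact: cvg_cst.
Qed.

Lemma l2cvg_cst X : l2cvg (fun=> X) X.
Proof.
rewrite /l2cvg /ip; under eq_fun do under eq_Rintegral do rewrite subrr mul0r.
by rewrite Rintegral_cst// mul0r; exact: cvg_cst.
Qed.

Lemma l2cvg_sum I (r : seq I) (k : I -> R) (Y_ : nat -> I -> Omega -> R) (Y : I -> Omega -> R) :
  (forall n i, sqint (Y_ n i)) -> (forall i, sqint (Y i)) ->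
  (forall i, l2cvg (fun n => Y_ n i) (Y i)) ->
  l2cvg (fun n w => \sum_(i <- r) k i * Y_ n i w) (fun w => \sum_(i <- r) k i * Y i w).
Proof.
move=> hY_ hY cY.
have hB n i := sqintB (hY_ n i) (hY i).
have E n : ip (fun w => \sum_(i <- r) k i * Y_ n i w - \sum_(i <- r) k i * Y i w)
    (fun w => \sum_(i <- r) k i * Y_ n i w - \sum_(i <- r) k i * Y i w) =
    \sum_(i <- r) k i * \sum_(j <- r) k j *
      ip (fun w => Y_ n i w - Y i w) (fun w => Y_ n j w - Y j w).
  have -> : (fun w => \sum_(i <- r) k i * Y_ n i w - \sum_(i <- r) k i * Y i w) =
      (fun w => \sum_(i <- r) k i * (Y_ n i w - Y i w)).
    by apply/funext => w; rewrite -sumrB; apply: eq_bigr => i _; rewrite mulrBr.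
  rewrite ip_suml//; last by apply: sqint_sum => i _; exact: sqintZ.
  by apply: eq_bigr => i _; rewrite ip_sumr.
have C : (\sum_(i <- r) k i * \sum_(j <- r) k j *
    ip (fun w => Y_ n i w - Y i w) (fun w => Y_ n j w - Y j w)) @[n --> \oo] -->
    \sum_(i <- r) k i * \sum_(j <- r) k j * (0 : R).
  apply: cvgr_sum => i _; apply: cvgMl_tmp; apply: cvgr_sum => j _.
  by apply: cvgMl_tmp; apply: (@cvg_ip0 _ _ 0) => //; exact: cY.
have S0 : \sum_(i <- r) k i * \sum_(j <- r) k j * (0 : R) = 0.
  by rewrite big1// => i _; rewrite big1 ?mulr0// => j _; rewrite mulr0.
rewrite S0 in C; apply: cvg_trans C; apply: near_eq_cvg.
by apply: nearW => n; exact/esym/E.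
Qed.

Lemma cos_lip (x y : R) : `|cos x - cos y| <= `|x - y|.
Proof.
have -> : cos x - cos y = - 2 * sin ((x + y) / 2) * sin ((x - y) / 2).
  have cx : cos x = cos ((x + y) / 2 + (x - y) / 2) by congr cos; field.
  have cy : cos y = cos ((x + y) / 2 - (x - y) / 2) by congr cos; field.
  by rewrite cx cy; move: (_ / 2) (_ / 2) => u v; rewrite cosB cosD; ring.
rewrite !normrM normrN normr_nat.
have := norm_sin_le ((x - y) / 2).
have -> : `|(x - y) / 2| = `|x - y| / 2 by rewrite normrM normfV normr_nat.
have := sin_max ((x + y) / 2).
move: `|sin ((x + y) / 2)| `|sin ((x - y) / 2)| (normr_ge0 (sin ((x + y) / 2)))
  (normr_ge0 (sin ((x - y) / 2))) => u v u0 v0 u1 vxy.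
by nra.
Qed.

Lemma measurable_cosD X (c : R) : measurable_fun setT X ->
  measurable_fun setT (fun w => cos (X w + c)).
Proof.
move=> mX; apply: (measurableT_comp (f := @cos R)).
  by apply: continuous_measurable_fun; exact: continuous_cos.
exact: measurable_funD.
Qed.

(** The cosine is 1-Lipschitz and the L^1 distance is at most the L^2 distance. This is how Gaussian
    transforms survive L^2 limits. *)
Lemma l2cvg_cos (Y_ : nat -> Omega -> R) Y (c : R) :
  (forall n, sqint (Y_ n)) -> sqint Y -> l2cvg Y_ Y ->
  \int[P]_w cos (Y_ n w + c) @[n --> \oo] --> \int[P]_w cos (Y w + c).
Proof.
move=> hY_ hY cY; apply/subr_cvg0; apply: cvg_sqr0.
apply: (@squeeze_cvgr _ _ _ _ (fun=> 0)
  (fun n => ip (fun w => Y_ n w - Y w) (fun w => Y_ n w - Y w))) => //; last exact: cvg_cst.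
apply: nearW => n; rewrite sqr_ge0/=.
apply: le_trans (Rintegral_abs_le (sqintB (hY_ n) hY)).
have ic X : sqint X -> P.-integrable setT (EFin \o (fun w => cos (X w + c))).
  move=> [mX _]; apply: (@integrable_bounded1 _ _ _ _ _ 1); first exact: measurable_cosD.
  by move=> w; exact: cos_max.
rewrite -[leLHS](real_normK (num_real _)) lerXn2r ?nnegrE//.
  by apply: Rintegral_ge0.
rewrite -RintegralB//; [|exact: ic..].
have iD := integrableB measurableT (ic _ (hY_ n)) (ic _ hY).
apply: (le_trans (le_normr_Rintegral measurableT iD)).
apply: le_Rintegral => //.
- exact: (integrable_norm iD).
- exact: (sqint_integrable (sqint_norm (sqintB (hY_ n) hY))).
- move=> w _ /=; apply: le_trans (cos_lip _ _) _.
  by rewrite opprD addrACA subrr addr0.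
Qed.

End square_integrable.

(** * Fatou's lemma and completeness of the space of square-integrable variables *)

Section fatou_bound.
Local Open Scope ereal_scope.

Lemma limn_einf_le (R : realType) (u : (\bar R)^nat) (l : \bar R) K :
  (forall n, (K <= n)%N -> u n <= l) -> limn_einf u <= l.
Proof.
move=> ul; rewrite limn_einf_lim; apply: lime_le; first exact: is_cvg_einfs.
apply: nearW => n; apply: le_trans (ul (maxn n K) (leq_maxr _ _)).
by apply: ereal_inf_lbound => /=; exists (maxn n K) => //=; exact: leq_maxl.
Qed.

Lemma fatou_ae_le d (T : measurableType d) (R : realType)
    (mu : {measure set T -> \bar R}) (f_ : (T -> \bar R)^nat) (f : T -> \bar R)
    (l : \bar R) K :
  (forall n, measurable_fun setT (f_ n)) -> (forall n x, 0 <= f_ n x) ->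
  measurable_fun setT f -> (forall x, 0 <= f x) ->
  {ae mu, forall x, f_ ^~ x @ \oo --> f x} ->
  (forall n, (K <= n)%N -> \int[mu]_x f_ n x <= l) -> \int[mu]_x f x <= l.
Proof.
move=> mf_ f_0 mf f0 cf fl.
have L0 x : 0 <= limn_einf (f_ ^~ x).
  by rewrite limn_einf_lim; apply: lime_ge; [exact: is_cvg_einfs|];
    apply: nearW => n; apply: le_ereal_inf_tmp => _ [m _ <-].
have mL : measurable_fun setT (fun x => limn_einf (f_ ^~ x)).
  rewrite /limn_einf; apply: measurableT_comp => //.
  by apply: measurable_fun_limn_esup => n; apply: measurableT_comp.
rewrite (@ge0_ae_eq_integral _ _ _ mu setT f (fun x => limn_einf (f_ ^~ x)))//.
  apply: le_trans (fatou mu measurableT mf_ (fun n x _ => f_0 n x)) _.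
  exact: limn_einf_le fl.
apply: filterS cf => x cfx _.
by have [-> _] := cvg_limn_einf_sup cfx.
Qed.

End fatou_bound.

Section square_integrable_complete.
Context {R : realType} d (Omega : measurableType d) (P : probability Omega R).
Implicit Types (X Y Z : Omega -> R).

Lemma sqint_integralE X Y : sqint P X -> sqint P Y ->
  (\int[P]_w (X w * Y w)%:E)%E = (ip P X Y)%:E.
Proof.
move=> hX hY; rewrite /ip /Rintegral fineK//.
exact: (integrable_fin_num measurableT (sqintM hX hY)).
Qed.

Lemma sqint_sqE X : sqint P X -> (\int[P]_w (X w ^+ 2)%:E)%E = (ip P X X)%:E.
Proof.
by move=> hX; rewrite -sqint_integralE//; apply: eq_integral => w _; rewrite expr2.
Qed.

Lemma sqint_lty X (l : R) : measurable_fun setT X ->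
  (\int[P]_w (X w ^+ 2)%:E <= l%:E)%E -> sqint P X /\ ip P X X <= l.
Proof.
move=> mX iX.
have hX : sqint P X.
  split => //; apply/integrableP; split.
    by apply/measurable_EFinP; exact: measurable_funX.
  apply: (@le_lt_trans _ _ l%:E); last exact: ltry.
  apply: le_trans iX; apply: ge0_le_integral => //.
  - apply: measurableT_comp => //.
    by apply/measurable_EFinP; exact: measurable_funX.
  - by apply/measurable_EFinP; exact: measurable_funX.
  - by move=> w _ /=; rewrite lee_fin ger0_norm// sqr_ge0.
by split => //; rewrite -lee_fin -sqint_sqE.
Qed.

(** The series of absolute increments has integral at most 2, hence is finite almost everywhere, and
    there the telescoping series converges absolutely. *)
Lemma summable_increments_cvg (Y : nat -> Omega -> R) :
  (forall n, measurable_fun setT (Y n)) ->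
  (forall n, (\int[P]_w `|Y n.+1 w - Y n w|%:E <= ((1 / 2) ^+ n)%:E)%E) ->
  {ae P, forall w, cvgn (Y ^~ w)}.
Proof.
move=> mY iY.
pose g n w : \bar R := `|Y n.+1 w - Y n w|%:E.
have mg n : measurable_fun setT (g n).
  by apply/measurable_EFinP; apply: measurableT_comp => //; exact: measurable_funB.
have g0 n w : (0 <= g n w)%E by rewrite lee_fin.
have h1 : `|1 / 2 : R| < 1 by rewrite ger0_norm//; lra.
have iG : P.-integrable setT (fun w => \sum_(n <oo) g n w)%E.
  apply/integrableP; split.
    by apply: ge0_emeasurable_sum.
  under eq_integral do rewrite gee0_abs ?nneseries_ge0//.
  rewrite integral_nneseries//.
  apply: (@le_lt_trans _ _ (\sum_(n <oo) ((1 / 2 : R) ^+ n)%:E)%E).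
    apply: lee_nneseries => [n _ _|n _]; [exact: integral_ge0|exact: iY].
  apply: (@le_lt_trans _ _ (2%:E)%E); last exact: ltry.
  apply: lime_le.
    by apply: is_cvg_nneseries => n _ _; rewrite lee_fin exprn_ge0//; lra.
  apply: nearW => n; rewrite sumEFin lee_fin.
  have := @geometric_le_lim _ n 1 (1 / 2 : R) ler01 ltac:(lra) h1.
  rewrite /series/= => h; apply: (@le_trans _ _ (1 * (1 - 1 / 2)^-1)); last first.
    by rewrite le_eqVlt; apply/orP; left; apply/eqP; field.
  by apply: le_trans h; rewrite le_eqVlt; apply/orP; left; apply/eqP/eq_bigr => i _; exact/esym/mul1r.
apply: filterS (integrable_ae measurableT iG) => w /(_ I) Gw.
have : cvgn (series (telescope (Y ^~ w))).
  apply: (@normed_cvg _ R^o).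
  have := @is_cvg_nneseries R (fun n => g n w) xpredT 0 (fun n _ _ => g0 n w).
  case/cvg_ex => l gl.
  have lfin : l \is a fin_num by move/cvg_lim : gl Gw => ->.
  apply/cvg_ex; exists (fine l).
  move: gl; rewrite -(fineK lfin); under eq_fun do rewrite /g sumEFin.
  by move/fine_cvg.
case/cvg_ex => l; rewrite telescopeK => cl; apply/cvg_ex; exists (l + Y 0%N w).
rewrite (_ : Y ^~ w = (fun n => (Y n w - Y 0%N w) + Y 0%N w)); last first.
  by apply/funext => n; rewrite subrK.
by apply: cvgD => //; exact: cvg_cst.
Qed.

(** Riesz-Fischer: a subsequence with summable increments converges almost surely, and Fatou bounds
    the L^2 distance from every late term of the whole sequence to that limit. *)
Lemma l2_complete (X_ : nat -> Omega -> R) : (forall n, sqint P (X_ n)) ->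
  (forall e, 0 < e -> exists K, forall k l, (K <= k)%N -> (K <= l)%N ->
     ip P (fun w => X_ k w - X_ l w) (fun w => X_ k w - X_ l w) <= e) ->
  exists2 X : {RV P >-> R}, sqint P X & l2cvg P X_ X.
Proof.
move=> hX_ cau.
have {cau} cau e : {K | 0 < e -> forall k l, (K <= k)%N -> (K <= l)%N ->
     ip P (fun w => X_ k w - X_ l w) (fun w => X_ k w - X_ l w) <= e}.
  apply: cid; have [e0|e0] := pselect (0 < e); first by have [K] := cau e e0; exists K.
  by exists 0%N.
(* The precision is a square because [ip] is a squared norm; the L^1 norms of the increments are
   then at most (1/2)^j. *)
pose K (j : nat) := sval (cau ((1 / 2) ^+ j ^+ 2)).
have KP j k l : (K j <= k)%N -> (K j <= l)%N ->
    ip P (fun w => X_ k w - X_ l w) (fun w => X_ k w - X_ l w) <= (1 / 2) ^+ j ^+ 2.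
  by apply: (svalP (cau ((1 / 2) ^+ j ^+ 2))); rewrite !exprn_gt0//; lra.
(* Summing the ranks makes phi monotone and at least each [K j]; the added j makes it unbounded. *)
pose phi j := (\sum_(i < j.+1) K i + j)%N.
have Kphi j : (K j <= phi j)%N by rewrite /phi big_ord_recr/= -addnA addnCA leq_addr.
have phiS j : (phi j <= phi j.+1)%N.
  by rewrite /phi [in leqRHS]big_ord_recr/= -addnA leq_add2l; lia.
have jphi j : (j <= phi j)%N by rewrite /phi leq_addl.
pose Y j := X_ (phi j).
have mX n : measurable_fun setT (X_ n) by case: (hX_ n).
have aeY : {ae P, forall w, cvgn (Y ^~ w)}.
  apply: summable_increments_cvg => [n|n]; first exact: mX.
  have hB := sqintB (hX_ (phi n.+1)) (hX_ (phi n)).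
  have iB := sqint_integrable (sqint_norm hB).
  rewrite -[leLHS](fineK (integrable_fin_num measurableT iB)) lee_fin.
  rewrite -[fine _]/(\int[P]_w `|X_ (phi n.+1) w - X_ (phi n) w|).
  rewrite -(@ler_pXn2r _ 2)// ?nnegrE ?exprn_ge0//; last first.
    by apply: Rintegral_ge0.
  apply: le_trans (Rintegral_abs_le hB) _.
  by apply: KP => //; apply: leq_trans (Kphi n) (phiS n).
(* The upper limit is measurable on all of [Omega] and agrees with the limit wherever that
   exists. *)
pose X w := fine (limn_esup (fun n => (Y n w)%:E)).
have mXl : measurable_fun setT X.
  apply: measurableT_comp => //; apply: measurable_fun_limn_esup => n.
  by apply/measurable_EFinP; exact: mX.
have cX : {ae P, forall w, Y n w @[n --> \oo] --> X w}.
  apply: filterS aeY => w /cvg_ex[l Yl].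
  have : (Y n w)%:E @[n --> \oo] --> l%:E by apply: cvg_EFin => //; exact: nearW.
  by move/cvg_limn_einf_sup => [_]; rewrite /X => ->.
have B e k : 0 < e -> (sval (cau e) <= k)%N ->
    sqint P (fun w => X_ k w - X w) /\
    ip P (fun w => X_ k w - X w) (fun w => X_ k w - X w) <= e.
  move=> e0 ek; apply: sqint_lty; first exact: measurable_funB.
  apply: (@fatou_ae_le _ _ _ P (fun n w => ((X_ k w - Y n w) ^+ 2)%:E) _ _ (sval (cau e))).
  - by move=> n; apply/measurable_EFinP; apply: measurable_funX; apply: measurable_funB; exact: mX.
  - by move=> n w; rewrite lee_fin sqr_ge0.
  - by apply/measurable_EFinP; apply: measurable_funX; apply: measurable_funB => //; exact: mX.
  - by move=> w; rewrite lee_fin sqr_ge0.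
  - apply: filterS cX => w cw; apply: cvg_EFin; first exact: nearW.
    have cXY : X_ k w - Y n w @[n --> \oo] --> X_ k w - X w.
      by apply: cvgB => //; exact: cvg_cst.
    by rewrite expr2; under eq_fun do rewrite /= expr2; exact: cvgM.
  - move=> n Kn; rewrite (sqint_sqE (sqintB (hX_ k) (hX_ (phi n)))).
    by rewrite lee_fin; apply: (svalP (cau e)) => //; exact: leq_trans Kn (jphi n).
have hX : sqint P X.
  have [hB _] := B 1 _ ltr01 (leqnn _).
  have := sqintB (hX_ (sval (cau 1))) hB.
  by under eq_fun do rewrite subKr.
pose X' : {RV P >-> R} := HB.pack X (@isMeasurableFun.Build _ _ _ _ X mXl).
exists X'; first exact: hX.
apply/cvgr0Pnorm_le => /= e e0.
exists (sval (cau e)) => // k /= ek.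
have [_] := B e k e0 ek.
by rewrite ger0_norm ?ip_ge0.
Qed.

End square_integrable_complete.

(** * Components of a field indexed by the unit box *)

Section brownian_field.
Context {R : realType} d (Omega : measurableType d) (P : probability Omega R).
Variables (n : nat) (X : n.-tuple R -> {RV P >-> R}).

(** For n = #|H| this is convertible to [multiindex H], so families pass from one to the other
    without transport. *)
Definition posindex := {nu : {ffun 'I_n -> nat} | [forall k, (0 < nu k)%N]}.

Definition field_cov (u v : n.-tuple R) : R :=
  \prod_(k < n) bridge_cov (tnth u k) (tnth v k).

Definition field_fun (nu : {ffun 'I_n -> nat}) (u : n.-tuple R) : R :=
  \prod_(k < n) sine_fun (nu k) (tnth u k).

(** The square root of the eigenvalue of [field_fun nu], hence the standard deviation of the
    coefficient of the field along it. *)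
Definition field_sd (nu : {ffun 'I_n -> nat}) : R :=
  ((\prod_(k < n) nu k)%N%:R * pi ^+ n)^-1.

Lemma posindex_gt0 (nu : posindex) k : (0 < val nu k)%N.
Proof. exact: (forallP (valP nu) k). Qed.

Lemma field_sd_gt0 (nu : posindex) : 0 < field_sd (val nu).
Proof.
rewrite invr_gt0 mulr_gt0 ?exprn_gt0 ?pi_gt0// ltr0n prodn_gt0// => k.
exact: posindex_gt0.
Qed.

Lemma field_sdE (nu : {ffun 'I_n -> nat}) :
  field_sd nu ^+ 2 = \prod_(k < n) bridge_eig (nu k).
Proof.
rewrite /field_sd /bridge_eig exprVn exprMn natr_prod -prodrXl -exprM mulnC exprM.
rewrite -[n in X in _ * X]card_ord -prodr_const -big_split/= -prodfV.
by apply: eq_bigr => k _; rewrite exprMn.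
Qed.

Hypothesis sqX : forall u, @unit_box R n u -> sqint P (X u).
Hypothesis covX : forall u v, @unit_box R n u -> @unit_box R n v ->
  ip P (X u) (X v) = field_cov u v.
Hypothesis cosX : forall (m : nat) (a : 'I_m -> R) (t : 'I_m -> n.-tuple R) c,
  (forall i, @unit_box R n (t i)) ->
  let S := fun w => \sum_(i < m) a i * X (t i) w in
  \int[P]_w cos (S w + c) = expR (- (ip P S S / 2)) * cos c.

Lemma field_combination_cos (J : finType) (a : J -> R) (t : J -> n.-tuple R) c :
  (forall i, @unit_box R n (t i)) ->
  let S := fun w => \sum_i a i * X (t i) w in
  \int[P]_w cos (S w + c) = expR (- (ip P S S / 2)) * cos c.
Proof.
move=> tb S.
have := @cosX #|J| (fun i => a (enum_val i)) (fun i => t (enum_val i)) c (fun i => tb _).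
have -> // : (fun w => \sum_(i < #|J|) a (enum_val i) * X (t (enum_val i)) w) = S.
by apply/funext => w; rewrite /S (reindex (enum_val : 'I_#|J| -> J))//=; exact/onW_bij/enum_val_bij.
Qed.

Definition grid_tuple N (g : {ffun 'I_n -> 'I_N}) : n.-tuple R :=
  [tuple (g k)%:R / N%:R | k < n].

Lemma grid_tuple_box N (g : {ffun 'I_n -> 'I_N}) : @unit_box R n (grid_tuple g).
Proof.
move=> k; rewrite tnth_mktuple divr_ge0 ?ler0n//=.
have N0 : (0 < N)%N by apply: leq_trans (ltn_ord (g k)).
by rewrite ler_pdivrMr ?ltr0n// mul1r ler_nat ltnW.
Qed.

Definition grid_coef N (nu : {ffun 'I_n -> nat}) : Omega -> R := fun w =>
  \sum_(g : {ffun 'I_n -> 'I_N})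
     (N%:R^-1 ^+ n * field_fun nu (grid_tuple g)) * X (grid_tuple g) w.

Lemma sqint_grid_coef N nu : sqint P (grid_coef N nu).
Proof. by apply: sqint_sum => g _; apply: sqintZ; exact/sqX/grid_tuple_box. Qed.

Lemma grid_sum_prod N (F : 'I_n -> 'I_N -> R) :
  \sum_(g : {ffun 'I_n -> 'I_N}) N%:R^-1 ^+ n * \prod_k F k (g k) =
  \prod_k (N%:R^-1 * \sum_(i < N) F k i).
Proof.
rewrite -mulr_sumr -(bigA_distr_bigA F) big_split/= prodr_const card_ord.
by [].
Qed.

Lemma ip_grid_coef N nu u : @unit_box R n u ->
  ip P (grid_coef N nu) (X u) = \prod_k (N%:R^-1 *
    \sum_(i < N) bridge_cov (i%:R / N%:R) (tnth u k) * sine_fun (nu k) (i%:R / N%:R)).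
Proof.
move=> ub; rewrite ip_suml; [|move=> g; exact/sqX/grid_tuple_box|exact: sqX].
rewrite -grid_sum_prod; apply: eq_bigr => g _.
rewrite covX//; last exact: grid_tuple_box.
rewrite -mulrA -big_split/=; congr (_ * _); apply: eq_bigr => k _.
by rewrite tnth_mktuple mulrC.
Qed.

(* For M %| N the coarse grid is contained in the fine one, on which [field_fun]
   restricts to an eigenvector. *)
Lemma ip_grid_coef2 N M (nu mu : {ffun 'I_n -> nat}) : (M %| N)%N -> (0 < N)%N ->
  (forall k, (0 < nu k < M)%N) -> (forall k, (0 < mu k < M)%N) ->
  ip P (grid_coef N nu) (grid_coef M mu) =
  (nu == mu)%:R * \prod_k grid_eig (nu k) N.
Proof.
move=> /dvdnP[q Nq] N0 nuM muM.
have [q0 M0] : (0 < q)%N /\ (0 < M)%N by apply/andP; rewrite -muln_gt0 -Nq.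
rewrite ip_sumr; [|move=> g; exact/sqX/grid_tuple_box|exact: sqint_grid_coef].
transitivity (\prod_k (M%:R^-1 * \sum_(i < M)
    grid_eig (nu k) N * (sine_fun (nu k) (i%:R / M%:R) * sine_fun (mu k) (i%:R / M%:R))) : R).
  rewrite -grid_sum_prod; apply: eq_bigr => g _.
  rewrite ip_grid_coef; last exact: grid_tuple_box.
  rewrite -mulrA -big_split/=; congr (_ * _); apply: eq_bigr => k _.
  rewrite tnth_mktuple.
  have -> : (g k)%:R / M%:R = (g k * q)%N%:R / N%:R :> R.
    by rewrite Nq !natrM; field; rewrite !pnatr_eq0; lia.
  rewrite grid_eigenvector; first by rewrite mulrCA (mulrC (sine_fun (mu k) _)).
    by have /andP[-> h] := nuM k; rewrite (leq_trans h)// Nq leq_pmull.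
  by rewrite Nq mulnC leq_mul2l ltnW ?orbT.
transitivity (\prod_k ((nu k == mu k)%:R * grid_eig (nu k) N : R)).
  apply: eq_bigr => k _; rewrite -mulr_sumr mulrCA mulrC.
  by rewrite sine_fun_grid_orthonormal.
rewrite big_split/=; congr (_ * _).
have [->|ne] := eqVneq nu mu; first by rewrite big1// => k _; rewrite eqxx.
have /existsP[k nk] : [exists k, nu k != mu k].
  apply: contra_neqT ne => /existsPn h; apply/ffunP => k.
  by apply/eqP; move: (h k); rewrite negbK.
by rewrite (bigD1 k)//= (negbTE nk) mul0r.
Qed.

Lemma cvg_expn2 : (2 ^ k)%N @[k --> \oo] --> \oo.
Proof. by apply/cvgnyPge => A; exists A => // k /= Ak; rewrite (leq_trans Ak)// ltnW// ltn_expl. Qed.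

Lemma cvg_prod_grid_eig (nu : {ffun 'I_n -> nat}) :
  \prod_k grid_eig (nu k) (2 ^ j) @[j --> \oo] --> (field_sd nu ^+ 2 : R).
Proof.
rewrite field_sdE; apply: cvgr_prod => k _.
exact: (cvg_comp _ _ cvg_expn2 (@cvg_grid_eig R (nu k))).
Qed.

Lemma posindex_bound (nu : {ffun 'I_n -> nat}) : exists K, forall j, (K <= j)%N ->
  forall k, (nu k < 2 ^ j)%N.
Proof.
exists (\sum_k nu k)%N => j Kj k; apply: leq_ltn_trans (ltn_expl j _) => //.
by apply: leq_trans Kj; rewrite (bigD1 k)//= leq_addr.
Qed.

Definition grid_component j (nu : posindex) : Omega -> R := fun w =>
  (field_sd (val nu))^-1 * grid_coef (2 ^ j) (val nu) w.

Lemma sqint_grid_component j nu : sqint P (grid_component j nu).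
Proof. exact/sqintZ/sqint_grid_coef. Qed.

Lemma ip_grid_component (nu mu : posindex) : exists K, forall i j, (K <= j <= i)%N ->
  ip P (grid_component i nu) (grid_component j mu) =
  (nu == mu)%:R * (field_sd (val nu) ^- 2 * \prod_k grid_eig (val nu k) (2 ^ i)).
Proof.
have [K1 h1] := posindex_bound (val nu); have [K2 h2] := posindex_bound (val mu).
exists (maxn K1 K2) => i j /andP[]; rewrite geq_max => /andP[K1j K2j] ji.
rewrite ipZl; [|exact: sqint_grid_coef|exact: sqint_grid_component].
rewrite ipC ipZl; [|exact: sqint_grid_coef|exact: sqint_grid_coef].
rewrite ipC ip_grid_coef2; last 4 first.
- by rewrite dvdn_exp2l.
- by rewrite expn_gt0.
- by move=> k; rewrite posindex_gt0 h1.
- by move=> k; rewrite posindex_gt0 h2.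
rewrite val_eqE; have [<-|_] := eqVneq nu mu; last by rewrite !mul0r !mulr0.
by rewrite !mul1r mulrA -invfM expr2.
Qed.

(** The inner product of two components depends only on the finer grid. For l <= k the squared
    distance is thus u k - 2 u k + u l = u l - u k, and u converges. *)
Lemma grid_component_cauchy nu (e : R) : 0 < e ->
  exists K, forall k l, (K <= k)%N -> (K <= l)%N ->
    ip P (fun w => grid_component k nu w - grid_component l nu w)
         (fun w => grid_component k nu w - grid_component l nu w) <= e.
Proof.
move=> e0; have [K hK] := ip_grid_component nu nu.
pose u j : R := field_sd (val nu) ^- 2 * \prod_k grid_eig (val nu k) (2 ^ j).
have uu i j : (K <= j <= i)%N -> ip P (grid_component i nu) (grid_component j nu) = u i.
  by move=> ij; rewrite hK// eqxx mul1r.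
have cu : u j @[j --> \oo] --> field_sd (val nu) ^- 2 * field_sd (val nu) ^+ 2.
  by apply: cvgMl_tmp; exact: cvg_prod_grid_eig.
have /cvgrPdist_le /(_ (e / 2)) := cu; rewrite divr_gt0// => /(_ isT)[K' _ hK'].
exists (maxn K K').
have W k l : (l <= k)%N -> (maxn K K' <= l)%N ->
    ip P (fun w => grid_component k nu w - grid_component l nu w)
         (fun w => grid_component k nu w - grid_component l nu w) <= e.
  move=> lk; rewrite geq_max => /andP[Kl K'l].
  rewrite ipBB; [|exact: sqint_grid_component..].
  rewrite !uu ?Kl ?leqnn ?lk ?(leq_trans Kl)//.
  have := hK' l K'l; have := hK' k (leq_trans K'l lk); rewrite /= !ler_distl.
  by move: (u k) (u l) => x y; lra.
move=> k l Kk Kl; have [lk|/ltnW kl] := leqP l k; first exact: W.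
have := W _ _ kl Kk; apply: le_trans.
rewrite le_eqVlt; apply/orP; left; apply/eqP; rewrite /ip.
by apply: eq_Rintegral => w _; ring.
Qed.

Theorem field_components : exists Z : posindex -> {RV P >-> R},
  [/\ forall nu, sqint P (Z nu),
      forall nu mu, ip P (Z nu) (Z mu) = (nu == mu)%:R,
      forall nu u, @unit_box R n u ->
        ip P (Z nu) (X u) = field_sd (val nu) * field_fun (val nu) u &
      forall (r : seq posindex) (a : posindex -> R) c, uniq r ->
        \int[P]_w cos (\sum_(i <- r) a i * Z i w + c) =
        expR (- ((\sum_(i <- r) a i ^+ 2) / 2)) * cos c].
Proof.
have /choice[Z hZ] : forall nu, exists Z : {RV P >-> R},
    sqint P Z /\ l2cvg P (fun j => grid_component j nu) Z.
  move=> nu; have [Z sZ cZ] := l2_complete (fun j => sqint_grid_component j nu)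
    (@grid_component_cauchy nu).
  by exists Z.
have sZ nu : sqint P (Z nu) by case: (hZ nu).
have cZ nu : l2cvg P (fun j => grid_component j nu) (Z nu) by case: (hZ nu).
have ZZ nu mu : ip P (Z nu) (Z mu) = (nu == mu)%:R.
  have h := l2cvg_ip (fun j => sqint_grid_component j nu)
    (fun j => sqint_grid_component j mu) (sZ nu) (sZ mu) (cZ nu) (cZ mu).
  apply: (cvg_unique _ h) => //.
  have [K hK] := ip_grid_component nu mu.
  have C : (nu == mu)%:R * (field_sd (val nu) ^- 2 *
      \prod_k grid_eig (val nu k) (2 ^ j)) @[j --> \oo] -->
      ((nu == mu)%:R * (field_sd (val nu) ^- 2 * field_sd (val nu) ^+ 2) : R).
    by apply: cvgMl_tmp; apply: cvgMl_tmp; exact: cvg_prod_grid_eig.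
  rewrite mulVf ?mulr1 in C; last by rewrite expf_neq0// gt_eqF// field_sd_gt0.
  apply: cvg_trans C; apply: near_eq_cvg; exists K => // j /= Kj.
  by rewrite hK// Kj leqnn.
exists Z; split => //.
- move=> nu u ub.
  have h := l2cvg_ip (fun j => sqint_grid_component j nu) (fun=> sqX ub)
    (sZ nu) (sqX ub) (cZ nu) (l2cvg_cst P (X u)).
  apply: (cvg_unique _ h) => //.
  have C : (field_sd (val nu))^-1 * \prod_k ((2 ^ j)%N%:R^-1 *
      \sum_(i < 2 ^ j) bridge_cov (i%:R / (2 ^ j)%N%:R) (tnth u k) *
        sine_fun (val nu k) (i%:R / (2 ^ j)%N%:R)) @[j --> \oo] -->
      ((field_sd (val nu))^-1 * \prod_k (bridge_eig (val nu k) *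
        sine_fun (val nu k) (tnth u k)) : R).
    apply: cvgMl_tmp; apply: cvgr_prod => k _.
    exact: (cvg_comp _ _ cvg_expn2 (cvg_riemann_bridge (posindex_gt0 nu k) (ub k))).
  rewrite big_split/= -field_sdE expr2 mulrA mulrA mulVf ?mul1r in C; last first.
    by rewrite gt_eqF// field_sd_gt0.
  apply: cvg_trans C; apply: near_eq_cvg; apply: nearW => j /=.
  rewrite ipZl; [|exact: sqint_grid_coef|exact: sqX].
  by rewrite ip_grid_coef.
- move=> r a c ur.
  pose S j w := \sum_(i <- r) a i * grid_component j i w.
  pose S' w := \sum_(i <- r) a i * Z i w.
  have sS j : sqint P (S j).
    by apply: sqint_sum => i _; apply: sqintZ; exact: sqint_grid_component.
  have sS' : sqint P S' by apply: sqint_sum => i _; exact: sqintZ.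
  have cS : l2cvg P S S'.
    exact: (l2cvg_sum r a sqint_grid_component sZ cZ).
  have SS : ip P S' S' = \sum_(i <- r) a i ^+ 2.
    rewrite ip_suml//; apply: eq_big_seq => i ir; rewrite ip_sumr//.
    rewrite (bigD1_seq i)//= ZZ eqxx mulr1 big1_seq ?addr0 ?expr2// => j /andP[ji _].
    by rewrite ZZ eq_sym (negbTE ji) mulr0.
  rewrite -SS.
  have c1 := @l2cvg_cos _ _ _ _ S S' c sS sS' cS.
  apply: (cvg_unique _ c1) => //.
  have C : expR (- (ip P (S j) (S j) / 2)) * cos c @[j --> \oo] -->
      (expR (- (ip P S' S' / 2)) * cos c : R).
    apply: cvgMr_tmp; apply: continuous_cvg; first exact: continuous_expR.
    apply: cvgN; apply: cvgMr_tmp.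
    exact: (l2cvg_ip sS sS sS' sS' cS cS).
  apply: cvg_trans C; apply: near_eq_cvg; apply: nearW => j.
  (* For fixed j all components live on one grid, so [S j] is a single finite combination of values
     of X, with coefficients b, to which the Gaussian hypothesis applies. *)
  pose t (g : {ffun 'I_n -> 'I_(2 ^ j)}) := grid_tuple g.
  pose b (g : {ffun 'I_n -> 'I_(2 ^ j)}) := \sum_(i <- r) a i *
    ((field_sd (val i))^-1 * ((2 ^ j)%N%:R^-1 ^+ n * field_fun (val i) (grid_tuple g))).
  have -> : S j = (fun w => \sum_g b g * X (t g) w).
    apply/funext => w; rewrite /S /grid_component /grid_coef /b.
    under [RHS]eq_bigr do rewrite mulr_suml.
    rewrite exchange_big/=; apply: eq_bigr => i _.
    by rewrite !mulr_sumr; apply: eq_bigr => g _; rewrite !mulrA.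
  rewrite -(field_combination_cos b c (fun g => grid_tuple_box g)).
  by [].
Qed.

End brownian_field.

(** * The product eigensystem on the unit box *)

Section field_system.
Context {R : realType} {n : nat}.
Local Notation posindex := (posindex n).
Local Notation box := (@unit_box R n).
Local Notation mu := (@lebesgue_tuple R n).

Lemma prod_nat_eq (nu mu : {ffun 'I_n -> nat}) :
  \prod_k ((nu k == mu k)%:R : R) = (nu == mu)%:R.
Proof.
have [->|ne] := eqVneq nu mu; first by rewrite big1// => k _; rewrite eqxx.
have /existsP[k nk] : [exists k, nu k != mu k].
  apply: contra_neqT ne => /existsPn h; apply/ffunP => k.
  by apply/eqP; move: (h k); rewrite negbK.
by rewrite (bigD1 k)//= (negbTE nk) mul0r.
Qed.

Lemma integral_field_fun2 (nu nu' : posindex) :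
  mu.-integrable box (fun u => (field_fun (val nu) u * field_fun (val nu') u : R)%:E) /\
  (\int[mu]_(u in box) (field_fun (val nu) u * field_fun (val nu') u)%:E =
   (nu == nu')%:R%:E)%E.
Proof.
pose f k x : R := sine_fun (val nu k) x * sine_fun (val nu' k) x.
have [|h1 h2] := @lebesgue_unit_box_prod R n f.
  by move=> k; apply: continuous_integrable01; apply: continuousM_fun;
    exact: continuous_sine_fun.
have E u : field_fun (val nu) u * field_fun (val nu') u = \prod_(k < n) f k (tnth u k).
  by rewrite -big_split.
split; first by under eq_fun do rewrite E.
under eq_integral do rewrite E.
rewrite h2 -val_eqE -prod_nat_eq; congr EFin; apply: eq_bigr => k _.
by rewrite Rintegral_sine_fun ?posindex_gt0.
Qed.

Lemma integral_field_cov (nu : posindex) u : box u ->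
  (\int[mu]_(v in box) (field_cov u v * field_fun (val nu) v)%:E =
   (field_sd (val nu) ^+ 2 * field_fun (val nu) u)%:E)%E.
Proof.
move=> ub; pose f k x : R := bridge_cov (tnth u k) x * sine_fun (val nu k) x.
have [|h1 h2] := @lebesgue_unit_box_prod R n f.
  move=> k; apply: continuous_integrable01; apply: continuousM_fun.
    by apply: continuous_bridge_cov; exact: ub.
  exact: continuous_sine_fun.
have E v : field_cov u v * field_fun (val nu) v = \prod_(k < n) f k (tnth v k).
  by rewrite -big_split.
under eq_integral do rewrite E.
rewrite h2 field_sdE -big_split/=; congr EFin; apply: eq_bigr => k _.
by rewrite Rintegral_bridge_cov ?posindex_gt0//; exact: ub.
Qed.

Lemma lebesgue_unit_box1 : mu box = 1%E.
Proof.
have [|_ h] := @lebesgue_unit_box_prod R n (fun _ => cst 1).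
  by move=> k; apply: continuous_integrable01; exact: cst_continuous.
transitivity (\int[mu]_(u in box) (\prod_(k < n) cst 1 (tnth u k))%:E)%E.
  under eq_integral do rewrite big1//.
  by rewrite integral_cst ?mul1e//; exact: measurable_unit_box.
rewrite h big1// => k _; rewrite Rintegral_cst//= mul1r.
have := @lebesgue_measure_itv R `[0, 1]; rewrite /= lte_fin ltr01 sube0.
by move=> ->.
Qed.

(** Factors are exchanged one at a time. The induction also keeps the partial products in [0, 1], so
    that each exchange costs at most e. *)
Lemma prod_dist_le (x y : 'I_n -> R) (e : R) :
  (forall k, 0 <= x k <= 1) -> (forall k, 0 <= y k <= 1) ->
  (forall k, `|x k - y k| <= e) -> `|\prod_k x k - \prod_k y k| <= n%:R * e.
Proof.
move=> x01 y01 xye.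
suff : forall r : seq 'I_n, [/\ 0 <= \prod_(k <- r) x k <= 1,
    0 <= \prod_(k <- r) y k <= 1 &
    `|\prod_(k <- r) x k - \prod_(k <- r) y k| <= (size r)%:R * e].
  by move=> /(_ (index_enum 'I_n))[_ _]; rewrite /index_enum -enumT size_enum_ord.
elim=> [|k r [hx hy IH]]; first by rewrite !big_nil subrr normr0 mul0r ler01 lexx.
rewrite !big_cons /= -[_.+1]add1n natrD mulrDl mul1r.
have := x01 k; have := y01 k; have := xye k.
move: (x k) (y k) (\prod_(j <- r) x j) (\prod_(j <- r) y j) hx hy IH => a b c d.
move=> hc hd cd ab ha hb; split.
- by apply/andP; split; nra.
- by apply/andP; split; nra.
- have -> : a * c - b * d = (a - b) * c + b * (c - d) by ring.
  apply: (le_trans (ler_normD _ _)); apply: lerD; rewrite normrM.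
    rewrite (ger0_norm (proj1 (andP hc))); apply: le_trans ab.
    by rewrite ler_piMr//; case/andP: hc.
  by rewrite (ger0_norm (proj1 (andP ha))); apply: le_trans cd; rewrite ler_piMl//; case/andP: ha.
Qed.

End field_system.

(** * Mercer's expansion on the diagonal of the box *)

Section mercer_box.
Context {R : realType} {n : nat}.
Local Notation posindex := (posindex n).
Local Notation box := (@unit_box R n).

Fact succ_index_subproof M (g : {ffun 'I_n -> 'I_M}) :
  [forall k, (0 < [ffun k => (g k).+1] k)%N].
Proof. by apply/forallP => k; rewrite ffunE. Qed.

Definition succ_index M (g : {ffun 'I_n -> 'I_M}) : posindex :=
  exist _ [ffun k => (g k).+1] (succ_index_subproof g).

Lemma succ_indexE M (g : {ffun 'I_n -> 'I_M}) k : val (succ_index g) k = (g k).+1.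
Proof. exact: ffunE. Qed.

Lemma succ_index_inj M : injective (@succ_index M).
Proof.
move=> g h gh; apply/ffunP => k; apply/val_inj/succn_inj => /=.
by rewrite -!succ_indexE gh.
Qed.

(** Over such a cube of indices a sum of products factorises into one-dimensional partial sums, and
    every finite set of indices lies in a cube. *)
Definition box_index M : {fset posindex} :=
  [fset nu in [seq succ_index g | g : {ffun 'I_n -> 'I_M}]]%fset.

Lemma mem_box_index M (nu : posindex) : (forall k, (val nu k <= M)%N) -> nu \in box_index M.
Proof.
move=> nuM; rewrite !inE; apply/mapP.
have lt k : ((val nu k).-1 < M)%N.
  by rewrite prednK ?posindex_gt0.
exists [ffun k => Ordinal (lt k)]; first by rewrite mem_enum.
by apply/val_inj/ffunP => k; rewrite succ_indexE ffunE/= prednK ?posindex_gt0.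
Qed.

Lemma box_indexP M (nu : posindex) : reflect (forall k, (val nu k <= M)%N) (nu \in box_index M).
Proof.
apply: (iffP idP) => [|]; last exact: mem_box_index.
by rewrite !inE => /mapP[g _ ->] k; rewrite succ_indexE.
Qed.

Lemma sub_box_index M N : (M <= N)%N -> (box_index M `<=` box_index N)%fset.
Proof.
move=> MN; apply/fsubsetP => nu /box_indexP nuM; apply/box_indexP => k.
exact: leq_trans MN.
Qed.

Lemma fset_sub_box_index (F : {fset posindex}) : exists M, (F `<=` box_index M)%fset.
Proof.
exists (\sum_(nu <- F) \sum_k val nu k)%N; apply/fsubsetP => nu nuF.
apply/box_indexP => k; rewrite (big_rem nu)//= (bigD1 k)//=.
by rewrite -!addnA leq_addr.
Qed.

Lemma sum_box_index M (f : posindex -> R) :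
  \sum_(nu <- box_index M) f nu = \sum_(g : {ffun 'I_n -> 'I_M}) f (succ_index g).
Proof.
transitivity (\sum_(nu <- [seq succ_index g | g : {ffun 'I_n -> 'I_M}]) f nu).
  apply: perm_big; apply: uniq_perm; first exact: fset_uniq.
    by rewrite map_inj_uniq ?enum_uniq//; exact: succ_index_inj.
  by move=> nu; rewrite !inE.
by rewrite big_map big_enum.
Qed.

Lemma sumr_fsubset (A B : {fset posindex}) (f : posindex -> R) :
  (A `<=` B)%fset -> (forall nu, 0 <= f nu) ->
  \sum_(nu <- A) f nu <= \sum_(nu <- B) f nu.
Proof.
move=> AB f0; rewrite [leRHS](bigID (mem A))/=.
rewrite -[leLHS]addr0; apply: lerD; last by apply: sumr_ge0.
rewrite -[leRHS]big_filter le_eqVlt; apply/orP; left; apply/eqP; apply: perm_big; apply: uniq_perm.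
- exact: fset_uniq.
- by rewrite filter_uniq// fset_uniq.
- move=> nu; rewrite mem_filter; have [|//] := boolP (nu \in A).
  by move/(fsubsetP AB).
Qed.

(** On the diagonal the terms are nonnegative, so a partial sum is below any longer one, and the one
    of length N exceeds the kernel by at most 16 / N. It is thus at most [bridge_cov t t], hence at
    most 1, as [prod_dist_le] requires. *)
Lemma mercer_partial_itv M (t : R) : (0 < M)%N -> 0 <= t <= 1 ->
  0 <= \sum_(i < M) bridge_eig i.+1 * (sine_fun i.+1 t * sine_fun i.+1 t) <= 1.
Proof.
move=> M0 t01.
have p m : 0 <= bridge_eig m.+1 * (sine_fun m.+1 t * sine_fun m.+1 t) :> R.
  by apply: mulr_ge0; [exact/ltW/bridge_eig_gt0|rewrite -expr2; exact: sqr_ge0].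
rewrite sumr_ge0//=; apply: (@le_trans _ _ (bridge_cov t t)); last first.
  by case/andP: (bridge_cov_itv t01 t01).
apply/ler_addgt0Pr => e e0.
pose N := (M + (Num.truncn (16 / e)).+1)%N.
have N0 : (0 < N)%N by rewrite ltn_addr.
have := mercer_bridge N0 t01 t01; rewrite ler_distl => /andP[+ _].
rewrite big_add1 big_mkord lerBlDr => h; apply: le_trans (le_trans h _).
  rewrite -(big_mkord xpredT (fun i => bridge_eig i.+1 * (sine_fun i.+1 t * sine_fun i.+1 t))).
  rewrite -[leRHS](big_mkord xpredT (fun i => bridge_eig i.+1 * (sine_fun i.+1 t * sine_fun i.+1 t))).
  rewrite [leRHS](big_cat_nat (n := M))//= ?leq_addr//.
  by rewrite lerDl; apply: sumr_ge0.
rewrite lerD2l; rewrite ler_pdivrMr ?ltr0n// mulrC -ler_pdivrMr//.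
apply: (@le_trans _ _ (Num.truncn (16 / e)).+1%:R).
  by apply/ltW; rewrite truncnS_gt.
by rewrite ler_nat /N leq_addl.
Qed.

Lemma mercer_box M u : (0 < M)%N -> box u ->
  `|field_cov u u - \sum_(nu <- box_index M) (field_sd (val nu) * field_fun (val nu) u) ^+ 2|
  <= n%:R * (16 / M%:R).
Proof.
move=> M0 ub; rewrite sum_box_index.
have -> : \sum_(g : {ffun 'I_n -> 'I_M}) (field_sd (val (succ_index g)) *
      field_fun (val (succ_index g)) u) ^+ 2 =
    \prod_(k < n) \sum_(i < M) bridge_eig i.+1 *
      (sine_fun i.+1 (tnth u k) * sine_fun i.+1 (tnth u k)).
  rewrite bigA_distr_bigA/=; apply: eq_bigr => g _.
  rewrite exprMn field_sdE expr2 -!big_split/=; apply: eq_bigr => k _.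
  by rewrite ffunE.
apply: prod_dist_le => k.
- exact: bridge_cov_itv.
- exact: mercer_partial_itv.
- have := mercer_bridge M0 (ub k) (ub k).
  by rewrite big_add1 big_mkord.
Qed.

End mercer_box.

(** * Mean-square error of the partial sums *)

Section field_mean_square.
Context {R : realType} d (Omega : measurableType d) (P : probability Omega R).
Variables (n : nat) (X : n.-tuple R -> {RV P >-> R}) (Z : posindex n -> {RV P >-> R}).
Hypothesis sqX : forall u, @unit_box R n u -> sqint P (X u).
Hypothesis covX : forall u v, @unit_box R n u -> @unit_box R n v ->
  ip P (X u) (X v) = field_cov u v.
Hypothesis sqZ : forall nu, sqint P (Z nu).
Hypothesis ZZ : forall nu mu, ip P (Z nu) (Z mu) = (nu == mu)%:R.
Hypothesis ZX : forall nu u, @unit_box R n u ->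
  ip P (Z nu) (X u) = field_sd (val nu) * field_fun (val nu) u.

Definition field_partial (F : {fset posindex n}) u w : R :=
  \sum_(nu <- F) (field_sd (val nu) * field_fun (val nu) u) * Z nu w.

Lemma sqint_field_partial F u : sqint P (field_partial F u).
Proof. by apply: sqint_sum => nu _; exact: sqintZ. Qed.

(** Bessel's identity: the partial sum is the orthogonal projection of [X u] on the span of the
    [Z nu] with nu in F. *)
Lemma field_defect F u : @unit_box R n u ->
  ip P (fun w => X u w - field_partial F u w) (fun w => X u w - field_partial F u w) =
  field_cov u u - \sum_(nu <- F) (field_sd (val nu) * field_fun (val nu) u) ^+ 2.
Proof.
move=> ub; have sF := sqint_field_partial F u.
rewrite ipBB//; last exact: sqX.
rewrite covX//.
have -> : ip P (field_partial F u) (field_partial F u) =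
    \sum_(nu <- F) (field_sd (val nu) * field_fun (val nu) u) ^+ 2.
  rewrite ip_suml//; apply: eq_big_seq => i ir; rewrite ip_sumr//.
  rewrite (bigD1_seq i)//= ZZ eqxx mulr1 big1_seq ?addr0 ?expr2// => j /andP[ji _].
  by rewrite ZZ eq_sym (negbTE ji) mulr0.
have -> : ip P (X u) (field_partial F u) =
    \sum_(nu <- F) (field_sd (val nu) * field_fun (val nu) u) ^+ 2.
  rewrite ip_sumr//; last exact: sqX.
  by apply: eq_bigr => nu _; rewrite ipC ZX// expr2.
ring.
Qed.

(** Enlarging F only decreases the defect, so the estimate on a cube holds for every finite set
    containing it. This is convergence of the unordered series, with a bound free of u. *)
Lemma field_defect_box M (F : {fset posindex n}) u : (0 < M)%N ->
  (box_index M `<=` F)%fset -> @unit_box R n u ->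
  ip P (fun w => X u w - field_partial F u w) (fun w => X u w - field_partial F u w) <=
  n%:R * (16 / M%:R).
Proof.
move=> M0 MF ub; rewrite field_defect//; apply: le_trans (mercer_box M0 ub).
apply: le_trans (ler_norm _); rewrite lerD2l lerN2.
by apply: sumr_fsubset => // nu; exact: sqr_ge0.
Qed.

End field_mean_square.

(** * The squared norm *)

Section square_comparison.
Context d (T : measurableType d) (R : realType) (mu : {measure set T -> \bar R}).
Variables (D : set T) (mD : measurable D) (f g : T -> R).
Hypotheses (mf : measurable_fun D f) (mg : measurable_fun D g).

(** Used with f and g in both orders, so that each squared norm is bounded by the other. The
    difference of the integrands is a perfect square divided by h. *)
Lemma integral_sqr_le (h : R) : 0 < h ->
  (\int[mu]_(x in D) (f x ^+ 2)%:E <=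
   (1 + h)%:E * \int[mu]_(x in D) (g x ^+ 2)%:E +
   (1 + h^-1)%:E * \int[mu]_(x in D) ((f x - g x) ^+ 2)%:E)%E.
Proof.
move=> h0; have hV : 0 < h^-1 by rewrite invr_gt0.
have mg2 : measurable_fun D (fun x => (g x ^+ 2)%:E).
  by apply/measurable_EFinP; exact: measurable_funX.
have mfg2 : measurable_fun D (fun x => ((f x - g x) ^+ 2)%:E).
  by apply/measurable_EFinP; apply: measurable_funX; exact: measurable_funB.
have mZ (k : R) (u : T -> R) : measurable_fun D (fun x => (u x)%:E) ->
    measurable_fun D (fun x => (k%:E * (u x)%:E)%E).
  by move=> mu'; exact: measurable_funeM.
have g0 x : D x -> (0 <= (g x ^+ 2)%:E)%E by rewrite lee_fin sqr_ge0.
have fg0 x : D x -> (0 <= ((f x - g x) ^+ 2)%:E)%E by rewrite lee_fin sqr_ge0.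
have h10 : (0 <= (1 + h)%:E)%E by rewrite lee_fin; lra.
have h20 : (0 <= (1 + h^-1)%:E)%E by rewrite lee_fin; lra.
rewrite -!ge0_integralZl// -ge0_integralD//; last 4 first.
- by move=> x Dx; rewrite mule_ge0// g0.
- exact: mZ.
- by move=> x Dx; rewrite mule_ge0// fg0.
- exact: mZ.
apply: ge0_le_integral => //.
- by move=> x _; rewrite lee_fin sqr_ge0.
- by apply/measurable_EFinP; exact: measurable_funX.
- by apply: emeasurable_funD; exact: mZ.
- move=> x Dx; rewrite -!EFinM -EFinD lee_fin -subr_ge0.
  have -> : (1 + h) * g x ^+ 2 + (1 + h^-1) * (f x - g x) ^+ 2 - f x ^+ 2 =
      h^-1 * (h * g x - (f x - g x)) ^+ 2 by field; rewrite gt_eqF.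
  by rewrite mulr_ge0 ?sqr_ge0// ltW.
Qed.

End square_comparison.

Section squeeze.
Context {R : realType}.
Implicit Types (N : \bar R) (q : nat -> R) (D : nat -> \bar R).

Lemma limn_einf_ge (D : nat -> \bar R) (c : \bar R) K :
  (forall k, (K <= k)%N -> c <= D k)%E -> (c <= limn_einf D)%E.
Proof.
move=> cD; rewrite limn_einf_lim; apply: lime_ge; first exact: is_cvg_einfs.
exists K => // k /= Kk; apply: le_ereal_inf_tmp => _ [m /= km <-].
by apply: cD; exact: leq_trans Kk km.
Qed.

Lemma ler_scale_addgt0 (x y : R) : 0 <= y -> (forall h, 0 < h -> x <= (1 + h) * y) ->
  x <= y.
Proof.
move=> y0 H; apply/ler_addgt0Pr => e e0.
have y1 : 0 < y + 1 by lra.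
have := H (e / (y + 1)) (divr_gt0 e0 y1).
rewrite mulrDl mul1r => h; apply: le_trans h _; rewrite lerD2l.
by rewrite mulrAC ler_pdivrMr// ler_pM2l// lerDl.
Qed.

(** An inequality with error term [D k] for all late k survives with the error removed, because
    liminf D = 0. Monotonicity of q turns a bound at late ranks into one at every rank; h tends to 0
    last. *)
Lemma sup_squeeze N q D : (0 <= N)%E -> N \is a fin_num ->
  (forall k, 0 <= q k) -> nondecreasing_seq q -> (forall k, (0 <= D k)%E) ->
  limn_einf D = 0%E ->
  (forall h k, 0 < h -> (N <= (1 + h)%:E * (q k)%:E + (1 + h^-1)%:E * D k)%E) ->
  (forall h k, 0 < h -> ((q k)%:E <= (1 + h)%:E * N + (1 + h^-1)%:E * D k)%E) ->
  N = ereal_sup (range (fun k => (q k)%:E)).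
Proof.
move=> + Nfin; rewrite -(fineK Nfin); move: (fine N) => r {N Nfin}.
rewrite lee_fin => r0 q0 ndq D0 limD H1 H2.
have key h K (x y : R) : 0 < h ->
    (forall k, (K <= k)%N -> (x%:E <= y%:E + (1 + h^-1)%:E * D k)%E) -> x <= y.
  move=> h0 H; have h1 : 0 < 1 + h^-1 by rewrite addr_gt0 ?invr_gt0.
  have : (((x - y) / (1 + h^-1))%:E <= limn_einf D)%E.
    apply: (@limn_einf_ge _ _ K) => k Kk; have := H k Kk; have := D0 k.
    case: (D k) => [s _| _ _|//]; last by rewrite leey.
    rewrite -EFinM -EFinD !lee_fin => hs.
    by rewrite ler_pdivrMr// lerBlDl mulrC.
  by rewrite limD lee_fin pmulr_lle0 ?invr_gt0// subr_le0.
have qr k : q k <= r.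
  apply: ler_scale_addgt0 => // h h0; apply: (key h k) => // j kj.
  by apply: le_trans (H2 h j h0); rewrite lee_fin ndq.
have qS k : ((q k)%:E <= ereal_sup (range (fun k => (q k)%:E)))%E.
  by apply: ereal_sup_ubound; exists k.
have Sr : (ereal_sup (range (fun k => (q k)%:E)) <= r%:E)%E.
  by apply: ge_ereal_sup => _ [k _ <-]; rewrite lee_fin.
apply/eqP; rewrite eq_le Sr andbT.
have Sfin : ereal_sup (range (fun k => (q k)%:E)) \is a fin_num.
  by rewrite fin_numElt (lt_le_trans _ (qS 0%N)) ?ltNyr// (le_lt_trans Sr) ?ltry.
move: qS; rewrite -(fineK Sfin); move: (fine _) => s qS.
rewrite lee_fin; apply: ler_scale_addgt0.
  by rewrite -lee_fin (le_trans _ (qS 0%N))// lee_fin.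
move=> h h0; apply: (key h 0%N) => // k _; apply: le_trans (H1 h k h0) _.
rewrite leeD2r// -EFinM lee_fin ler_pM2l; last by lra.
by rewrite -lee_fin.
Qed.

End squeeze.

Section box_esum.
Context {R : realType} {n : nat}.

Lemma esum_box_index (f : posindex n -> R) : (forall nu, 0 <= f nu) ->
  (\esum_(nu in [set: posindex n]) (f nu)%:E)%E =
  ereal_sup (range (fun k => (\sum_(nu <- box_index k) f nu)%:E)).
Proof.
move=> f0; apply/eqP; rewrite eq_le; apply/andP; split.
  apply: ge_ereal_sup => _ [A [Afin _] <-].
  have [k Ak] := fset_sub_box_index (fset_set A).
  apply: (@le_trans _ _ (\sum_(nu <- box_index k) f nu)%:E); last first.
    by apply: ereal_sup_ubound; exists k.
  by rewrite fsbig_finite//= sumEFin lee_fin; exact: sumr_fsubset.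
apply: ge_ereal_sup => _ [k _ <-]; apply: esum_ge.
exists [set` box_index k]; first by split.
by rewrite fsbig_finite//= set_fsetK sumEFin.
Qed.

End box_esum.

(** * Tonelli for a jointly measurable field on the box *)

Section tonelli_box.
Context {R : realType} d (Omega : measurableType d) (P : probability Omega R).
Variables (n : nat) (g : Omega -> n.-tuple R -> R).
Local Notation box := (@unit_box R n).
Local Notation mu := (@lebesgue_tuple R n).
Hypothesis mg : measurable_fun ([set: Omega] `*` box) (fun x => g x.1 x.2).

Lemma measurable_box_section w : measurable_fun box (g w).
Proof.
have mB : measurable ([set: Omega] `*` box).
  by apply: measurableX => //; exact: measurable_unit_box.
have mbox : measurable box by exact: measurable_unit_box.
have mf : measurable_fun setT ((fun x => g x.1 x.2) \_ ([set: Omega] `*` box)).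
  by apply/(measurable_restrict _ mB measurableT); rewrite setTI.
rewrite -[box]setTI; apply/(measurable_restrict _ mbox measurableT).
have := measurableT_comp mf (@pair1_measurable _ _ Omega (n.-tuple R) w).
rewrite (_ : _ \o _ = g w \_ box)//; apply/funext => u; rewrite /= !patchE.
congr (if _ then _ else _).
by apply/idP/idP; rewrite !inE /=; [case|split].
Qed.

Lemma tonelli_box :
  [/\ measurable_fun setT (fun w => \int[mu]_(u in box) (g w u ^+ 2)%:E)%E,
  measurable_fun box (fun u => \int[P]_w (g w u ^+ 2)%:E)%E &
  \int[P]_w \int[mu]_(u in box) (g w u ^+ 2)%:E =
   \int[mu]_(u in box) \int[P]_w (g w u ^+ 2)%:E]%E.
Proof.
(* Extension by zero off the box, since Tonelli is applied on the full product space. *)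
pose f : Omega * n.-tuple R -> \bar R :=
  (fun x => (g x.1 x.2 ^+ 2)%:E) \_ ([set: Omega] `*` box).
have mB : measurable ([set: Omega] `*` box).
  by apply: measurableX => //; exact: measurable_unit_box.
have mf : measurable_fun setT f.
  apply/(measurable_restrict _ mB measurableT); rewrite setTI.
  by apply/measurable_EFinP; exact: measurable_funX.
have f0 x : (0 <= f x)%E.
  by rewrite /f patchE; case: ifPn => // _; rewrite lee_fin sqr_ge0.
have fE w u : f (w, u) = ((fun u => (g w u ^+ 2)%:E) \_ box) u.
  rewrite /f !patchE; congr (if _ then _ else _).
  by apply/idP/idP; rewrite !inE /=; [case|split].
have FE w : fubini_F mu f w = (\int[mu]_(u in box) (g w u ^+ 2)%:E)%E.
  rewrite /fubini_F [RHS]integral_mkcond; apply: eq_integral => u _; exact: fE.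
have GE : fubini_G P f = (fun u => \int[P]_w (g w u ^+ 2)%:E)%E \_ box.
  apply/funext => u; rewrite /fubini_G patchE; case: ifPn => ub.
    by apply: eq_integral => w _; rewrite fE patchE ub.
  by rewrite integral0_eq// => w _; rewrite fE patchE (negbTE ub).
split.
  have : measurable_fun setT (fubini_F mu f) by exact: measurable_fun_fubini_tonelli_F.
  by rewrite (_ : fubini_F _ _ = fun w => (\int[mu]_(u in box) (g w u ^+ 2)%:E)%E)//; apply/funext.
  have mbox : measurable box by exact: measurable_unit_box.
  rewrite -[box]setTI; apply/(measurable_restrict _ mbox measurableT).
  by rewrite -GE; exact: measurable_fun_fubini_tonelli_G.
transitivity (\int[P]_w fubini_F mu f w)%E.
  by apply: eq_integral => w _; rewrite FE.
transitivity (\int[mu]_u fubini_G P f u)%E; first exact: fubini_tonelli.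
by rewrite GE [RHS]integral_mkcond.
Qed.

End tonelli_box.

(** * Almost sure identity between the squared norm and the series *)

Section field_norm.
Context {R : realType} d (Omega : measurableType d) (P : probability Omega R).
Variables (n : nat) (X : n.-tuple R -> {RV P >-> R}) (Z : posindex n -> {RV P >-> R}).
Local Notation box := (@unit_box R n).
Local Notation mu := (@lebesgue_tuple R n).
Hypothesis sqX : forall u, box u -> sqint P (X u).
Hypothesis covX : forall u v, box u -> box v -> ip P (X u) (X v) = field_cov u v.
Hypothesis sqZ : forall nu, sqint P (Z nu).
Hypothesis ZZ : forall nu mu, ip P (Z nu) (Z mu) = (nu == mu)%:R.
Hypothesis ZX : forall nu u, box u ->
  ip P (Z nu) (X u) = field_sd (val nu) * field_fun (val nu) u.
Hypothesis mX : measurable_fun ([set: Omega] `*` box) (fun x => X x.2 x.1).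

Let S k u w := field_partial Z (box_index k) u w.
Let q k w : R := \sum_(nu <- box_index k) (field_sd (val nu) * Z nu w) ^+ 2.
Let N w := (\int[mu]_(u in box) (X u w ^+ 2)%:E)%E.
Let D k w := (\int[mu]_(u in box) ((X u w - S k u w) ^+ 2)%:E)%E.

Lemma integral_unit_box_cst (c : R) : (\int[mu]_(u in box) c%:E = c%:E)%E.
Proof.
rewrite integral_cst; last exact: measurable_unit_box.
by rewrite -[RHS]mule1; congr mule; exact: lebesgue_unit_box1.
Qed.

Lemma measurable_field_fun nu : measurable_fun setT (@field_fun R n nu).
Proof.
apply: (@measurable_prod_tnth R n (fun k => sine_fun (nu k))) => k.
by apply: continuous_measurable_fun; exact: continuous_sine_fun.
Qed.

Lemma measurable_field_partial F :
  measurable_fun setT (fun x : Omega * n.-tuple R => field_partial Z F x.2 x.1).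
Proof.
apply: measurable_sum => nu; apply: measurable_funM.
  apply: measurable_funM => //.
  exact: (measurableT_comp (measurable_field_fun (val nu)) measurable_snd).
exact: (measurableT_comp (measurable_funPT (Z nu)) measurable_fst).
Qed.

(** Parseval at a fixed outcome w: the random coefficients are frozen and orthonormality in L^2 of
    the box leaves the diagonal terms. *)
Lemma integral_field_partial_sqr (F : {fset posindex n}) w :
  (\int[mu]_(u in box) (field_partial Z F u w ^+ 2)%:E =
   (\sum_(nu <- F) (field_sd (val nu) * Z nu w) ^+ 2)%:E)%E.
Proof.
pose a nu := field_sd (val nu) * Z nu w.
have mbox := @measurable_unit_box R n.
pose h (nu nu' : posindex n) (u : n.-tuple R) : R := field_fun (val nu) u * field_fun (val nu') u.
have ih nu nu' : mu.-integrable box (EFin \o h nu nu').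
  by have [h1 _] := @integral_field_fun2 R n nu nu'; exact: h1.
have hE nu nu' : \int[mu]_(u in box) h nu nu' u = (nu == nu')%:R.
  by have [_] := @integral_field_fun2 R n nu nu'; rewrite /Rintegral => ->.
have iZ k (f : n.-tuple R -> R) : mu.-integrable box (EFin \o f) ->
    mu.-integrable box (EFin \o (fun u => k * f u)).
  by move=> fi; have := integrableZl mbox k fi.
have E u : field_partial Z F u w ^+ 2 =
    \sum_(nu <- F) \sum_(nu' <- F) a nu * a nu' * h nu nu' u.
  rewrite expr2 mulr_suml; apply: eq_bigr => nu _; rewrite mulr_sumr.
  by apply: eq_bigr => nu' _; rewrite /a /h; ring.
have i1 nu : mu.-integrable box
    (EFin \o (fun u => \sum_(nu' <- F) a nu * a nu' * h nu nu' u)).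
  by apply: integrable_Rsum => // nu' _; exact: iZ.
under eq_integral do rewrite E.
rewrite -[LHS]fineK; last first.
  by apply: (integrable_fin_num mbox); apply: integrable_Rsum => // nu _; exact: i1.
rewrite -[fine _]/(\int[mu]_(u in box) \sum_(nu <- F) \sum_(nu' <- F) a nu * a nu' * h nu nu' u).
rewrite Rintegral_sum//; congr EFin; apply: eq_big_seq => nu nuF.
rewrite Rintegral_sum//; last by move=> nu' _; exact: iZ.
rewrite (bigD1_seq nu)//= RintegralZl// hE eqxx mulr1 big1 ?addr0 -?expr2// => nu' nn.
by rewrite RintegralZl// hE eq_sym (negbTE nn) mulr0.
Qed.

Let mXS k : measurable_fun ([set: Omega] `*` box) (fun x => X x.2 x.1 - S k x.2 x.1).
Proof.
apply: measurable_funB => //.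
exact: (measurable_funTS (measurable_field_partial _)).
Qed.

Let ms w : measurable_fun box (X ^~ w).
Proof. exact: (measurable_box_section (g := fun w u => X u w)). Qed.

Let mS k w : measurable_fun box (S k ^~ w).
Proof.
apply: (measurable_box_section (g := fun w u => S k u w)).
exact: (measurable_funTS (measurable_field_partial _)).
Qed.

Let D_ge0 k w : (0 <= D k w)%E.
Proof. by apply: integral_ge0 => u _; rewrite lee_fin sqr_ge0. Qed.

Let mD k : measurable_fun setT (D k).
Proof. by have [] := tonelli_box P (g := fun w u => X u w - S k u w) (mXS k). Qed.

(** After Tonelli the mean-square bound is uniform in u and the box has measure 1. The shift to k.+1
    meets the condition 0 < M of [field_defect_box]. *)
Let int_D k : (\int[P]_w D k.+1 w <= (n%:R * (16 / k.+1%:R))%:E)%E.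
Proof.
have [_ mG ->] := tonelli_box P (g := fun w u => X u w - S k.+1 u w) (mXS k.+1).
rewrite -integral_unit_box_cst.
apply: ge0_le_integral => //.
- exact: measurable_unit_box.
- by move=> u _; apply: integral_ge0 => w _; rewrite lee_fin sqr_ge0.
- move=> u ub.
  rewrite sqint_sqE; last by apply: sqintB; [exact: sqX|exact: sqint_field_partial].
  by rewrite lee_fin; exact: (field_defect_box sqX covX sqZ ZZ ZX).
Qed.

Lemma field_norm_measurable : measurable_fun setT N.
Proof. by have [] := tonelli_box P (g := fun w u => X u w) mX. Qed.

Let N_ge0 w : (0 <= N w)%E.
Proof. by apply: integral_ge0 => u _; rewrite lee_fin sqr_ge0. Qed.

(** The expected squared norm is at most 1, as the kernel is at most 1 on the diagonal. *)
Let N_fin : {ae P, forall w, N w \is a fin_num}.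
Proof.
have iN : P.-integrable setT N.
  apply/integrableP; split; first exact: field_norm_measurable.
  under eq_integral do rewrite gee0_abs//.
  have [_ mG ->] := tonelli_box P (g := fun w u => X u w) mX.
  apply: (@le_lt_trans _ _ 1%E); last exact: ltry.
  rewrite -integral_unit_box_cst.
  apply: ge0_le_integral => //.
  - exact: measurable_unit_box.
  - by move=> u _; apply: integral_ge0 => w _; rewrite lee_fin sqr_ge0.
  - move=> u ub; rewrite sqint_sqE; last exact: sqX.
    rewrite covX// lee_fin; apply: prodr_ile1 => k _.
    exact: bridge_cov_itv.
by apply: filterS (integrable_ae measurableT iN) => w; exact.
Qed.

Let D_cvg : {ae P, forall w, limn_einf (fun k => D k.+1 w) = 0%E}.
Proof.
pose L w := limn_einf (fun k => D k.+1 w).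
have L0 w : (0 <= L w)%E by apply: (@limn_einf_ge _ _ _ 0%N).
have mL : measurable_fun setT L.
  rewrite /L /limn_einf; apply: measurableT_comp => //.
  apply: measurable_fun_limn_esup => k.
  by apply: measurableT_comp => //; exact: mD.
have iL : (\int[P]_w `|L w| = 0)%E.
  under eq_integral do rewrite gee0_abs//.
  apply/eqP; rewrite eq_le integral_ge0// andbT.
  apply: le_trans (fatou P measurableT (fun k => mD k.+1) (fun k w _ => D_ge0 k.+1 w)) _.
  apply/lee_addgt0Pr => e e0; rewrite add0e.
  apply: (@limn_einf_le _ _ _ (Num.truncn (e^-1 * (n%:R * 16))).+1) => k kK.
  apply: le_trans (int_D k) _; rewrite lee_fin mulrA ler_pdivrMr ?ltr0n//.
  rewrite -ler_pdivrMl//; apply: le_trans (ltW (truncnS_gt _)) _.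
  by rewrite ler_nat leqW.
have := (ae_eq_integral_abs P measurableT mL).1 iL.
by apply: filterS => w /(_ I).
Qed.

Theorem field_norm_ae : {ae P, forall w, N w =
  \esum_(nu in [set: posindex n]) ((field_sd (val nu) * Z nu w) ^+ 2)%:E}%E.
Proof.
apply: filterS2 N_fin D_cvg => w Nfin limD.
rewrite esum_box_index; last by move=> nu; exact: sqr_ge0.
rewrite (@sup_squeeze R (N w) (fun k => q k.+1 w) (fun k => D k.+1 w))//.
(* Shifting the index by one leaves the supremum unchanged, because q is nondecreasing. *)
- apply/eqP; rewrite eq_le; apply/andP; split; apply: ge_ereal_sup => _ [k _ <-].
    by apply: ereal_sup_ubound; exists k.+1.
  apply: (@le_trans _ _ (q k.+1 w)%:E); last by apply: ereal_sup_ubound; exists k.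
  rewrite lee_fin; apply: sumr_fsubset; first exact: sub_box_index.
  by move=> nu; exact: sqr_ge0.
- by move=> k; apply: sumr_ge0 => nu _; exact: sqr_ge0.
- move=> i j ij; apply: sumr_fsubset; first exact: sub_box_index.
  by move=> nu; exact: sqr_ge0.
- move=> h k h0; rewrite -integral_field_partial_sqr.
  by apply: (integral_sqr_le _ (@measurable_unit_box R n) (ms w) (mS k.+1 w) h0).
- move=> h k h0; rewrite -integral_field_partial_sqr.
  rewrite (_ : D k.+1 w = \int[mu]_(u in box) ((S k.+1 u w - X u w) ^+ 2)%:E)%E.
    by apply: (integral_sqr_le _ (@measurable_unit_box R n) (mS k.+1 w) (ms w) h0).
  by apply: eq_integral => u _; rewrite -sqrrN opprB.
Qed.

Lemma field_series_measurable : measurable_fun setT (fun w =>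
  \esum_(nu in [set: posindex n]) ((field_sd (val nu) * Z nu w) ^+ 2)%:E)%E.
Proof.
apply: (emeasurable_fun_cvg (fun k w => (q k w)%:E)).
  move=> k; apply/measurable_EFinP; apply: measurable_sum => nu.
  by apply: measurable_funX; apply: measurable_funM => //; exact: measurable_funPT.
move=> w _; rewrite esum_box_index; last by move=> nu; exact: sqr_ge0.
apply: ereal_nondecreasing_cvgn => i j ij; rewrite lee_fin; apply: sumr_fsubset.
  exact: sub_box_index.
by move=> nu; exact: sqr_ge0.
Qed.

End field_norm.

(** * The Brownian tent *)

Section faces.
Context {R : realType} {p : nat} (H : {set 'I_p}).
Implicit Types (u v : #|H|.-tuple R) (t : 'rV[R]_p).

Definition face_coord t : #|H|.-tuple R := [tuple t ord0 (enum_val k) | k < #|H|].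

Lemma face_point_enum_val u k : face_point u ord0 (enum_val k) = tnth u k.
Proof.
rewrite mxE (enum_val_nth (enum_val k)) index_uniq ?enum_uniq//.
  by rewrite -tnth_nth.
by rewrite -cardE.
Qed.

Lemma face_point_out u j : j \notin H -> face_point u ord0 j = 1.
Proof.
move=> jH; rewrite mxE nth_default// size_tuple cardE leqNgt index_mem mem_enum.
exact: jH.
Qed.

Lemma face_point_coord t : face_point (face_coord t) = face_proj H t.
Proof.
apply/rowP => j; rewrite [RHS]mxE; case: ifPn => jH; last exact: face_point_out.
by rewrite -(enum_rankK_in jH jH) face_point_enum_val tnth_mktuple.
Qed.

Lemma face_coord_box t : cube t -> @unit_box R #|H| (face_coord t).
Proof. by move=> tc k; rewrite tnth_mktuple; exact: tc. Qed.

Lemma face_point_face u : @unit_box R #|H| u -> face H (face_point u).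
Proof.
move=> ub; exists (face_point u) => [j|].
  have [jH|jH] := boolP (j \in H).
    by rewrite -(enum_rankK_in jH jH) face_point_enum_val; exact: ub.
  by rewrite face_point_out// ler01 lexx.
by apply/rowP => j; rewrite [LHS]mxE; case: ifPn => // jH; rewrite face_point_out.
Qed.

Lemma faceP s : face H s -> exists2 u, @unit_box R #|H| u & s = face_point u.
Proof.
move=> [t tc <-]; exists (face_coord t); first exact: face_coord_box.
by rewrite face_point_coord.
Qed.

Lemma tent_cov_face_point u v :
  tent_cov H (face_point u) (face_point v) = field_cov u v.
Proof.
rewrite /tent_cov big_enum_val/=; apply: eq_bigr => k _.
by rewrite !face_point_enum_val.
Qed.

Lemma tent_eigenfun_face_point (nu : multiindex H) u :
  tent_eigenfun nu (face_point u) = field_fun (val nu) u.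
Proof. by apply: eq_bigr => k _; rewrite face_point_enum_val. Qed.

Lemma tent_eigensystem :
  orthonormal_eigensystem H (@tent_cov R p H)
    (fun nu : multiindex H => ((mi_norm nu)%:R * pi ^+ #|H|) ^- 2)
    (@tent_eigenfun R p H).
Proof.
split=> [nu mu|nu|nu s /faceP[u ub ->]].
- rewrite /face_integral; under eq_integral do rewrite !tent_eigenfun_face_point.
  by have [_] := @integral_field_fun2 R #|H| nu mu.
- by have := exprn_gt0 2 (@field_sd_gt0 R _ nu); rewrite /field_sd exprVn.
- rewrite /face_integral; under eq_integral do
    rewrite tent_cov_face_point tent_eigenfun_face_point.
  rewrite (@integral_field_cov R #|H| nu u ub) tent_eigenfun_face_point.
  by rewrite /field_sd exprVn.
Qed.

Lemma poweR2 (x : \bar R) : (0 <= x -> x `^ 2 = x ^+ 2)%E.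
Proof.
case: x => [r r0| _|//]; last by rewrite poweRyr ?pnatr_eq0// expe2 mulyy.
by rewrite poweR_EFin powR_mulrn -?lee_fin.
Qed.

Lemma face_L2norm_sqr (f : 'rV[R]_p -> R) :
  (face_L2norm H f ^+ 2)%E =
  (\int[lebesgue_tuple #|H|]_(u in @unit_box R #|H|) (f (face_point u) ^+ 2)%:E)%E.
Proof.
rewrite -poweR2 ?Lnorm_ge0// /face_L2norm poweR_Lnorm ?pnatr_eq0//.
rewrite [RHS]integral_mkcond; apply: eq_integral => u _; rewrite !patchE.
case: ifPn => _; last by rewrite abse0 poweR0r ?pnatr_eq0.
by rewrite poweR2 ?abse_ge0// expe2 -abseM gee0_abs -EFinM ?expr2// lee_fin -expr2 sqr_ge0.
Qed.

End faces.

Lemma ae_eq_pushforward {R : realType} d (Omega : measurableType d)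
    (P : probability Omega R) (f g : Omega -> \bar R) (B : set (\bar R)) :
  measurable_fun setT f -> measurable_fun setT g -> {ae P, forall w, f w = g w} ->
  measurable B -> pushforward P f B = pushforward P g B.
Proof.
move=> mf mg fg mB.
have mp (h : Omega -> \bar R) : measurable_fun setT h -> measurable (h @^-1` B).
  by move=> mh; rewrite -[X in measurable X]setTI; exact: mh.
have E (h : Omega -> \bar R) : measurable_fun setT h ->
    pushforward P h B = (\int[P]_w (\1_(h @^-1` B) w)%:E)%E.
  by move=> mh; rewrite integral_indic ?setIT//; exact: mp.
rewrite !E//; apply: ge0_ae_eq_integral => //.
- by apply/measurable_EFinP; apply: measurable_indic; exact: mp.
- by apply/measurable_EFinP; apply: measurable_indic; exact: mp.
- apply: filterS fg => w fgw _; rewrite !indicE.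
  suff -> : (w \in f @^-1` B) = (w \in g @^-1` B) by [].
  by apply/idP/idP; rewrite !inE/= fgw.
Qed.

Section tent.
Context {R : realType} d (Omega : measurableType d) (P : probability Omega R).
Variables (p : nat) (H : {set 'I_p}) (T : 'rV[R]_p -> {RV P >-> R}).
Hypothesis hT : brownian_tent H T.

Definition tent_field (u : #|H|.-tuple R) := T (face_point u).

Lemma tent_field_mom u v : @unit_box R #|H| u -> @unit_box R #|H| v ->
  (\int[P]_w (tent_field u w * tent_field v w)%:E)%E = (field_cov u v)%:E.
Proof.
move=> ub vb; have [_ _ h] := hT.
by have := h _ _ (face_point_face ub) (face_point_face vb); rewrite unlock tent_cov_face_point.
Qed.

(** From the covariance on the diagonal: the integrand is nonnegative there and its expectation is a
    real number. *)
Lemma sqint_tent_field u : @unit_box R #|H| u -> sqint P (tent_field u).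
Proof.
move=> ub.
have [] := @sqint_lty R d Omega P (tent_field u) (field_cov u u) => //.
by rewrite -tent_field_mom//; under eq_integral do rewrite expr2.
Qed.

Lemma ip_tent_field u v : @unit_box R #|H| u -> @unit_box R #|H| v ->
  ip P (tent_field u) (tent_field v) = field_cov u v.
Proof. by move=> ub vb; rewrite /ip /Rintegral tent_field_mom. Qed.

Lemma tent_field_mean u : @unit_box R #|H| u -> \int[P]_w tent_field u w = 0.
Proof.
move=> ub; have [_ h _] := hT.
by have := h _ (face_point_face ub); rewrite unlock /Rintegral => ->.
Qed.

Lemma tent_field_cos (m : nat) (a : 'I_m -> R) (t : 'I_m -> #|H|.-tuple R) c :
  (forall i, @unit_box R #|H| (t i)) ->
  let S := fun w => \sum_(i < m) a i * tent_field (t i) w in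
  \int[P]_w cos (S w + c) = expR (- (ip P S S / 2)) * cos c.
Proof.
move=> tb S.
have sS : sqint P S.
  by apply: sqint_sum => i _; apply: sqintZ; exact: sqint_tent_field.
have mS : measurable_fun setT S by case: sS.
pose S' : {RV P >-> R} := HB.pack S (@isMeasurableFun.Build _ _ _ _ S mS).
have gS : is_gaussian P S'.
  have [h _ _] := hT.
  exact: (h m a (fun i => face_point (t i)) (fun i => face_point_face (tb i))).
apply: (@Rintegral_gaussian_cos _ _ _ P S' (ip P S S) c gS).
- by case: sS.
- rewrite Rintegral_sum//; last first.
    by move=> i _; apply: sqint_integrable; apply: sqintZ; exact: sqint_tent_field.
  rewrite big1// => i _; rewrite RintegralZl ?tent_field_mean ?mulr0//.
  by apply: sqint_integrable; exact: sqint_tent_field.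
- by apply: eq_Rintegral => w _; rewrite expr2.
Qed.

End tent.

Theorem mainTheorem3 (R : realType) (d : measure_display)
    (Omega : measurableType d) (P : probability Omega R)
    (p : nat) (hp : (1 <= p)%N) (H : {set 'I_p})
    (T : 'rV[R]_p -> {RV P >-> R}) (hT : brownian_tent H T) :
  exists Z : multiindex H -> {RV P >-> R},
    [/\ iid_standard_gaussian P (fun nu => Z nu : Omega -> R),
        orthonormal_eigensystem H (@tent_cov R p H)
          (fun nu : multiindex H => ((mi_norm nu)%:R * pi ^+ #|H|) ^- 2)
          (@tent_eigenfun R p H),
        uniform_mean_square_sum P (@cube R p)
          (fun (nu : multiindex H) t w =>
             Z nu w / ((mi_norm nu)%:R * pi ^+ #|H|) *
             \prod_(k < #|H|)
               (Num.sqrt 2 * sin ((val nu k)%:R * pi * t ord0 (enum_val k))))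
          (fun t w => T (face_proj H t) w) &
        jointly_measurable H (fun t => T t : Omega -> R) ->
        let sqnorm : Omega -> \bar R :=
          fun w => (face_L2norm H (fun t => T t w) ^+ 2)%E in
        let series : Omega -> \bar R := fun w =>
          \esum_(nu in [set: multiindex H])
            (Z nu w ^+ 2 / ((mi_norm nu)%:R ^+ 2 * pi ^+ (2 * #|H|)))%:E in
        [/\ measurable_fun [set: Omega] sqnorm,
            measurable_fun [set: Omega] series,
            {ae P, forall w, sqnorm w = series w} &
            forall B : set (\bar R), measurable B ->
              pushforward P sqnorm B = pushforward P series B]].
Proof.
have [Z [sZ ZZ ZX cosZ]] := field_components (sqint_tent_field hT)
  (ip_tent_field hT) (tent_field_cos hT).
exists Z; split.
- exact: cos_iid_standard_gaussian cosZ.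
- exact: tent_eigensystem.
(* M brings the bound of [field_defect_box] below e; as it does not involve t, the convergence is
   uniform on the cube. *)
- move=> e e0; pose M := (Num.truncn (e^-1 * (#|H|%:R * 16))).+1.
  exists (box_index M) => F MF t tc.
  have ub : @unit_box R #|H| (face_coord H t) := face_coord_box tc.
  have -> : (fun w => (T (face_proj H t) w - \sum_(nu <- F)
      Z nu w / ((mi_norm nu)%:R * pi ^+ #|H|) *
      \prod_(k < #|H|) (Num.sqrt 2 * sin ((val nu k)%:R * pi * t ord0 (enum_val k)))) ^+ 2) =
      (fun w => (tent_field T (face_coord H t) w - field_partial Z F (face_coord H t) w) ^+ 2).
    apply/funext => w; rewrite /tent_field face_point_coord; congr ((_ - _) ^+ 2).
    apply: eq_bigr => nu _; rewrite [RHS]mulrC mulrA; congr (_ * _).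
    by apply: eq_bigr => k _; rewrite tnth_mktuple.
  rewrite unlock sqint_sqE; last first.
    by apply: sqintB; [exact: sqint_tent_field|exact: sqint_field_partial].
  rewrite lee_fin.
  apply: le_trans (field_defect_box (sqint_tent_field hT) (ip_tent_field hT) sZ ZZ ZX _ MF ub) _ => //.
  rewrite mulrA ler_pdivrMr ?ltr0n// -ler_pdivrMl//.
  exact: (ltW (truncnS_gt _)).
- move=> jm sqnorm series.
  have sqE : sqnorm = (fun w => (\int[lebesgue_tuple #|H|]_(u in @unit_box R #|H|)
      (tent_field T u w ^+ 2)%:E)%E).
    by apply/funext => w; exact: face_L2norm_sqr.
  have serE : series = (fun w => \esum_(nu in [set: posindex #|H|])
      ((field_sd (val nu) * Z nu w) ^+ 2)%:E)%E.
    apply/funext => w; apply: eq_esum => nu _; congr EFin.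
    by rewrite /field_sd exprMn exprVn [RHS]mulrC exprMn -exprM mulnC.
  have msq : measurable_fun setT sqnorm.
    by rewrite sqE; exact: (field_norm_measurable (X := tent_field T) jm).
  have mser : measurable_fun setT series.
    by rewrite serE; exact: field_series_measurable.
  have ae : {ae P, forall w, sqnorm w = series w}.
    rewrite sqE serE.
    exact: (field_norm_ae (sqint_tent_field hT) (ip_tent_field hT) sZ ZZ ZX jm).
  split => // B mB; exact: ae_eq_pushforward.
Qed.
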